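(* Let $H\subset\mathbb R^n$ be a bounded, open, mildly regular set, $m\ge1$, $\mathcal B$ a finite index set. Assume: for each $\beta\in\mathcal B$, $b_\beta\in C^m(\bar H)$ with $b_\beta(x)>0$ for all $x\in\bar H$; $\theta_\beta:H\to H$ is a $C^m$ map with components in $C^m(\bar H)$; for some norm $\|\cdot\|$ there exist $\mu\ge1$ and $\kappa<1$ with $\|\theta_\omega(x)-\theta_\omega(y)\|\le\kappa\|x-y\|$ for all $\omega\in\mathcal B_\mu$, $x,y\in H$; and there exists an integer $\mu'\ge1$ such that $b_\omega(x)<1$ for all $\omega\in\mathcal B_{\mu'}$ and all $x\in\bar H$. For $s\in\mathbb R$ let $\Lambda_s:C^m(\bar H)\to C^m(\bar H)$, $(\Lambda_sf)(x)=\sum_{\beta\in\mathcal B}(b_\beta(x))^sf(\theta_\beta(x))$. Then $s\mapsto r(\Lambda_s)$, $s\in\mathbb R$, is strictly decreasing and real analytic, and $\lim_{s\to\infty}r(\Lambda_s)=0$.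
   Context: $H$ is mildly regular if there exist $\eta>0$, $M\ge1$ such that whenever $x,y\in H$ with $\|x-y\|<\eta$ there is a Lipschitz $\psi:[0,1]\to H$ with $\psi(0)=x$, $\psi(1)=y$, $\int_0^1\|\psi'(t)\|dt\le M\|x-y\|$. $C^m(\bar H)$ is the Banach space of real $C^m$ functions on $H$ whose partial derivatives of order $\le m$ extend continuously to $\bar H$. $\mathcal B_\nu=\{(j_1,\ldots,j_\nu):j_k\in\mathcal B\}$; for $\omega=(j_1,\ldots,j_\nu)$, $\theta_\omega=\theta_{j_\nu}\circ\cdots\circ\theta_{j_1}$ and $b_\omega(x)=b_{j_\nu}(\theta_{(j_1,\ldots,j_{\nu-1})}(x))\cdots b_{j_2}(\theta_{j_1}(x))\,b_{j_1}(x)$. $r(\cdot)$ is the spectral radius. *)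

(* Defs.v *)
From HB Require Import structures.
From mathcomp Require Import all_boot all_order all_algebra.
From mathcomp Require Import all_classical all_reals all_analysis.
Set Implicit Arguments. Unset Strict Implicit. Unset Printing Implicit Defensive.
Import Order.TTheory GRing.Theory Num.Theory.
Import numFieldNormedType.Exports.
Local Open Scope classical_set_scope.
Local Open Scope ring_scope.

Definition ebasis {R : realType} {n : nat} (i : 'I_n) : 'rV[R]_n := delta_mx 0 i.

Definition pderiv {R : realType} {n : nat} (i : 'I_n) (f : 'rV[R]_n -> R)
  : 'rV[R]_n -> R := fun x => 'D_(ebasis i) f x.

Fixpoint iter_pderiv {R : realType} {n : nat} (idx : seq 'I_n) (f : 'rV[R]_n -> R)
  : 'rV[R]_n -> R :=
  match idx with
  | [::] => f
  | i :: l => pderiv i (iter_pderiv l f)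
  end.

Fixpoint Ck_on {R : realType} {n : nat} (k : nat) (H : set 'rV[R]_n)
  (f : 'rV[R]_n -> R) : Prop :=
  match k with
  | 0 => forall x, H x -> {for x, continuous f}
  | k'.+1 => (forall x, H x -> {for x, continuous f}) /\
             forall i : 'I_n, (forall x, H x -> derivable f x (ebasis i)) /\
                              Ck_on k' H (pderiv i f)
  end.

(* f (restricted to H) belongs to C^m(\bar H): f is C^m on H and every
   partial derivative of order <= m extends continuously to the closure *)
Definition CmBar {R : realType} {n : nat} (m : nat) (H : set 'rV[R]_n)
  (f : 'rV[R]_n -> R) : Prop :=
  Ck_on m H f /\
  forall idx : seq 'I_n, (size idx <= m)%N ->
    exists g : 'rV[R]_n -> R, {within closure H, continuous g} /\
      forall x, H x -> g x = iter_pderiv idx f x.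

(* mild regularity of H (w.r.t. the standard norm of 'rV[R]_n; the notion
   does not depend on the chosen norm) *)
Definition mildly_regular {R : realType} {n : nat} (H : set 'rV[R]_n) : Prop :=
  exists eta M : R, 0 < eta /\ 1 <= M /\
   forall x y, H x -> H y -> `|x - y| < eta ->
     exists psi : R -> 'rV[R]_n,
       psi 0 = x /\ psi 1 = y /\
       (forall t, 0 <= t <= 1 -> H (psi t)) /\
       (exists L : R, forall s t, 0 <= s <= 1 -> 0 <= t <= 1 ->
           `|psi s - psi t| <= L * `|s - t|) /\
       (\int[@lebesgue_measure R]_(t in [set t : R | (0 <= t <= 1)%R])
           (`|'D_1 psi t|%R%:E) <= (M * `|x - y|)%R%:E)%E.

Definition is_norm {R : realType} {n : nat} (N : 'rV[R]_n -> R) : Prop :=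
  (forall x, N x = 0 -> x = 0) /\
  (forall (c : R) x, N (c *: x) = `|c| * N x) /\
  (forall x y, N (x + y) <= N x + N y).

Fixpoint thetaw {R : realType} {n : nat} {B : Type}
  (theta : B -> 'rV[R]_n -> 'rV[R]_n) (w : seq B) (x : 'rV[R]_n) : 'rV[R]_n :=
  match w with
  | [::] => x
  | j :: w' => thetaw theta w' (theta j x)
  end.

Fixpoint bw {R : realType} {n : nat} {B : Type} (b : B -> 'rV[R]_n -> R)
  (theta : B -> 'rV[R]_n -> 'rV[R]_n) (w : seq B) (x : 'rV[R]_n) : R :=
  match w with
  | [::] => 1
  | j :: w' => b j x * bw b theta w' (theta j x)
  end.

Definition Lambda {R : realType} {n : nat} {B : finType} (b : B -> 'rV[R]_n -> R)
  (theta : B -> 'rV[R]_n -> 'rV[R]_n) (s : R) (f : 'rV[R]_n -> R)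
  : 'rV[R]_n -> R :=
  fun x => \sum_(j : B) (b j x `^ s) * f (theta j x).

(* L - (a + i c) is bijective on the complexification X + iX of the function
   space X (functions identified when they agree on H): the pair (u,v)
   represents u + i v, and (L - (a+ic))(u+iv) = (Lu - a u + c v) + i(Lv - a v - c u). *)
Definition cbij {R : realType} {n : nat}
  (L : ('rV[R]_n -> R) -> ('rV[R]_n -> R)) (X : set ('rV[R]_n -> R))
  (H : set 'rV[R]_n) (a c : R) : Prop :=
  (forall u v, X u -> X v ->
     (forall x, H x -> L u x - a * u x + c * v x = 0 /\ L v x - a * v x - c * u x = 0) ->
     forall x, H x -> u x = 0 /\ v x = 0) /\
  (forall g h, X g -> X h -> exists u v, X u /\ X v /\
     forall x, H x -> L u x - a * u x + c * v x = g x /\ L v x - a * v x - c * u x = h x).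

Definition spec_radius {R : realType} {n : nat}
  (L : ('rV[R]_n -> R) -> ('rV[R]_n -> R)) (X : set ('rV[R]_n -> R))
  (H : set 'rV[R]_n) : R :=
  sup [set r : R | exists a c : R, ~ cbij L X H a c /\ r = Num.sqrt (a ^+ 2 + c ^+ 2)].

Definition real_analytic {R : realType} (f : R -> R) : Prop :=
  forall s0 : R, exists (d : R) (c : nat -> R), 0 < d /\
    forall s, `|s - s0| < d ->
      (fun N : nat => \sum_(k < N) c k * (s - s0) ^+ k) @ \oo --> f s.

(* Main.v *)
Require Import Defs.
From HB Require Import structures.
From mathcomp Require Import all_boot all_order all_algebra.
From mathcomp Require Import all_classical all_reals all_analysis.
From mathcomp Require Import measurable_realfun.
From mathcomp Require Import ring lra.
Set Implicit Arguments. Unset Strict Implicit. Unset Printing Implicit Defensive.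
Import Order.TTheory GRing.Theory Num.Theory.
Import numFieldNormedType.Exports.
Local Open Scope classical_set_scope.
Local Open Scope ring_scope.

(* The spectral radius of Lambda_s on C^m of the closure is the number lam for
   which Lambda_s h = lam h has a solution h bounded between two positive
   constants; no regularity of h is needed.  On the one hand, such an h
   prevents Lambda_s u = lam u + 1 from having a bounded solution.  On the other
   hand, comparison with h bounds the iterates of Lambda_s by lam^k, so that for
   |z| > lam the resolvent equation has a bounded solution given by a Neumann
   series; its derivatives satisfy a linear system of the same type, again
   contracting because long words in the theta_j have bounded Jacobians, and
   induction on the order of differentiation makes the solution C^m.

   Mild regularity enters only through the Lipschitz continuity of C^1
   functions: the increment of f along an arc is at most sup |f'| times its
   length.  Hence ln b_j is Lipschitz for a metric in which every theta_j is a
   contraction, and Lambda_s preserves a cone of functions with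
   h x <= e^(K d(x, y)) h y, in which an eigenfunction is found.  Dividing by it
   turns Lambda_s0 into a Markov operator which contracts oscillations, and the
   eigenvalue equation near s0 is solved by power series in s - s0 whose
   coefficients are bounded by a majorant argument.

   Finally, b_w <= rho < 1 for the words of length k gives
   lam_t^k <= rho^(t - s) lam_s^k for s <= t, by comparing the two positive
   eigenfunctions: this yields the strict decrease and the limit. *)

(** * Lipschitz estimates on mildly regular sets *)

(** Since any bounded positive eigenfunction identifies the eigenvalue, existence and perturbation
    are treated among functions on [H] that are Lipschitz for a metric, where no derivative occurs;
    the order m enters only through the resolvent equation.

    Two obstacles shape this treatment. Compactness of families of functions is replaced by monotone
    limits: the upper limit of the normalized iterates satisfies only an inequality, and iterating
    once more from it gives an increasing sequence that converges to an eigenfunction. Moreover the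
    Markov operator need not contract Lipschitz constants, because its weights depend on the point
    and add a multiple of the oscillation. Replacing d by min (1, kappa d) with kappa large puts the
    oscillation into the seminorm and divides its contribution by kappa.

    Complex scalars are never formed: a complex function is a pair of real ones and a complex number
    a 2 by 2 matrix. Systems with matrix coefficients are needed anyway, since the partial
    derivatives of a solution are coupled. *)

Lemma lebesgue_stieltjes_itv (R : realType) (F : cumulative R R) (a b : R) :
  a <= b -> lebesgue_stieltjes_measure F `]a, b]%classic = (F b - F a)%:E.
Proof.
move=> ab; rewrite /lebesgue_stieltjes_measure /measure_extension.
rewrite measurable_mu_extE/=; last exact: is_ocitv.
by rewrite wlength_itv_bnd.
Qed.

Lemma lipschitz_continuous (R : realType) (V : normedModType R) (f : R -> V) (L : R) :
  (forall s t, `|f s - f t| <= L * `|s - t|) -> continuous f.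
Proof.
move=> lipf x; apply/cvgrPdist_le => e e0.
have L1 : 0 < `|L| + 1 by rewrite ltr_wpDl.
near=> y; apply: (le_trans (lipf _ _)).
apply: (@le_trans _ _ ((`|L| + 1) * `|x - y|)).
  by rewrite ler_wpM2r// (le_trans (ler_norm _))// lerDl.
rewrite -ler_pdivlMl//; near: y.
by apply: cvgr_dist_le => //; rewrite mulr_gt0// invr_gt0.
Unshelve. all: end_near. Qed.

Lemma cumulative_of_lipschitz (R : realType) (f : R -> R) (L : R) :
  {homo f : x y / x <= y} -> (forall s t, `|f s - f t| <= L * `|s - t|) ->
  exists F : cumulative R R, F = f :> (R -> R).
Proof.
move=> ndf lipf.
have rc : right_continuous f.
  by apply: right_continuousW; exact: lipschitz_continuous lipf.
by exists (HB.pack_for (cumulative R R) f (isCumulative.Build R _ R f ndf rc)).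
Qed.

(* L x - F x is again nondecreasing, so its Stieltjes measure complements that
   of F to L times the Lebesgue measure. *)
Lemma lebesgue_stieltjes_le (R : realType) (F : cumulative R R) (L : R) (A : set R) :
  (forall s t, s <= t -> F t - F s <= L * (t - s)) -> measurable A ->
  (lebesgue_stieltjes_measure F A <= L%:E * lebesgue_measure A)%E.
Proof.
move=> lipF mA.
have L0 : 0 <= L.
  have := lipF 0 1 ler01; rewrite subr0 mulr1; apply: le_trans.
  by rewrite subr_ge0 cumulative_is_nondecreasing.
have ndF (s t : R) : s <= t -> F s <= F t by exact: cumulative_is_nondecreasing.
have [G GE] : exists G : cumulative R R, G = (fun x => L * x - F x) :> (R -> R).
  apply: (@cumulative_of_lipschitz _ _ (2 * L)) => [x y xy|s t].
    by have := lipF _ _ xy; nra.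
  wlog st : s t / s <= t => [H|].
    have [/H//|/ltW/H] := leP s t.
    by rewrite distrC (distrC t).
  have h := lipF _ _ st; have h' := ndF _ _ st.
  rewrite (distrC s) (ger0_norm (_ : 0 <= t - s)) ?subr_ge0// ler_norml; apply/andP; split; nra.
have [I IE] : exists I : cumulative R R, I = (fun x => L * x) :> (R -> R).
  apply: (@cumulative_of_lipschitz _ _ L) => [x y xy|s t]; first exact: ler_wpM2l.
  by rewrite -mulrBr normrM (ger0_norm L0).
have mu1 : lebesgue_stieltjes_measure I A =
    measure_add (lebesgue_stieltjes_measure F) (lebesgue_stieltjes_measure G) A.
  apply: lebesgue_stieltjes_measure_unique => // X [[a b] _ <-].
  rewrite [RHS]measure_addE /=.
  have [ab|ba] := leP a b; last by rewrite set_itv_ge ?measure0 ?adde0// bnd_simp -leNgt ltW.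
  by rewrite !lebesgue_stieltjes_itv// GE IE -EFinD; congr EFin; ring.
have mu2 : lebesgue_stieltjes_measure I A =
    mscale (NngNum L0) (@lebesgue_measure R) A.
  apply: lebesgue_stieltjes_measure_unique => // X [[a b] _ <-] /=.
  have [ab|ba] := leP a b; last by rewrite set_itv_ge ?measure0// bnd_simp -leNgt ltW.
  rewrite /mscale/= lebesgue_stieltjes_itv// IE.
  rewrite (_ : @lebesgue_measure R _ = (b - a)%:E) -?EFinM ?mulrBr//.
  exact: lebesgue_stieltjes_itv.
have -> : (L%:E * lebesgue_measure A = lebesgue_stieltjes_measure I A)%E.
  by rewrite mu2.
by rewrite mu1 measure_addE leeDl.
Qed.

(** [phi x + L x] is nondecreasing, and its Stieltjes measure is at most 2 L times the Lebesgue
    measure. Its Radon-Nikodym density minus L is [g], and Lebesgue's differentiation theorem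
    identifies [g] with the derivative almost everywhere. *)
Lemma lipschitz_ftc (R : realType) (phi : R -> R) (L : R) :
  (forall s t, `|phi s - phi t| <= L * `|s - t|) ->
  exists g : R -> R,
    [/\ (@lebesgue_measure R).-integrable `[0, 1]%classic (EFin \o g),
     forall s t, 0 <= s -> s <= t -> t <= 1 ->
      (phi t - phi s)%:E = (\int[@lebesgue_measure R]_(x in `]s, t]%classic) (g x)%:E)%E &
     {ae @lebesgue_measure R, forall x, 0 < x < 1 ->
        derivable phi x 1 /\ 'D_1 phi x = g x}].
Proof.
move=> lip.
pose mu := @lebesgue_measure R.
have L0 : 0 <= L.
  by have := lip 1 0; rewrite subr0 normr1 mulr1; apply: le_trans.
have [F FE] : exists F : cumulative R R, F = (fun x => phi x + L * x) :> (R -> R).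
  apply: (@cumulative_of_lipschitz _ _ (2 * L)) => [x y xy|s t].
    have := lip y x; rewrite [X in _ * X]ger0_norm ?subr_ge0//.
    by rewrite ler_norml => /andP[]; lra.
  rewrite (_ : _ - _ = (phi s - phi t) + L * (s - t)); last by ring.
  rewrite (le_trans (ler_normD _ _))// normrM (ger0_norm L0).
  by have := lip s t; lra.
have lipF s t : s <= t -> F t - F s <= (2 * L) * (t - s).
  move=> st; rewrite FE; have := lip t s; rewrite [X in _ * X]ger0_norm ?subr_ge0//.
  by rewrite ler_norml => /andP[]; lra.
(* Restriction to a bounded interval containing [0, 1] makes the measure finite, so that the density
   is integrable on the whole line. *)
pose D := `]-1, 2]%classic : set R.
have mD : measurable (D : set (measurableTypeR R)) by exact: measurable_itv.
have Doo : (lebesgue_stieltjes_measure F D < +oo)%E.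
  by rewrite lebesgue_stieltjes_itv ?ltry//; lra.
pose nu := mfrestr mD Doo.
have numu : nu `<< mu.
  apply/null_content_dominatesP => A mA A0.
  apply/eqP; rewrite eq_le measure_ge0 andbT.
  apply: (@le_trans _ _ (lebesgue_stieltjes_measure F A)).
    by rewrite /nu /= /mfrestr /mrestr le_measure ?inE//; [exact: measurableI].
  by rewrite (le_trans (lebesgue_stieltjes_le lipF mA))// A0 mule0.
have [f [f0 ffin intf nuE]] := radon_nikodym_sigma_finite numu.
pose h : R -> R := fun x => fine (f x).
have hE : f = EFin \o h by apply/funext => x; rewrite /h /= fineK.
rewrite hE in intf nuE.
have inth : (@lebesgue_measure R).-integrable [set: R] (EFin \o h) by exact: intf.
have FI s t : -1 <= s -> s <= t -> t <= 2 ->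
    (F t - F s)%:E = (\int[@lebesgue_measure R]_(x in `]s, t]%classic) (h x)%:E)%E.
  move=> s1 st t2; rewrite -[RHS]nuE; last exact: measurable_itv.
  rewrite /nu /= /mfrestr /mrestr setIidl; last first.
    by apply: subset_itv; rewrite bnd_simp.
  by rewrite lebesgue_stieltjes_itv.
have intS (A : set R) : (measurable : set (set (measurableTypeR R))) A ->
    (@lebesgue_measure R).-integrable A (EFin \o h).
  by move=> mA; apply: integrableS inth => //.
have intc (A : set R) : (measurable : set (set (measurableTypeR R))) A ->
    A `<=` `[0, 1]%classic -> (@lebesgue_measure R).-integrable A (EFin \o (cst L : R -> R)).
  move=> mA A01.
  have mI : (measurable : set (set (measurableTypeR R))) `[0, 1]%classic.
    exact: measurable_itv.
  apply: (@integrableS _ (measurableTypeR R) R (@lebesgue_measure R) `[0, 1]%classic) => //.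
  apply: (@continuous_compact_integrable R (cst L)); first exact: (@segment_compact R 0 1).
  by apply: continuous_subspaceT => x; exact: cvg_cst.
have mE : (fun x : R => (h x - L)%:E) = (fun x : R => ((h x)%:E - L%:E)%E).
  by apply/funext => x; rewrite EFinB.
exists (fun x => h x - L); split.
- rewrite /comp mE; apply: integrableB; [exact: measurable_itv|exact: intS|].
  by apply: intc => //; exact: measurable_itv.
- move=> s t s0 st t1.
  have mst : (measurable : set (set (measurableTypeR R))) `]s, t]%classic.
    exact: measurable_itv.
  under eq_integral do rewrite EFinB.
  have sub : `]s, t]%classic `<=` `[0, 1]%classic by apply: subset_itv; rewrite bnd_simp.
  rewrite integralB//; [|exact: intS|exact: intc].
  rewrite -FI//; [|lra..].
  rewrite integral_cst//.
  rewrite [X in (_ - _ * X)%E](_ : _ = (t - s)%:E); last exact: lebesgue_stieltjes_itv.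
  by rewrite -EFinM -EFinB FE; congr EFin; ring.
- have := FTC1Ny (fun y => intS _ (measurable_itv `]-oo, y]))
    (open_integrable_locally openT inth).
  apply: filterS; first exact: (ae_filter_ringOfSetsType mu).
  move=> x; set K := fun _ => _ => -[dK KE] /andP[x0 x1].
  have K_F y : -1 <= y -> y <= 2 -> K y = K (-1) + F y - F (-1).
    move=> y1 y2; have := FI _ _ (lexx _) y1 y2.
    rewrite -addrA => H; apply/eqP; rewrite addrC -subr_eq; apply/eqP.
    rewrite /K (@Rintegral_itvB _ _ -oo%O (BRight y) (-1)) ?bnd_simp//.
      by rewrite /Rintegral -H.
    by apply: intS; exact: measurable_itv.
  have near_phi : \forall y \near x, K y - (K (-1) - F (-1) + L * y) = phi y.
    have := @near_in_itvoo R 0 1 x; rewrite in_itv/= x0 x1 => /(_ isT).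
    apply: filterS => y; rewrite in_itv/= => /andP[y0 y1].
    by rewrite K_F ?FE; [ring|lra..].
  pose G : R -> R := fun y => K y - (K (-1) - F (-1) + L * y).
  have dG : is_derive x 1 G (h x - L).
    have dK' : is_derive x 1 K (h x) by apply: DeriveDef => //; rewrite -KE derive1E.
    rewrite /G; apply: is_deriveB.
    rewrite -[X in is_derive _ _ _ X]add0r; apply: is_deriveD.
    rewrite -[X in is_derive _ _ _ X]mulr1; exact: is_deriveZ.
  split; first by apply: near_eq_derivable near_phi _.
  rewrite -(near_eq_derive _ near_phi).
  by rewrite (@derive_val _ _ _ _ _ _ _ dG).
Qed.

(* Without measurability of g the integral is a lower integral; this is all
   that is known of the speed of an arbitrary Lipschitz curve. *)
Lemma ge0_ae_le_lower_integral d (T : measurableType d) (R : realType)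
    (mu : {measure set T -> \bar R}) (D : set T) (f g : T -> \bar R) :
  measurable D -> measurable_fun D f ->
  (forall x, 0 <= f x)%E -> (forall x, 0 <= g x)%E ->
  {ae mu, forall x, D x -> (f x <= g x)%E} ->
  (\int[mu]_(x in D) f x <= \int[mu]_(x in D) g x)%E.
Proof.
move=> mD mf f0 g0 [N [mN N0 sub]].
have fg x : ~ N x -> D x -> (f x <= g x)%E.
  by move=> Nx Dx; apply: contrapT => h; apply: Nx; apply: sub => /(_ Dx).
have -> : (\int[mu]_(x in D) f x = \int[mu]_(x in D `\` N) f x)%E.
  exact: ge0_negligible_integral.
rewrite integral_mkcond [leRHS]integral_mkcond.
rewrite !ge0_integralTE; last 2 first.
- by move=> x; rewrite patchE; case: ifP.
- by move=> x; rewrite patchE; case: ifP.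
apply: le_ereal_sup => _ [h hf <-]; exists h => // x.
apply: (le_trans (hf x)); rewrite !patchE.
case: ifPn => [/set_mem [Dx Nx]|_]; first by rewrite mem_set//; exact: fg.
by case: ifP.
Qed.

(** Precomposition with this 1-Lipschitz retraction extends a curve that is Lipschitz on [0, 1] to
    the whole line with the same constant, as [lipschitz_ftc] requires. *)
Definition clamp01 {R : realType} (t : R) : R := Num.max 0 (Num.min t 1).

Lemma clamp01_itv (R : realType) (t : R) : 0 <= clamp01 t <= 1.
Proof. by rewrite /clamp01 le_max lexx/= ge_max ler01 ge_min lexx orbT. Qed.

Lemma clamp01_id (R : realType) (t : R) : 0 <= t <= 1 -> clamp01 t = t.
Proof. by move=> /andP[t0 t1]; rewrite /clamp01 (min_idPl t1) (max_idPr t0). Qed.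

Lemma clamp01_lip (R : realType) (s t : R) : `|clamp01 s - clamp01 t| <= `|s - t|.
Proof.
wlog st : s t / s <= t => [H|].
  by have [/H//|/ltW/H] := leP s t; rewrite distrC (distrC t).
rewrite distrC (distrC s) (ger0_norm (_ : 0 <= t - s)) ?subr_ge0//.
rewrite /clamp01; case: (leP s 1) => s1; case: (leP t 1) => t1;
  case: (leP 0 s) => s0; case: (leP 0 t) => t0; rewrite ?(max_idPr ler01);
  rewrite ler_norml; apply/andP; split; lra.
Qed.

Lemma rv_norm_le_sum (R : realType) (n : nat) (v : 'rV[R]_n) :
  `|v| <= \sum_(i < n) `|v 0 i|.
Proof.
rewrite [leLHS]/Num.norm/= mx_normrE; apply: bigmax_le => [|[i j] _ /=].
  by apply: sumr_ge0.
by rewrite (bigD1 j)//= ord1 lerDl sumr_ge0.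
Qed.

Lemma rv_coord_le_norm (R : realType) (n : nat) (v : 'rV[R]_n) (i : 'I_n) :
  `|v 0 i| <= `|v|.
Proof.
rewrite [leRHS]/Num.norm/= mx_normrE.
by apply: (le_bigmax _ (fun ij : 'I_1 * 'I_n => `|v ij.1 ij.2|) (0, i)).
Qed.

(* ell t is the arc length of the curve up to time t for the l^1 norm of 'rV_n,
   hence the factor n. *)
Lemma lipschitz_curve_length (R : realType) (n : nat) (psi : R -> 'rV[R]_n) (L : R) :
  (forall s t, 0 <= s <= 1 -> 0 <= t <= 1 -> `|psi s - psi t| <= L * `|s - t|) ->
  exists ell : R -> R,
    (forall s t, 0 <= s -> s <= t -> t <= 1 -> `|psi t - psi s| <= ell t - ell s) /\
    ((ell 1 - ell 0)%:E <= n%:R%:E *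
      \int[@lebesgue_measure R]_(t in [set t : R | (0 <= t <= 1)%R]) (`|'D_1 psi t|%R%:E))%E.
Proof.
move=> lip.
pose mu := @lebesgue_measure R.
have mitv (i : interval R) : (measurable : set (set (measurableTypeR R))) [set` i].
  exact: measurable_itv.
have L0 : 0 <= L.
  have := lip 1 0; rewrite subr0 normr1 mulr1 !lexx !ler01 => /(_ isT isT).
  exact: le_trans.
pose phi (i : 'I_n) t := psi (clamp01 t) 0 i.
have lipphi i s t : `|phi i s - phi i t| <= L * `|s - t|.
  apply: (@le_trans _ _ (L * `|clamp01 s - clamp01 t|)); last first.
    by rewrite ler_wpM2l// clamp01_lip.
  apply: le_trans (lip _ _ (clamp01_itv s) (clamp01_itv t)).
  by have := rv_coord_le_norm (psi (clamp01 s) - psi (clamp01 t)) i; rewrite !mxE.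
have /choice[g gP] := fun i => lipschitz_ftc (lipphi i).
have ig i : mu.-integrable `[0, 1]%classic (EFin \o (fun x => `|g i x|)).
  have [h _ _] := gP i; exact: integrable_norm.
have igS i (A : interval R) : [set` A] `<=` `[0, 1]%classic ->
    mu.-integrable [set` A] (EFin \o (fun x => `|g i x|)).
  by move=> sA; apply: integrableS (ig i).
pose ell t := \sum_(i < n) (\int[mu]_(x in `]0, t]%classic) `|g i x|)%R.
have ellB s t : 0 <= s -> s <= t -> t <= 1 ->
    ell t - ell s = \sum_(i < n) (\int[mu]_(x in `]s, t]%classic) `|g i x|)%R.
  move=> s0 st t1; rewrite -sumrB; apply: eq_bigr => i _.
  rewrite (@Rintegral_itvB _ _ (BRight 0) (BRight t) s) ?bnd_simp//.
  by apply: igS; apply: subset_itv; rewrite bnd_simp.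
exists ell; split.
  move=> s t s0 st t1; rewrite ellB//.
  apply: (le_trans (rv_norm_le_sum _)); apply: ler_sum => i _.
  have [gi gE _] := gP i.
  have sub : `]s, t]%classic `<=` `[0, 1]%classic by apply: subset_itv; rewrite bnd_simp.
  have -> : (psi t - psi s) 0 i = (\int[mu]_(x in `]s, t]%classic) g i x)%R.
    rewrite /Rintegral -gE//= /phi !clamp01_id ?mxE//; apply/andP; split => //.
      exact: le_trans st t1.
    exact: le_trans s0 st.
  by apply: le_normr_Rintegral => //; exact: integrableS gi.
rewrite ellB// -sumEFin.
have setE : [set t : R | 0 <= t <= 1] = `[0, 1]%classic.
  by apply/seteqP; split => t /=; rewrite in_itv.
rewrite setE; set I := (\int[_]_(_ in _) _)%E.
have -> : (n%:R%:E * I = \sum_(i < n) I)%E.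
  by rewrite mule_natl sumr_const card_ord.
apply: lee_sum => i _.
have sub : (`]0, 1]%classic : set R) `<=` `[0, 1]%classic by apply: subset_itv; rewrite bnd_simp.
rewrite /Rintegral fineK; last by apply: integrable_fin_num => //; exact: igS.
have igi := ig i.
apply: (@le_trans _ _ (\int[mu]_(t in `[0%R, 1%R]%classic) `|g i t|%:E)%E).
  apply: ge0_subset_integral => //; exact: measurable_int (ig i).
apply: ge0_ae_le_lower_integral => //; first exact: measurable_int (ig i).
(* The endpoints are discarded because [phi] and the coordinates of [psi] agree on a neighbourhood
   of interior points only. *)
have ae_neq (c : R) : {ae mu, forall x : R, x <> c}.
  exists [set c]; split; [exact: measurable_set1|exact: lebesgue_measure_set1|].
  by move=> x /= /contrapT.
have aeF := ae_filter_ringOfSetsType mu.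
have ae_all : {ae mu, forall x, forall j : 'I_n,
    0 < x < 1 -> derivable (phi j) x 1 /\ 'D_1 (phi j) x = g j x}.
  by apply: filter_forall => j; have [_ _] := gP j.
apply: filterS3 ae_all (ae_neq 0) (ae_neq 1) => x dphi x0 x1.
rewrite /= in_itv/= => /andP[x0' x1'].
have {}x0' : 0 < x by rewrite lt_neqAle x0' andbT eq_sym; apply/eqP.
have {}x1' : x < 1 by rewrite lt_neqAle x1' andbT; apply/eqP.
have x01 : 0 < x < 1 by rewrite x0'.
have near_phi j : \forall y \near x, phi j y = psi y 0 j.
  have := @near_in_itvoo R 0 1 x; rewrite in_itv/= x01 => /(_ isT).
  apply: filterS => y; rewrite in_itv/= => /andP[y0 y1].
  by rewrite /phi clamp01_id// (ltW y0) ltW.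
have dpsi : derivable psi x 1.
  apply/derivable_mxP => k j; rewrite ord1.
  by apply: near_eq_derivable (near_phi j) _; have [] := dphi j x01.
have [_ <-] := dphi i x01.
rewrite lee_fin (near_eq_derive _ (near_phi i)).
by have := rv_coord_le_norm ('D_1 psi x) i; rewrite derive_mx// mxE.
Qed.

(** * Mean value inequalities and differentiability *)

Lemma is_derive_line (R : realType) (V W : normedModType R) (f : V -> W) (w v : V) (t : R) :
  derivable f (t *: v + w) v ->
  is_derive t 1 (fun t : R => f (t *: v + w)) ('D_v f (t *: v + w)).
Proof.
have E : (fun h : R => h^-1 *: (((fun t : R => f (t *: v + w)) \o shift t) (h *: 1) -
      f (t *: v + w))) =
    (fun h : R => h^-1 *: ((f \o shift (t *: v + w)) (h *: v) - f (t *: v + w))).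
  by apply/funext => h /=; rewrite [h *: 1]mulr1 scalerDl addrA.
by move=> df; apply: DeriveDef; rewrite /derivable /derive E.
Qed.

(** The number [c] is a reference value of the derivative: a partial derivative at the centre when
    differentiability is proved, 0 when an increment is bounded. *)
Lemma directional_mean_value (R : realType) (V : normedModType R) (f : V -> R)
    (w v : V) (c e d : R) :
  (forall t : R, 0 <= t <= 1 -> derivable f ((t * d) *: v + w) v /\
     `|'D_v f ((t * d) *: v + w) - c| <= e) ->
  `|f (d *: v + w) - f w - c * d| <= e * `|d|.
Proof.
move=> H.
pose g (t : R) := f (t *: (d *: v) + w).
have dg (t : R) : 0 <= t <= 1 -> is_derive t 1 g ('D_v f ((t * d) *: v + w) * d).
  move=> t01; have [df _] := H t t01.
  have h : is_derive t 1 (fun t : R => t * d) d.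
    rewrite (_ : (fun t : R => t * d) = d \*: id); last first.
      by apply/funext => u /=; rewrite mulrC.
    by apply: is_derive_eq (is_deriveZ _ _) _; rewrite [LHS]mulr1.
  rewrite (_ : g = (fun t : R => f (t *: v + w)) \o (fun t => t * d)); last first.
    by apply/funext => u; rewrite /g /= scalerA.
  have k := is_derive_line df.
  exact: is_derive1_comp.
have [t|t|c0] := @MVT_segment R g (fun t => 'D_v f ((t * d) *: v + w) * d) 0 1 ler01.
- by rewrite in_itv/= => /andP[t0 t1]; apply: dg; rewrite !ltW.
- apply: derivable_within_continuous => {}t; rewrite in_itv/= => t01.
  by have [] := dg t t01.
rewrite in_itv/= => c01; rewrite /g scale1r scale0r add0r subr0 mulr1 => ->.
have [_ h] := H c0 c01.
by rewrite -mulrBl normrM ler_wpM2r.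
Qed.

(** Coordinates are changed from [y] to [z] one at a time. A ball of the sup norm is a product of
    intervals, so all intermediate points stay in it. *)
Lemma coord_mean_value (R : realType) (n : nat) (f : 'rV[R]_n -> R)
    (x y z : 'rV[R]_n) (r e : R) (c : 'I_n -> R) :
  (forall u, `|u - x| <= r -> forall i, derivable f u (ebasis i) /\
     `|pderiv i f u - c i| <= e) ->
  `|y - x| <= r -> `|z - x| <= r ->
  `|f z - f y - \sum_(i < n) c i * (z - y) 0 i| <= n%:R * e * `|z - y|.
Proof.
move=> H yx zx.
pose w (k : nat) : 'rV[R]_n := \row_j (if (j < k)%N then z 0 j else y 0 j).
have -> : f z - f y = \sum_(i < n) (f (w i.+1) - f (w i)).
  rewrite -(big_mkord xpredT (fun i => f (w i.+1) - f (w i))) telescope_sumr//.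
  by congr (f _ - f _); apply/rowP => j; rewrite !mxE ?ltn_ord ?ltn0.
rewrite -sumrB (le_trans (ler_norm_sum _ _ _))//.
have -> : n%:R * e * `|z - y| = \sum_(i < n) (e * `|z - y|).
  by rewrite sumr_const card_ord -mulrA mulr_natl.
apply: ler_sum => i _.
have -> : w i.+1 = ((z - y) 0 i) *: ebasis i + w i.
  apply/rowP => j; rewrite !mxE eqxx/= ltnS leq_eqVlt.
  have [ij|ij] := eqVneq (val j) (val i).
    by rewrite (val_inj ij) eqxx ltnn mulr1 subrK.
  by rewrite (_ : (j == i) = false) ?mulr0 ?add0r//; apply/negbTE.
apply: (@le_trans _ _ (e * `|(z - y) 0 i|)); last first.
  apply: ler_wpM2l; last exact: rv_coord_le_norm.
  have [_ h] := H y yx i; exact: le_trans h.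
apply: directional_mean_value => t /andP[t0 t1]; apply: H.
rewrite [leLHS]/Num.norm/= mx_normrE; apply: bigmax_le => [|[k j] _ /=].
  by rewrite (le_trans _ yx).
rewrite ord1 !mxE eqxx /=.
have yj : `|y 0 j - x 0 j| <= r by have := le_trans (rv_coord_le_norm _ j) yx; rewrite !mxE.
have zj : `|z 0 j - x 0 j| <= r by have := le_trans (rv_coord_le_norm _ j) zx; rewrite !mxE.
move: yj zj; have [->|ij] := eqVneq j i.
  rewrite ltnn mulr1 !ler_norml => /andP[? ?] /andP[? ?]; apply/andP; split; nra.
by rewrite mulr0 add0r; case: ifP.
Qed.

Lemma differentiable_of_approx (R : realType) (V : normedModType R) (f : V -> R) (x : V)
    (df : {linear V -> R}) :
  continuous df ->
  (forall e, 0 < e -> \forall h \near 0, `|f (h + x) - f x - df h| <= e * `|h|) ->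
  is_diff x f df.
Proof.
move=> cdf approx.
have E : f \o shift x = cst (f x) + df +o_ 0 id.
  apply/eqaddoP => e e0; have := approx e e0; apply: filterS => h.
  by rewrite /= !fctE opprD addrA.
have D : 'd f x = df :> (V -> R) by exact: diff_unique.
by apply: DiffDef => //; apply/diff_locallyP; rewrite D.
Qed.

Lemma differentiable_of_continuous_partials (R : realType) (n : nat) (f : 'rV[R]_n -> R)
    (x : 'rV[R]_n) :
  (\forall y \near x, forall i, derivable f y (ebasis i)) ->
  (forall i, {for x, continuous (pderiv i f)}) ->
  differentiable f x.
Proof.
move=> df cf.
pose l (h : 'rV[R]_n) : R := \sum_(i < n) pderiv i f x * h 0 i.
have lin : linear l.
  move=> a u v; rewrite /l scaler_sumr -big_split/=; apply: eq_bigr => i _.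
  by rewrite !mxE mulrDr [a *: _]mulrCA.
pose L : {linear 'rV[R]_n -> R} := HB.pack l (GRing.isLinear.Build _ _ _ _ _ lin).
have cL : continuous L.
  move=> v; apply: differentiable_continuous; rewrite /L/= /l.
  have -> : (fun h : 'rV[R]_n => \sum_(i < n) pderiv i f x * h 0 i) =
     \sum_(i < n) (fun h : 'rV[R]_n => pderiv i f x *: (h 0 i : R)).
    by apply/funext => h; rewrite fct_sumE.
  apply: differentiable_sum => i; apply: differentiableZ; exact: differentiable_coord.
suff approx (e : R) : 0 < e -> \forall h \near (0 : 'rV[R]_n), `|f (h + x) - f x - L h| <= e * `|h|.
  by have [] := differentiable_of_approx cL approx.
move=> e0.
(* The divisor is n + 1 and not n, so that dimension 0 is covered. *)
pose e' := e / (n.+1)%:R.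
have e'0 : 0 < e' by rewrite divr_gt0// ltr0n.
have : \forall y \near x, forall i, derivable f y (ebasis i) /\
    `|pderiv i f y - pderiv i f x| <= e'.
  apply: (@filter_forall _ _ (fun i y => derivable f y (ebasis i) /\
    `|pderiv i f y - pderiv i f x| <= e') (nbhs x) (nbhs_filter x)) => i; have /cvgrPdist_le/(_ _ e'0) := cf i.
  by move: df; apply: filterS2 => y dfy; rewrite distrC; split.
move=> /nbhs_ballP[r /= r0 hr].
have r20 : 0 < r / 2 by rewrite divr_gt0.
apply/nbhs_ballP; exists (r / 2) => //= h; rewrite -ball_normE /ball_/= sub0r normrN => /ltW hr2.
have := @coord_mean_value R n f x x (h + x) (r / 2) e' (fun i => pderiv i f x).
rewrite addrK subrr normr0 => H.
apply: (le_trans (H _ _ hr2)).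
- move=> u ux; apply: hr; rewrite -ball_normE /ball_/= distrC (le_lt_trans ux)//.
  by rewrite ltr_pdivrMr// ltr_pMr// ltr1n.
- by rewrite divr_ge0// ltW.
rewrite ler_wpM2r// /e' mulrCA ger_pMr// ler_pdivrMr ?ltr0n// mul1r ler_nat.
exact: leqnSn.
Qed.

(** * Continuity up to the boundary and Lipschitz continuity *)

Definition C0bar {R : realType} {n : nat} (H : set 'rV[R]_n) (f : 'rV[R]_n -> R) : Prop :=
  (forall x, H x -> {for x, continuous f}) /\
  exists g : 'rV[R]_n -> R, {within closure H, continuous g} /\ forall x, H x -> g x = f x.

Lemma iter_pderiv_rcons (R : realType) (n : nat) (l : seq 'I_n) (i : 'I_n) (f : 'rV[R]_n -> R) :
  iter_pderiv (rcons l i) f = iter_pderiv l (pderiv i f).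
Proof. by elim: l => //= j l ->. Qed.

Lemma CmBar0E (R : realType) (n : nat) (H : set 'rV[R]_n) (f : 'rV[R]_n -> R) :
  CmBar 0 H f <-> C0bar H f.
Proof.
split=> [[cf ef]|[cf ef]]; split => //; first exact: (ef [::]).
by move=> [|].
Qed.

(** The derivative applied first is the last entry of the index list, hence the case analysis on
    [rcons]. This recursive form serves all later inductions on the order. *)
Lemma CmBarSE (R : realType) (n m : nat) (H : set 'rV[R]_n) (f : 'rV[R]_n -> R) :
  CmBar m.+1 H f <-> C0bar H f /\
    forall i, (forall x, H x -> derivable f x (ebasis i)) /\ CmBar m H (pderiv i f).
Proof.
split=> [[[cf df] ef]|[[cf ef] df]].
  split; first by split => //; exact: (ef [::]).
  move=> i; have [dfi cfi] := df i; split => //; split => // l lm.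
  by have := ef (rcons l i); rewrite size_rcons iter_pderiv_rcons; apply.
split; first by split => // i; have [dfi []] := df i.
move=> l; case/lastP: l => [|l i] //.
by rewrite size_rcons iter_pderiv_rcons => lm; have [_ [_]] := df i; apply.
Qed.

Lemma CmBar_C0bar (R : realType) (n m : nat) (H : set 'rV[R]_n) (f : 'rV[R]_n -> R) :
  CmBar m H f -> C0bar H f.
Proof. by case: m => [/CmBar0E//|m /CmBarSE[]]. Qed.

Lemma CmBarW (R : realType) (n m : nat) (H : set 'rV[R]_n) (f : 'rV[R]_n -> R) :
  CmBar m.+1 H f -> CmBar m H f.
Proof.
elim: m f => [|m IH] f /CmBarSE[c0 df]; first exact/CmBar0E.
by apply/CmBarSE; split => // i; have [? /IH] := df i.
Qed.

Lemma bounded_closure_compact (R : realType) (n : nat) (H : set 'rV[R]_n) :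
  bounded_set H -> compact (closure H).
Proof.
move=> bH; apply: bounded_closed_compact; last exact: closed_closure.
have [M [Mr HM]] := bH; exists M; split => // K MK x.
have cl : closed [set y : 'rV[R]_n | `|y| <= K].
  have -> : [set y : 'rV[R]_n | `|y| <= K] = (fun y : 'rV[R]_n => `|y|) @^-1` [set r | r <= K] by [].
  apply: closed_comp; last exact: closed_le.
  by move=> y _; exact: norm_continuous.
rewrite closureE => /(_ [set y : 'rV[R]_n | `|y| <= K]); apply; split => //.
by move=> y /HM; apply.
Qed.

Lemma C0bar_bounded (R : realType) (n : nat) (H : set 'rV[R]_n) (f : 'rV[R]_n -> R) :
  bounded_set H -> C0bar H f -> exists2 K, 0 <= K & forall x, H x -> `|f x| <= K.
Proof.
move=> bH [_ [g [cg gf]]].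
have [M [Mr HM]] := compact_bounded (continuous_compact cg (bounded_closure_compact bH)).
exists (`|M| + 1) => [|x Hx]; first by rewrite addr_ge0.
rewrite -gf//; apply: HM; first by rewrite (le_lt_trans (ler_norm _))// ltrDl.
by exists x => //; exact: subset_closure.
Qed.

Lemma CmBar_differentiable (R : realType) (n m : nat) (H : set 'rV[R]_n) (f : 'rV[R]_n -> R)
    (x : 'rV[R]_n) :
  open H -> CmBar m.+1 H f -> H x -> differentiable f x.
Proof.
move=> oH /CmBarSE[_ df] Hx; apply: differentiable_of_continuous_partials.
  have : nbhs x H by exact: open_nbhs_nbhs.
  by apply: filterS => y Hy i; have [+ _] := df i; apply.
by move=> i; have [_ /CmBar_C0bar[+ _]] := df i; apply.
Qed.

(** The partial derivatives are bounded on all of [H], so [K] is global; only the radius depends on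
    [x]. This is what summation along a curve requires. *)
Lemma CmBar_locally_lipschitz (R : realType) (n m : nat) (H : set 'rV[R]_n)
    (f : 'rV[R]_n -> R) :
  bounded_set H -> open H -> CmBar m.+1 H f ->
  exists2 K, 0 <= K & forall x, H x -> exists2 r, 0 < r & forall y z,
    `|y - x| <= r -> `|z - x| <= r -> `|f z - f y| <= K * `|z - y|.
Proof.
move=> bH oH /CmBarSE[_ df].
have /choice[K KP] : forall i, exists K, 0 <= K /\ forall x, H x -> `|pderiv i f x| <= K.
  by move=> i; have [_ /CmBar_C0bar/(C0bar_bounded bH)[K]] := df i; exists K.
have K0 : 0 <= \sum_i K i by apply: sumr_ge0 => i _; have [] := KP i.
exists (n%:R * \sum_i K i) => [|x Hx]; first by rewrite mulr_ge0.
have /nbhs_ballP[r /= r0 rH] : nbhs x H by exact: open_nbhs_nbhs.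
exists (r / 2) => [|y z yx zx]; first by rewrite divr_gt0.
have := @coord_mean_value R n f x y z (r / 2) (\sum_i K i) (fun=> 0).
rewrite [X in _ - _ - X](_ : _ = 0); last by apply: big1 => i _; rewrite mul0r.
rewrite subr0; apply => // u ux i.
have Hu : H u.
  apply: rH; rewrite -ball_normE /ball_/= distrC (le_lt_trans ux)//.
  by rewrite ltr_pdivrMr// ltr_pMr// ltr1n.
have [du _] := df i; split; first exact: du.
have [_ /(_ u Hu) h] := KP i.
rewrite subr0 (le_trans h)// (bigD1 i)//= lerDl sumr_ge0// => j _.
by have [] := KP j.
Qed.

(** Continuation: the supremum of the times up to which the bound holds cannot be less than 1 and,
    when it is 1, is attained. The radius [d] may depend on [t] without any uniformity. *)
Lemma increment_le_continuation (R : realType) (u l : R -> R) (K : R) :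
  (forall t : R, 0 <= t <= 1 -> exists2 d : R, 0 < d & forall a b : R, 0 <= a -> a <= b -> b <= 1 ->
     `|a - t| < d -> `|b - t| < d -> `|u b - u a| <= K * (l b - l a)) ->
  `|u 1 - u 0| <= K * (l 1 - l 0).
Proof.
move=> loc.
pose S := [set t : R | 0 <= t <= 1 /\ `|u t - u 0| <= K * (l t - l 0)].
have S0 : S 0 by split; rewrite ?lexx ?ler01// !subrr normr0 mulr0.
have supS : has_sup S by split; [exists 0|exists 1 => t [/andP[]]].
have t1 : sup S <= 1 by apply: ge_sup => [|t [/andP[]]]//; exists 0.
have t0 : 0 <= sup S by apply: ub_le_sup => //; case: supS.
have [|d d0 H] := loc (sup S); first by rewrite t0.
have [s [/andP[s0 s1] Ss] ts] := sup_adherent d0 supS.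
have st : s <= sup S by apply: ub_le_sup => //; [case: supS|split => //; rewrite s0].
have step b : s <= b -> b <= 1 -> `|b - sup S| < d -> S b.
  move=> sb b1 bd; split; first by rewrite b1 (le_trans s0).
  have := H _ _ s0 sb b1 _ bd; rewrite ltr_norml => /(_ _)/le_trans.
  have -> : u b - u 0 = (u b - u s) + (u s - u 0) by ring.
  move=> h; rewrite (le_trans (ler_normD _ _))//.
  rewrite (_ : K * (l b - l 0) = K * (l b - l s) + K * (l s - l 0)); last by ring.
  apply: lerD Ss; apply: h => //; apply/andP; split; lra.
have [t1'|t1'] := ltP (sup S) 1; last first.
  have [] := step 1 => //; rewrite (_ : sup S = 1) ?subrr ?normr0//.
  by apply/eqP; rewrite eq_le t1.
pose b := Num.min 1 (sup S + d / 2).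
have bS : sup S < b by rewrite lt_min t1' ltrDl divr_gt0.
have : S b.
  apply: step; first by rewrite (le_trans st)// ltW.
    by rewrite ge_min lexx.
  rewrite gtr0_norm ?subr_gt0// ltrBlDl gt_min; apply/orP; right.
  by rewrite ltrD2l ltr_pdivrMr// ltr_pMr// ltr1n.
by move=> /(ub_le_sup supS.2); rewrite leNgt bS.
Qed.

(** Points at distance at least [eta] are handled by the bound on [f]. Closer points are joined by a
    curve, along which the local bounds add up to [K] times its length, and this length is at most n
    M times the distance. *)
Lemma mildly_regular_lipschitz (R : realType) (n m : nat) (H : set 'rV[R]_n)
    (f : 'rV[R]_n -> R) :
  bounded_set H -> open H -> mildly_regular H -> CmBar m.+1 H f ->
  exists2 K, 0 <= K & forall x y, H x -> H y -> `|f x - f y| <= K * `|x - y|.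
Proof.
move=> bH oH [eta [M [eta0 [M1 reg]]]] Cf.
have [K K0 locK] := CmBar_locally_lipschitz bH oH Cf.
have [C C0 bC] := C0bar_bounded bH (CmBar_C0bar Cf).
have M0 : 0 <= M by exact: le_trans M1.
have A0 : 0 <= K * (n%:R * M) by rewrite !mulr_ge0.
have B0 : 0 <= 2 * C / eta by rewrite divr_ge0 ?mulr_ge0// ltW.
exists (K * (n%:R * M) + 2 * C / eta) => [|x y Hx Hy]; first exact: addr_ge0.
have [xy|xy] := ltP `|x - y| eta; last first.
  apply: (@le_trans _ _ (2 * C / eta * `|x - y|)); last by rewrite ler_wpM2r// lerDr.
  apply: (@le_trans _ _ (2 * C)).
    by rewrite (le_trans (ler_normB _ _))// mulr_natl mulr2n lerD// bC.
  by rewrite -mulrA ler_peMr ?mulr_ge0// mulrC ler_pdivlMr// mul1r.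
apply: (@le_trans _ _ (K * (n%:R * M) * `|x - y|)); last by rewrite ler_wpM2r// lerDl.
have [psi [p0 [p1 [pH [[L lip] int]]]]] := reg x y Hx Hy xy.
have [ell [ellP ellI]] := lipschitz_curve_length lip.
have ell_le : ell 1 - ell 0 <= n%:R * M * `|x - y|.
  rewrite -lee_fin (le_trans ellI)// -mulrA EFinM lee_wpmul2l// ?lee_fin//.
apply: (@le_trans _ _ (K * (ell 1 - ell 0))); last first.
  by rewrite -[leRHS]mulrA ler_wpM2l.
rewrite distrC -p0 -p1.
apply: (@increment_le_continuation _ (f \o psi) ell) => t t01.
have [r r0 rK] := locK (psi t) (pH t t01).
exists (r / (`|L| + 1)) => [|a b a0 ab b1 at_ bt].
  by rewrite divr_gt0// ltr_wpDl.
have near_t s : 0 <= s <= 1 -> `|s - t| < r / (`|L| + 1) -> `|psi s - psi t| <= r.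
  move=> s01 st; rewrite (le_trans (lip _ _ s01 t01))//.
  apply: (@le_trans _ _ ((`|L| + 1) * `|s - t|)).
    by rewrite ler_wpM2r// (le_trans (ler_norm _))// lerDl.
  by rewrite mulrC -ler_pdivlMr ?ltW// ltr_wpDl.
have a01 : 0 <= a <= 1 by rewrite a0 (le_trans ab).
have b01 : 0 <= b <= 1 by rewrite b1 (le_trans a0).
apply: (le_trans (rK _ _ (near_t _ a01 at_) (near_t _ b01 bt))).
by rewrite ler_wpM2l// ellP.
Qed.

(** * Positive eigenfunctions of transfer operators *)

Definition transfer {R : realType} {X : Type} {B : finType} (w : B -> X -> R)
    (th : B -> X -> X) (f : X -> R) : X -> R :=
  fun x => \sum_(j : B) w j x * f (th j x).

Section TransferMonotone.
Context {R : realType} {X : Type} {B : finType}.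
Implicit Types (w : B -> X -> R) (th : B -> X -> X) (f g : X -> R).

Lemma transferZ w th c f : transfer w th (fun x => c * f x) = (fun x => c * transfer w th f x).
Proof. by apply/funext => x; rewrite /transfer mulr_sumr; apply: eq_bigr => j _; rewrite mulrCA. Qed.

Lemma iter_transferZ w th c f k :
  iter k (transfer w th) (fun x => c * f x) = (fun x => c * iter k (transfer w th) f x).
Proof. by elim: k => //= k ->; rewrite transferZ. Qed.

Lemma transfer_le w th f g : (forall j x, 0 <= w j x) -> (forall x, f x <= g x) ->
  forall x, transfer w th f x <= transfer w th g x.
Proof. by move=> w0 fg x; apply: ler_sum => j _; rewrite ler_wpM2l. Qed.

Lemma iter_transfer_le w th f g k : (forall j x, 0 <= w j x) -> (forall x, f x <= g x) ->
  forall x, iter k (transfer w th) f x <= iter k (transfer w th) g x.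
Proof. by move=> w0 fg; elim: k => //= k IH x; apply: transfer_le. Qed.

Lemma cvg_transfer w th (f_ : nat -> X -> R) f :
  (forall x, f_ n x @[n --> \oo] --> f x) ->
  forall x, transfer w th (f_ n) x @[n --> \oo] --> transfer w th f x.
Proof.
move=> ff x; apply: cvg_big => [|j _]; first exact: add_continuous.
by apply: cvgMl_tmp; exact: ff.
Qed.

End TransferMonotone.

(* Functions satisfying a Harnack-type inequality; their ratios are controlled
   uniformly and the cone is preserved by the transfer operator. *)
Definition log_lipschitz {R : realType} {X : Type} (d : X -> X -> R) (K : R) (f : X -> R) :=
  (forall x, 0 < f x) /\ forall x y, f x <= expR (K * d x y) * f y.

Section PositiveEigenfunction.
Context {R : realType} {X : Type} {B : finType}.
Variables (w : B -> X -> R) (th : B -> X -> X) (d : X -> X -> R) (x0 : X) (b0 : B).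
Variables (q K D : R).
Hypothesis q01 : 0 <= q < 1.
Hypothesis K0 : 0 <= K.
Hypothesis dD : forall x y, 0 <= d x y <= D.
Hypothesis dth : forall j x y, d (th j x) (th j y) <= q * d x y.
Hypothesis wK : forall j, log_lipschitz d K (w j).

Local Notation T := (transfer w th).
Local Notation K' := (K / (1 - q)).
Local Notation E := (expR (K' * D)).

Let w0 j x : 0 <= w j x. Proof. by have [/(_ x)/ltW] := wK j. Qed.
Let q1 : 0 < 1 - q. Proof. by rewrite subr_gt0; case/andP: q01. Qed.
Let K'0 : 0 <= K'. Proof. by rewrite divr_ge0// ltW. Qed.
Let E0 : 0 < E. Proof. exact: expR_gt0. Qed.

(** The constant K' = K / (1 - q) is the fixed point of K' = K + q K': the weight contributes K, and
    the contraction by [th] reduces the constant of [f] to q K'. *)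
Lemma log_lipschitz_transfer f : log_lipschitz d K' f -> log_lipschitz d K' (T f).
Proof.
move=> [f0 fK]; split=> [x|x y].
  rewrite /transfer (bigD1 b0)//= ltr_wpDr// ?sumr_ge0// => [j _|].
    by rewrite mulr_ge0// ltW.
  by rewrite mulr_gt0//; have [] := wK b0.
rewrite /transfer mulr_sumr; apply: ler_sum => j _.
have [wj0 wjK] := wK j.
apply: (@le_trans _ _ ((expR (K * d x y) * w j y) * (expR (K' * (q * d x y)) * f (th j y)))).
  apply: ler_pM => //; first exact: ltW.
  apply: (le_trans (fK _ (th j y))); rewrite ler_wpM2r ?(ltW (f0 _))// ler_expR.
  by rewrite ler_wpM2l.
rewrite mulrACA -expRD (_ : K * _ + _ = K' * d x y)//.
by field; rewrite gt_eqF.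
Qed.

Lemma log_lipschitz_ratio f x y : log_lipschitz d K' f -> f x <= E * f y.
Proof.
move=> [f0 fK]; rewrite (le_trans (fK x y))// ler_wpM2r ?(ltW (f0 _))// ler_expR.
by rewrite ler_wpM2l//; have /andP[] := dD x y.
Qed.

Let U k := iter k T (fun=> 1).
Let u k := U k x0.

Let U_cone k : log_lipschitz d K' (U k).
Proof.
elim: k => [|k IH]; last exact: log_lipschitz_transfer.
split=> // x y; rewrite /U/= mulr1 -[leLHS]expR0 ler_expR mulr_ge0//.
by have /andP[] := dD x y.
Qed.

Let u0 k : 0 < u k. Proof. by have [+ _] := U_cone k; apply. Qed.

Let UD k l : U (k + l) = iter k T (U l). Proof. by rewrite /U iterD. Qed.

Let u_add_le k l : u (k + l) <= E * (u k * u l).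
Proof.
rewrite {1}/u UD.
apply: (@le_trans _ _ (iter k T (fun x => (E * u l) * 1) x0)).
  apply: iter_transfer_le => // x; rewrite mulr1.
  exact: (log_lipschitz_ratio x x0 (U_cone l)).
by rewrite iter_transferZ -mulrA (mulrC (u l)).
Qed.

Let u_add_ge k l : u k * u l <= E * u (k + l).
Proof.
rewrite {3}/u UD -ler_pdivrMl// (mulrC (u k)) mulrA.
apply: (@le_trans _ _ (iter k T (fun x => (E^-1 * u l) * 1) x0)).
  by rewrite iter_transferZ.
apply: iter_transfer_le => // x; rewrite mulr1 ler_pdivrMl//.
exact: (log_lipschitz_ratio x0 x (U_cone l)).
Qed.

Let v k := ln (u k).
Let e := K' * D.

Let uE k : u k = expR (v k). Proof. by rewrite /v lnK// posrE. Qed.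

Let v_mul k l : l.+1%:R * v k - l%:R * e <= v (k * l.+1) <= l.+1%:R * v k + l%:R * e.
Proof.
have v1 i j : v (i + j) <= e + (v i + v j).
  by rewrite -ler_expR !expRD -!uE u_add_le.
have v2 i j : v i + v j <= e + v (i + j).
  by rewrite -ler_expR !expRD -!uE u_add_ge.
elim: l => [|l /andP[IH1 IH2]]; first by rewrite muln1 mul1r !mul0r subr0 addr0 lexx.
have := v1 k (k * l.+1)%N; have := v2 k (k * l.+1)%N; rewrite -mulnS.
move: IH1 IH2; rewrite -!(natr1 l.+1) -!(natr1 l) => *.
by apply/andP; split; lra.
Qed.

(* Fekete: log u is additive up to a constant. *)
Let growth_rate : exists2 rho : R, 0 < rho &
  forall k, u k <= E * rho ^+ k /\ rho ^+ k <= E * u k.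
Proof.
have e0 : 0 <= e.
  by rewrite mulr_ge0//; have /andP[h1 h2] := dD x0 x0; exact: le_trans h2.
(* Both sides are compared through [v] at the product of the indices: for positive indices every
   (v_k - e) / k lies below every (v_l + e) / l, and the supremum of the former is the growth
   exponent. *)
have vkl k l : l.+1%:R * (v k.+1 - e) <= k.+1%:R * (v l.+1 + e).
  have /andP[h1 _] := v_mul k.+1 l; have /andP[_ h2] := v_mul l.+1 k.
  have := le_trans h1 (eq_ind _ (fun i => v i <= _) h2 _ (mulnC l.+1 k.+1)).
  rewrite -!(natr1 l) -!(natr1 k); lra.
pose S := range (fun k => (v k.+1 - e) / k.+1%:R).
have ubS l : ubound S ((v l.+1 + e) / l.+1%:R).
  by move=> _ [k _ <-]; rewrite ler_pdivrMr ?ltr0n// mulrAC ler_pdivlMr ?ltr0n// mulrC (mulrC _ k.+1%:R).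
have S0 : S !=set0 by exists ((v 1%N - e) / 1%:R), 0%N.
exists (expR (sup S)); first exact: expR_gt0.
move=> [|k].
  rewrite !expr0 /u /U /= mulr1 -[X in X <= _]expR0 ler_expR.
  by rewrite -/e e0.
rewrite -expRM_natl !uE -!expRD !ler_expR; split.
  rewrite -lerBlDl -ler_pdivrMl ?ltr0n// mulrC.
  by apply: ub_le_sup; [exists ((v 1%N + e) / 1%:R); exact: ubS|exists k].
rewrite mulrC -ler_pdivlMr ?ltr0n// addrC; apply: ge_sup => //; exact: ubS.
Qed.

(** The bare set [X] offers no compactness. The normalized iterates [V k] lie between two positive
    constants, and their upper limit [g] satisfies rho g <= T g, because T of a supremum is at least
    the supremum of the images. Then rho^-k T^k g increases with k, stays bounded and converges to
    an eigenfunction; the cone condition passes to pointwise limits. *)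
Lemma transfer_eigenfunction : exists (lam : R) (h : X -> R),
  [/\ 0 < lam, log_lipschitz d K' h & T h = (fun x => lam * h x)].
Proof.
have [rho rho0 rhoP] := growth_rate.
pose V k x := U k x / rho ^+ k.
have rk0 k : 0 < rho ^+ k by rewrite exprn_gt0.
have V_le k x : V k x <= E * E.
  rewrite /V ler_pdivrMr// (le_trans (log_lipschitz_ratio x x0 (U_cone k)))//.
  by rewrite -[leRHS]mulrA ler_wpM2l ?(ltW E0)//; have [] := rhoP k.
have V_ge k x : (E * E)^-1 <= V k x.
  rewrite /V ler_pdivlMr// ler_pdivrMl ?mulr_gt0//.
  have [_ h] := rhoP k; rewrite (le_trans h)// -[leRHS]mulrA ler_wpM2l ?(ltW E0)//.
  exact: (log_lipschitz_ratio x0 x (U_cone k)).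
have TV k x : T (V k) x = rho * V k.+1 x.
  have -> : V k = (fun x => (rho ^+ k)^-1 * U k x) by apply/funext => y; rewrite /V mulrC.
  rewrite transferZ /V -[T (U k)]/(U k.+1) exprS.
  by field; rewrite !gt_eqF.
have scale_cone (c : R) f : 0 < c -> log_lipschitz d K' f ->
    log_lipschitz d K' (fun x => c * f x).
  move=> c0 [f0 fK]; split=> [x|x y]; first by rewrite mulr_gt0.
  by rewrite mulrCA ler_wpM2l// ltW.
have V_cone k : log_lipschitz d K' (V k).
  have -> : V k = (fun x => (rho ^+ k)^-1 * U k x) by apply/funext => y; rewrite /V mulrC.
  by apply: scale_cone => //; rewrite invr_gt0.
pose S n x := [set V k x | k in [set k | (n <= k)%N]].
have S0 n x : S n x !=set0 by exists (V n x), n => /=.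
have ubS n x : ubound (S n x) (E * E) by move=> _ [k _ <-].
have hubS n x : has_ubound (S n x) by exists (E * E); exact: ubS.
pose G n x := sup (S n x).
have V_G n k x : (n <= k)%N -> V k x <= G n x.
  by move=> nk; apply: ub_le_sup => //; exists k.
have G_le n x : G n x <= E * E by apply: ge_sup.
have G_ge n x : (E * E)^-1 <= G n x by apply: le_trans (V_G n n x _).
have G_ni x : nonincreasing_seq (G ^~ x).
  move=> n m nm; apply: ge_sup => // _ [k /= mk <-]; apply: V_G.
  exact: leq_trans mk.
have G_cvg x : cvgn (G ^~ x).
  by apply: nonincreasing_is_cvgn => //; exists (E * E)^-1 => _ [n _ <-].
pose g x := limn (G ^~ x).
have g_G n x : g x <= G n x by apply: nonincreasing_cvgn_ge.
have g_ge x : (E * E)^-1 <= g x by apply: limr_ge => //; exact: nearW.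
have G_cone n x y : G n x <= expR (K' * d x y) * G n y.
  apply: ge_sup => // _ [k /= nk <-]; have [_ h] := V_cone k.
  by rewrite (le_trans (h x y))// ler_wpM2l ?expR_ge0// V_G.
have EE0 : 0 < (E * E)^-1 by rewrite invr_gt0 mulr_gt0.
have g_cone : log_lipschitz d K' g.
  split=> [x|x y]; first exact: lt_le_trans (g_ge x).
  apply: (ler_cvg_to (G_cvg x) (cvgMl_tmp (G_cvg y))).
  by apply: nearW => n; exact: G_cone.
have Tg x : rho * g x <= T g x.
  have TG : T (G n) x @[n --> \oo] --> T g x by apply: cvg_transfer => y; exact: G_cvg.
  apply: (cvgr_to_ge TG).
  apply: nearW => n; rewrite (@le_trans _ _ (rho * G n.+1 x))//.
    by rewrite ler_wpM2l// ltW.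
  rewrite -ler_pdivlMl//; apply: ge_sup => // _ [[//|k] /= nk <-].
  rewrite ler_pdivlMl// -TV; apply: transfer_le => // y; exact: V_G.
pose W k x := (rho ^+ k)^-1 * iter k T g x.
have TW k x : T (W k) x = rho * W k.+1 x.
  by rewrite /W transferZ exprS invfM/= mulrA mulVKf// gt_eqF.
have W_nd x : nondecreasing_seq (W ^~ x).
  apply/nondecreasing_seqP => k.
  rewrite /W (_ : (rho ^+ k.+1)^-1 * _ = (rho ^+ k)^-1 * (rho^-1 * iter k.+1 T g x)); last first.
    by rewrite exprS invfM -mulrA mulrCA.
  rewrite ler_wpM2l ?invr_ge0 ?(ltW (rk0 _))// ler_pdivlMl// iterSr.
  rewrite (_ : rho * _ = iter k T (fun x => rho * g x) x); last by rewrite iter_transferZ.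
  exact: iter_transfer_le.
have W_le k x : W k x <= (E * E) * (E * E).
  rewrite /W ler_pdivrMl//.
  apply: (@le_trans _ _ (iter k T (fun x => E * E * 1) x)).
    apply: iter_transfer_le => // y; rewrite mulr1; exact: le_trans (G_le 0%N y).
  rewrite iter_transferZ mulrCA ler_wpM2l ?mulr_ge0 ?expR_ge0//.
  by have := V_le k x; rewrite /V ler_pdivrMr// [_ * rho ^+ k]mulrC.
have W_cvg x : cvgn (W ^~ x).
  by apply: nondecreasing_is_cvgn => //; exists (E * E * (E * E)) => _ [n _ <-].
have W_cone k : log_lipschitz d K' (W k).
  apply: scale_cone; first by rewrite invr_gt0.
  by elim: k => //= k IH; exact: log_lipschitz_transfer.
pose h x := limn (W ^~ x).
exists rho, h; split => //.
  split=> [x|x y].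
    apply: (lt_le_trans (_ : 0 < W 0%N x)); first by have [+ _] := W_cone 0%N; apply.
    exact: nondecreasing_cvgn_le.
  apply: (ler_cvg_to (W_cvg x) (cvgMl_tmp (W_cvg y))).
  by apply: nearW => n; have [_] := W_cone n; apply.
apply/funext => x.
have h1 : T (W n) x @[n --> \oo] --> T h x by apply: cvg_transfer => y; exact: W_cvg.
have h2 : T (W n) x @[n --> \oo] --> rho * h x.
  under eq_fun do rewrite TW.
  by apply: cvgMl_tmp; rewrite (cvg_shiftS (W ^~ x)); exact: W_cvg.
exact: (cvg_unique _ h1 h2).
Qed.

End PositiveEigenfunction.

(** * Contraction of normalized transfer operators *)

Definition dlipschitz {R : realType} {X : Type} (d : X -> X -> R) (f : X -> R) (c : R) : Prop :=
  forall x y, `|f x - f y| <= c * d x y.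

Section GeometricSeries.
Context {R : realType} {X : Type}.
Implicit Types (d : X -> X -> R) (f : X -> R).

Lemma dlipschitzW d f (c c' : R) : (forall x y, 0 <= d x y) -> c <= c' ->
  dlipschitz d f c -> dlipschitz d f c'.
Proof. by move=> d0 cc' fc x y; rewrite (le_trans (fc x y))// ler_wpM2r. Qed.

Lemma dlipschitz_sum d n (F : nat -> X -> R) (c : nat -> R) :
  (forall i, dlipschitz d (F i) (c i)) ->
  dlipschitz d (fun x => \sum_(i < n) F i x) (\sum_(i < n) c i).
Proof.
move=> Fc x y; rewrite -sumrB mulr_suml (le_trans (ler_norm_sum _ _ _))//.
by apply: ler_sum => i _; exact: Fc.
Qed.

Lemma dlipschitz_lim d (F : nat -> X -> R) f (c : R) :
  (forall n, dlipschitz d (F n) c) -> (forall x, F n x @[n --> \oo] --> f x) ->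
  dlipschitz d f c.
Proof.
move=> Fc Ff x y.
have h : `|F n x - F n y| @[n --> \oo] --> `|f x - f y| by apply: cvg_norm; exact: cvgB.
by apply: (cvgr_to_le h); apply: nearW => n; exact: Fc.
Qed.

Lemma geometric_sum_le (r : R) n : 0 <= r < 1 -> \sum_(i < n) r ^+ i <= (1 - r)^-1.
Proof.
move=> /andP[r0 r1]; have r1' : 0 < 1 - r by rewrite subr_gt0.
rewrite -[leRHS]mul1r ler_pdivlMr// mulrC.
have /(congr1 -%R) := subrX1 r n; rewrite opprB -mulNr opprB => <-.
by rewrite lerBlDr lerDl exprn_ge0.
Qed.

Lemma geometric_series_cvg (r c : R) (u : nat -> R) : 0 <= r < 1 ->
  (forall n, `|u n| <= c * r ^+ n) -> cvgn (fun n => \sum_(i < n) u i).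
Proof.
move=> /andP[r0 r1] uc.
rewrite (_ : (fun n => _) = series u); last first.
  by apply/funext => n; rewrite /series/= big_mkord.
apply: normed_cvg; apply: (@series_le_cvg _ _ (geometric c r)) => //.
- by move=> n; exact: normr_ge0.
- by move=> n; exact: le_trans (normr_ge0 _) (uc n).
- by apply: is_cvg_geometric_series; rewrite ger0_norm.
Qed.

End GeometricSeries.

Lemma bounded_oscillation (R : realType) (X : Type) (x0 : X) (f : X -> R) (O : R) :
  (forall x y, `|f x - f y| <= O) -> exists M, forall x, M - O <= f x <= M.
Proof.
move=> fO; have S0 : range f !=set0 by exists (f x0), x0.
have ub y : ubound (range f) (f y + O).
  move=> _ [x _ <-]; rewrite -lerBlDl (le_trans (ler_norm _))//.
exists (sup (range f)) => x; rewrite lerBlDr ge_sup//=.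
by apply: ub_le_sup; [exists (f x + O)|exists x].
Qed.

(** For c >= 0, a function is c-Lipschitz for this metric exactly if its oscillation is at most c
    and its Lipschitz constant for [d] is at most c kappa. *)
Definition capped {R : realType} {X : Type} (kappa : R) (d : X -> X -> R) : X -> X -> R :=
  fun x y => Num.min 1 (kappa * d x y).

Section MarkovContraction.
Context {R : realType} {X : Type} {B : finType}.
Variables (p : B -> X -> R) (th : B -> X -> X) (d : X -> X -> R) (x0 : X).
Variables (q C D : R).
Hypothesis q01 : 0 <= q < 1.
Hypothesis C0 : 0 <= C.
Hypothesis dD : forall x y, 0 <= d x y <= D.
Hypothesis dC : forall x y, d x y = d y x.
Hypothesis dth : forall j x y, d (th j x) (th j y) <= q * d x y.
Hypothesis p1 : forall x, \sum_(j : B) p j x = 1.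
Hypothesis pC : forall j, log_lipschitz d C (p j).

Local Notation L := (transfer p th).
Local Notation C' := (C / (1 - q)).

Let p0 j x : 0 <= p j x. Proof. by have [/(_ x)/ltW] := pC j. Qed.
Let q0 : 0 <= q. Proof. by case/andP: q01. Qed.
Let q1 : 0 < 1 - q. Proof. by rewrite subr_gt0; case/andP: q01. Qed.
Let C'0 : 0 <= C'. Proof. by rewrite divr_ge0// ltW. Qed.
Let d0 x y : 0 <= d x y. Proof. by have /andP[] := dD x y. Qed.
Let D0 : 0 <= D. Proof. by have /andP[h1 h2] := dD x0 x0; exact: le_trans h2. Qed.

(* The measures with weights p j x and p j y share the part e * p j y. *)
Lemma markov_coupling f O V x y :
  (forall a b, `|f a - f b| <= O) -> (forall j, `|f (th j x) - f (th j y)| <= V) ->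
  `|L f x - L f y| <= expR (- (C * d x y)) * V + (1 - expR (- (C * d x y))) * O.
Proof.
move=> fO fV; set e := expR _.
have [M MP] := bounded_oscillation x0 fO.
have pe j : e * p j y <= p j x.
  have [_ /(_ y x)] := pC j; rewrite dC => h.
  by rewrite /e expRN ler_pdivrMl ?expR_gt0.
have e1 : e <= 1 by rewrite -[leRHS]expR0 ler_expR oppr_le0 mulr_ge0.
have sa : \sum_j (p j x - e * p j y) = 1 - e by rewrite sumrB -mulr_sumr !p1 mulr1.
have sb : \sum_j (p j y - e * p j y) = 1 - e by rewrite sumrB -mulr_sumr !p1 mulr1.
have -> : L f x - L f y = e * \sum_j p j y * (f (th j x) - f (th j y)) +
   (\sum_j (p j x - e * p j y) * f (th j x) - \sum_j (p j y - e * p j y) * f (th j y)).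
  rewrite mulr_sumr -!sumrB -big_split/=; apply: eq_bigr => j _; ring.
rewrite (le_trans (ler_normD _ _))// lerD//.
  rewrite normrM (ger0_norm (expR_ge0 _)) ler_wpM2l ?expR_ge0//.
  rewrite (le_trans (ler_norm_sum _ _ _))// -[leRHS]mul1r -(p1 y) mulr_suml.
  by apply: ler_sum => j _; rewrite normrM ger0_norm// ler_wpM2l.
have bound (a : B -> R) (z : X) : (forall j, 0 <= a j) -> \sum_j a j = 1 - e ->
    (1 - e) * (M - O) <= \sum_j a j * f (th j z) <= (1 - e) * M.
  move=> a0 <-; rewrite !mulr_suml; apply/andP; split; apply: ler_sum => j _;
    by rewrite ler_wpM2l//; have /andP[] := MP (th j z).
have /andP[a1 a2] : (1 - e) * (M - O) <= \sum_j (p j x - e * p j y) * f (th j x) <= (1 - e) * M.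
  by apply: bound => // j; rewrite subr_ge0.
have /andP[b1 b2] : (1 - e) * (M - O) <= \sum_j (p j y - e * p j y) * f (th j y) <= (1 - e) * M.
  by apply: bound => // j; rewrite subr_ge0 ler_piMl.
rewrite ler_norml; apply/andP; split; lra.
Qed.

(** At step i a pair at distance at most q^i d(x, y) stays coupled with weight at least exp (- C q^i
    d(x, y)). The product of these weights is at least exp (- C' d(x, y)), uniformly in [k]. Coupled
    pairs end at distance at most q^k d(x, y), and the remaining mass costs the oscillation. *)
Lemma iter_markov_contraction f O P k x y :
  0 <= O -> 0 <= P -> (forall a b, `|f a - f b| <= O) -> dlipschitz d f P ->
  `|iter k L f x - iter k L f y| <=
    P * q ^+ k * d x y + (1 - expR (- (C' * d x y))) * O.
Proof.
move=> O0 P0 fO fP.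
have osc i a b : `|iter i L f a - iter i L f b| <= O.
  elim: i a b => //= i IH a b.
  by rewrite (le_trans (markov_coupling IH (fun j => IH _ _)))// -mulrDl addrC subrK mul1r.
elim: k x y => [|k IH] x y /=.
  rewrite expr0 mulr1 (le_trans (fP x y))// lerDl mulr_ge0// subr_ge0 -[leRHS]expR0 ler_expR.
  by rewrite oppr_le0 mulr_ge0.
set V := P * q ^+ k.+1 * d x y + (1 - expR (- (C' * (q * d x y)))) * O.
have hV j : `|iter k L f (th j x) - iter k L f (th j y)| <= V.
  rewrite (le_trans (IH _ _))// /V lerD//.
    by rewrite exprSr (mulrA P) -[leRHS]mulrA ler_wpM2l ?mulr_ge0 ?exprn_ge0.
  by rewrite ler_wpM2r// lerD2l lerN2 ler_expR lerN2 ler_wpM2l.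
rewrite (le_trans (markov_coupling (osc k) hV))//.
set e := expR (- (C * _)); rewrite /V; set e' := expR (- (C' * (q * _))).
have -> : expR (- (C' * d x y)) = e * e'.
  rewrite -expRD; congr expR; by field; rewrite gt_eqF.
have e0 : 0 <= e by exact: expR_ge0.
have e1 : e <= 1 by rewrite -[leRHS]expR0 ler_expR oppr_le0 mulr_ge0.
have : 0 <= P * q ^+ k.+1 * d x y by rewrite !mulr_ge0 ?exprn_ge0.
set Q := P * _ * _ => Q0; nra.
Qed.

Lemma markov_capped_contraction : exists (kappa r A : R) (k0 : nat),
  [/\ 0 < kappa, 0 <= r < 1, 0 <= A & forall f c, 0 <= c -> dlipschitz (capped kappa d) f c ->
    dlipschitz (capped kappa d) (iter k0 L f) (r * c) /\
    dlipschitz (capped kappa d) (L f) (A * c)].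
Proof.
(* Near the diagonal 1 - exp (- C' d) <= C' d, at most half of kappa d; where the cap is reached,
   the same quantity is at most 1 - t with t = exp (- C' D). The other terms carry q^k, so both
   bounds drop below 1 for large k. *)
have [kappa kappaE] : exists kappa, kappa = 2 * C' + 1 by exists (2 * C' + 1).
have kappa0 : 0 < kappa by rewrite kappaE ltr_wpDl// mulr_ge0.
pose t := expR (- (C' * D)).
have t0 : 0 < t by exact: expR_gt0.
have t1 : t <= 1 by rewrite -[leRHS]expR0 ler_expR oppr_le0 mulr_ge0.
have key f c k : 0 <= c -> dlipschitz (capped kappa d) f c ->
    dlipschitz (capped kappa d) (iter k L f)
      (Num.max (kappa * q ^+ k * D + (1 - t)) (q ^+ k + 1 / 2) * c).
  move=> c0 fc x y; set M := Num.max _ _.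
  have osc a b : `|f a - f b| <= c.
    by rewrite (le_trans (fc a b))// ler_piMr// ge_min lexx.
  have lip : dlipschitz d f (c * kappa).
    by move=> a b; rewrite (le_trans (fc a b))// -mulrA ler_wpM2l// ge_min lexx orbT.
  have /(_ (mulr_ge0 c0 (ltW kappa0))) := iter_markov_contraction k x y c0 _ osc lip.
  move/le_trans; apply.
  have qk0 : 0 <= q ^+ k by rewrite exprn_ge0.
  have exp_ge : 1 - C' * d x y <= expR (- (C' * d x y)).
    by rewrite -[X in 1 + X]mulN1r mulrC mulrN1; exact: expR_ge1Dx.
  have exp_ge' : t <= expR (- (C' * d x y)).
    by rewrite ler_expR lerN2 ler_wpM2l//; have /andP[] := dD x y.
  have dxy := d0 x y; have /andP[_ dxD] := dD x y.
  have M1 : kappa * q ^+ k * D + (1 - t) <= M by rewrite le_max lexx.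
  have M2 : q ^+ k + 1 / 2 <= M by rewrite le_max lexx orbT.
  rewrite /capped /Num.min; case: ifPn => _.
    have : kappa * q ^+ k * d x y <= kappa * q ^+ k * D by rewrite ler_wpM2l// mulr_ge0// ltW.
    move=> h; rewrite mulr1 (mulrC M).
    rewrite (_ : _ + _ = c * (kappa * q ^+ k * d x y + (1 - expR (- (C' * d x y))))); last by ring.
    by rewrite ler_wpM2l// (le_trans _ M1)// lerD// lerB.
  rewrite (_ : _ + _ = c * (kappa * q ^+ k * d x y + (1 - expR (- (C' * d x y))))); last by ring.
  rewrite (mulrC M) -[leRHS]mulrA ler_wpM2l//.
  apply: (@le_trans _ _ ((q ^+ k + 1 / 2) * (kappa * d x y))).
    rewrite mulrDl (_ : kappa * _ * _ = q ^+ k * (kappa * d x y)); last by ring.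
    rewrite lerD// kappaE; nra.
  by rewrite ler_wpM2r// mulr_ge0// ltW.
have qlim : q ^+ k @[k --> \oo] --> 0 by apply: cvg_expr; rewrite ger0_norm//; case/andP: q01.
have KD : 0 < kappa * D + 1 by rewrite ltr_wpDl// mulr_ge0// ltW.
(* The two bounds make q^k0 + 1/2 at most 3/4 and kappa q^k0 D at most t/2. *)
pose eps := Num.min (1 / 4) (t / 2 / (kappa * D + 1)).
have eps0 : 0 < eps by rewrite lt_min; apply/andP; split; rewrite ?divr_gt0.
have [k0 _ hk0] : \forall k \near \oo, q ^+ k <= eps.
  have /cvgr0Pnorm_le/(_ _ eps0) := qlim.
  by apply: filterS => k; rewrite ger0_norm// exprn_ge0.
have {}hk0 := hk0 k0 (leqnn _).
pose M k := Num.max (kappa * q ^+ k * D + (1 - t)) (q ^+ k + 1 / 2).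
have M0 k : 0 <= M k by rewrite le_max; apply/orP; right; rewrite addr_ge0 ?exprn_ge0.
exists kappa, (M k0), (M 1%N), k0; split => //.
  rewrite M0/= /M gt_max; apply/andP; split; last first.
    have : q ^+ k0 <= 1 / 4 by rewrite (le_trans hk0)// ge_min lexx.
    lra.
  have : q ^+ k0 <= t / 2 / (kappa * D + 1) by rewrite (le_trans hk0)// ge_min lexx orbT.
  rewrite ler_pdivlMr// mulrDr mulr1 => h.
  have : 0 <= q ^+ k0 by rewrite exprn_ge0.
  rewrite (_ : kappa * q ^+ k0 * D = q ^+ k0 * (kappa * D)); last by ring.
  lra.
move=> f c c0 fc; split; first exact: key.
exact: (key f c 1%N).
Qed.

(* Solvability of (1 - L) g = f modulo constants. *)
Lemma markov_poisson : exists (kappa S A : R) (res : (X -> R) -> X -> R),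
  [/\ 0 < kappa, 0 <= S, 0 <= A & forall f c, 0 <= c -> dlipschitz (capped kappa d) f c ->
    [/\ dlipschitz (capped kappa d) (L f) (A * c),
      dlipschitz (capped kappa d) (res f) (S * c), res f x0 = 0 &
      forall x, res f x - (L (res f) x - L (res f) x0) = f x - f x0]].
Proof.
have [kappa [r [A [k0 [kappa0 r01 A0 HL]]]]] := markov_capped_contraction.
pose cd := capped kappa d.
have cd0 x y : 0 <= cd x y by rewrite le_min ler01/= mulr_ge0// ltW.
have cd1 x y : cd x y <= 1 by rewrite ge_min lexx.
(* The solution is the sum over k of [Ec] applied to L^k f, normalized to vanish at [x0]. Since only
   L^k0 is known to contract, the series is summed in blocks of [k0] terms. *)
pose Ec (f : X -> R) x := f x - f x0.
pose blk f j x := \sum_(i < k0) Ec (iter i L (iter (k0 * j) L f)) x.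
pose u f n x := \sum_(j < n) blk f j x.
pose a := \sum_(i < k0) A ^+ i.
have a0 : 0 <= a by apply: sumr_ge0 => i _; exact: exprn_ge0.
have r1 : 0 < 1 - r by rewrite subr_gt0; case/andP: r01.
have r0 : 0 <= r by case/andP: r01.
have Ec_lip f c : dlipschitz cd f c -> dlipschitz cd (Ec f) c.
  by move=> fc x y; rewrite /Ec (_ : _ - _ = f x - f y)//; ring.
have blk_lip f c j : 0 <= c -> dlipschitz cd f c -> dlipschitz cd (blk f j) (a * c * r ^+ j).
  move=> c0 fc; rewrite /a -mulrA mulr_suml.
  apply: (@dlipschitz_sum _ _ cd k0 (fun i => Ec (iter i L (iter (k0 * j) L f)))
    (fun i => A ^+ i * (c * r ^+ j))) => i; apply: Ec_lip.
  have c0' : 0 <= c * r ^+ j by rewrite mulr_ge0// exprn_ge0.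
  have step : dlipschitz cd (iter (k0 * j) L f) (c * r ^+ j).
    elim: j {c0'} => [|j IH]; first by rewrite muln0 mulr1.
    rewrite mulnS iterD exprS mulrCA; apply: (HL _ _ _ IH).1.
    by rewrite mulr_ge0// exprn_ge0.
  elim: (i : nat) => [|i' IH] /=; first by rewrite mul1r.
  rewrite exprS -mulrA; apply: (HL _ _ _ IH).2.
  by rewrite mulr_ge0// exprn_ge0.
have blk0 f j : blk f j x0 = 0 by apply: big1 => i _; rewrite /Ec subrr.
exists kappa, (a / (1 - r)), A, (fun f x => limn (fun n => u f n x)); split => //.
  by rewrite divr_ge0// ltW.
move=> f c c0 fc.
have cvgu x : cvgn (fun n => u f n x).
  apply: (@geometric_series_cvg _ r (a * c) (fun n => blk f n x)) => // n.
  rewrite -[blk f n x]subr0 -(blk0 f n).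
  rewrite (le_trans (blk_lip f c n c0 fc x x0))// ler_piMr// !mulr_ge0// exprn_ge0//.
split; first exact: (HL f c c0 fc).2.
- apply: (@dlipschitz_lim _ _ _ (u f)); last by move=> x; exact: cvgu.
  move=> n; apply: (@dlipschitzW _ _ _ _ (\sum_(j < n) a * c * r ^+ j)) => //.
    rewrite -mulr_sumr (_ : a / (1 - r) * c = a * c * (1 - r)^-1); last by rewrite mulrAC.
    rewrite ler_wpM2l ?mulr_ge0//.
    exact: geometric_sum_le.
  apply: (@dlipschitz_sum _ _ cd n (blk f) (fun j => a * c * r ^+ j)) => j.
  exact: blk_lip.
- rewrite (_ : (fun n => u f n x0) = fun=> 0); first exact: lim_cst.
  by apply/funext => n; apply: big1 => j _; exact: blk0.
move=> x; set g := fun x => limn _.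
have L1 (h : X -> R) (e : R) y : L (fun z => h z - e) y = L h y - e.
  rewrite /transfer -[in RHS](mulr1 e) -(p1 y) mulr_sumr -sumrB.
  by apply: eq_bigr => j _; rewrite mulrBr (mulrC e).
have Lsum n (F : 'I_n -> X -> R) y : L (fun z => \sum_(i < n) F i z) y = \sum_(i < n) L (F i) y.
  rewrite /transfer exchange_big/=; apply: eq_bigr => j _; by rewrite mulr_sumr.
have blkE j y : blk f j y - (L (blk f j) y - L (blk f j) x0) =
    Ec (iter (k0 * j) L f) y - Ec (iter (k0 * j.+1) L f) y.
  rewrite /blk !Lsum -!sumrB mulnS iterD.
  set F := iter (k0 * j) L f.
  have tel := telescope_sumr (fun i => - Ec (iter i L F) y) (leq0n k0).
  rewrite (_ : Ec F y - _ = - Ec (iter k0 L F) y - (- Ec (iter 0 L F) y)); last by ring.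
  rewrite -tel big_mkord; apply: eq_bigr => i _.
  rewrite /Ec !L1 /=; ring.
have uE n y : u f n y - (L (u f n) y - L (u f n) x0) = Ec f y - Ec (iter (k0 * n) L f) y.
  rewrite /u !Lsum -!sumrB (eq_bigr _ (fun j _ => blkE (val j) y)).
  have tel := telescope_sumr (fun j => - Ec (iter (k0 * j) L f) y) (leq0n n).
  rewrite (_ : Ec f y - _ = - Ec (iter (k0 * n) L f) y - (- Ec (iter (k0 * 0) L f) y)); last first.
    by rewrite muln0 /=; ring.
  by rewrite -tel big_mkord; apply: eq_bigr => i _; ring.
have lim1 : (u f n x - (L (u f n) x - L (u f n) x0)) @[n --> \oo] --> g x - (L g x - L g x0).
  by apply: cvgB; [exact: cvgu|apply: cvgB; apply: cvg_transfer => y; exact: cvgu].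
have lim2 : (u f n x - (L (u f n) x - L (u f n) x0)) @[n --> \oo] --> f x - f x0.
  under eq_fun do rewrite uE.
  rewrite -[f x - f x0]subr0; apply: cvgB; first exact: cvg_cst.
  apply/norm_cvg0P.
  apply: (@squeeze_cvgr _ _ _ _ (fun=> 0) (fun n => c * r ^+ n)); last 2 first.
  - exact: cvg_cst.
  - by rewrite -(mulr0 c); apply: cvgMl_tmp; apply: cvg_expr; rewrite ger0_norm//; case/andP: r01.
  apply: nearW => n; rewrite normr_ge0/=.
  have : dlipschitz cd (iter (k0 * n) L f) (c * r ^+ n).
    elim: n => [|j IH]; first by rewrite muln0 mulr1.
    rewrite mulnS iterD exprS mulrCA; apply: (HL _ _ _ IH).1.
    by rewrite mulr_ge0// exprn_ge0.
  by move=> /(_ x x0)/le_trans; apply; rewrite ler_piMr// mulr_ge0// exprn_ge0.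
exact: (cvg_unique _ lim1 lim2).
Qed.

End MarkovContraction.

(** * Analytic perturbation of the eigenvalue *)

(** Iterating [F] on sequences freezes the first n entries after n rounds; the solution is read off
    the diagonal. *)
Lemma strong_recursion (T : Type) (t0 : T) (F : (nat -> T) -> nat -> T) :
  (forall u v k, (forall i, (i < k)%N -> u i = v i) -> F u k = F v k) ->
  exists u, forall k, u k = F u k.
Proof.
move=> Fext; pose U n := iter n F (fun=> t0).
have stable k : forall n m, (k < n)%N -> (k < m)%N -> U n k = U m k.
  elim/ltn_ind: k => k IH [//|n] [//|m] kn km; apply: Fext => i ik.
  by apply: IH => //; exact: leq_trans ik _.
exists (fun k => U k.+1 k) => k; apply: Fext => i ik.
exact: stable.
Qed.

Lemma sum_triangle (R : realType) (F : nat -> nat -> R) N :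
  \sum_(k < N) \sum_(i < k.+1) F i (k - i)%N = \sum_(i < N) \sum_(l < N - i) F i l.
Proof.
elim: N => [|N IH]; first by rewrite !big_ord0.
rewrite big_ord_recr/= IH [RHS]big_ord_recr/= subSnn big_ord1.
rewrite [X in _ + X = _]big_ord_recr/= subnn addrA; congr (_ + _).
rewrite -big_split/=; apply: eq_bigr => i _.
by rewrite subSn ?(ltnW (ltn_ord i))// big_ord_recr.
Qed.

Lemma le_sum_ord (R : realType) (b : nat -> R) (M N : nat) : (forall i, 0 <= b i) ->
  (M <= N)%N -> \sum_(i < M) b i <= \sum_(i < N) b i.
Proof.
move=> b0 MN; rewrite -(subnKC MN) big_split_ord/= lerDl.
by apply: sumr_ge0 => i _; exact: b0.
Qed.

(** As both sequences vanish at 0, the orders up to N involve only indices below N. This gain of one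
    index closes the induction in [quadratic_majorant]. *)
Lemma convolution_le (R : realType) (a b : nat -> R) N :
  (forall i, 0 <= a i) -> (forall i, 0 <= b i) -> a 0%N = 0 -> b 0%N = 0 ->
  \sum_(k < N.+1) \sum_(i < k.+1) a i * b (k - i)%N <=
    (\sum_(i < N) a i) * (\sum_(l < N) b l).
Proof.
move=> a0 b0 a00 b00; rewrite (sum_triangle (fun i l => a i * b l)).
rewrite big_ord_recr/= subSnn big_ord1 b00 mulr0 addr0 mulr_suml.
apply: ler_sum => -[[|i] iN] _ /=.
  by rewrite a00 mul0r big1// => l _; rewrite mul0r.
rewrite -mulr_sumr ler_wpM2l//; apply: le_sum_ord => //.
by rewrite subSS leq_subr.
Qed.

(** The product of the partial sums exceeds the triangular sum by the terms with N <= i + l. There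
    (1/4)^(i+l) is at most (1/2)^N (1/2)^i (1/2)^l, so the excess is of order (1/2)^N. *)
Lemma cvg_cauchy_product (R : realType) (C : R) (u v : nat -> R) (su sv : R) :
  (forall k, `|u k| <= C * (1 / 4) ^+ k) -> (forall k, `|v k| <= C * (1 / 4) ^+ k) ->
  \sum_(k < N) u k @[N --> \oo] --> su -> \sum_(k < N) v k @[N --> \oo] --> sv ->
  \sum_(k < N) \sum_(i < k.+1) u i * v (k - i)%N @[N --> \oo] --> su * sv.
Proof.
move=> uC vC hu hv.
have C0 : 0 <= C by have := le_trans (normr_ge0 _) (uC 0%N); rewrite mulr1.
have -> : (fun N => \sum_(k < N) \sum_(i < k.+1) u i * v (k - i)%N) =
    (fun N => (\sum_(k < N) u k) * (\sum_(k < N) v k) -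
      \sum_(i < N) \sum_(l < N | (N <= i + l)%N) u i * v l).
  apply/funext => N; rewrite (sum_triangle (fun i l => u i * v l)).
  rewrite mulr_suml -sumrB; apply: eq_bigr => i _.
  rewrite mulr_sumr (bigID (fun l : 'I_N => (N <= i + l)%N) xpredT)/= addrC addrK.
  rewrite (big_ord_widen _ (fun l => u i * v l) (leq_subr i N)).
  by apply: eq_bigl => l; rewrite -ltnNge ltn_subRL.
rewrite -[su * sv]subr0; apply: cvgB; first exact: cvgM.
apply/norm_cvg0P; apply: (@squeeze_cvgr _ _ _ _ (fun=> 0) (fun N => C * C * 4 * (1 / 2) ^+ N)).
- apply: nearW => N; rewrite normr_ge0/=.
  apply: (@le_trans _ _ (\sum_(i < N) \sum_(l < N) C * C * (1 / 2) ^+ N * ((1 / 2) ^+ i * (1 / 2) ^+ l))).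
    rewrite (le_trans (ler_norm_sum _ _ _))//; apply: ler_sum => i _.
    rewrite (le_trans (ler_norm_sum _ _ _))// [leRHS](bigID (fun l : 'I_N => (N <= i + l)%N))/=.
    rewrite ler_wpDr//.
      by apply: sumr_ge0 => l _; rewrite !mulr_ge0 ?exprn_ge0.
    apply: ler_sum => l il; rewrite normrM (le_trans (ler_pM _ _ (uC _) (vC _)))//.
    rewrite mulrACA -[leRHS]mulrA ler_wpM2l ?mulr_ge0// -!exprD.
    have -> : 1 / 4 = (1 / 2) ^+ 2 :> R by rewrite expr2; field.
    rewrite -exprM mul2n -addnn !exprD ler_wpM2r ?mulr_ge0 ?exprn_ge0// -!exprD.
    by rewrite ler_wiXn2l//; lra.
  under eq_bigr do rewrite -mulr_sumr -mulr_sumr.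
  rewrite -mulr_sumr -mulr_suml (_ : C * C * 4 * _ = C * C * (1 / 2) ^+ N * 4); last by ring.
  rewrite ler_wpM2l ?mulr_ge0 ?exprn_ge0//.
  have -> : 4 = 2 * 2 :> R by ring.
  have g : \sum_(i < N) (1 / 2) ^+ i <= 2 :> R.
    rewrite (le_trans (geometric_sum_le _ _))//; first by apply/andP; split; lra.
    by rewrite (_ : (1 - 1 / 2)^-1 = 2)//; field.
  by rewrite ler_pM// sumr_ge0// => i _; rewrite exprn_ge0.
- exact: cvg_cst.
- rewrite -(mulr0 (C * C * 4)); apply: cvgMl_tmp; apply: cvg_expr.
  by rewrite ger0_norm; lra.
Qed.

(* Majorants for the coefficients of a formal solution of the quadratic
   eigenvalue equation: the partial sums stay below a fixed threshold. *)
Lemma quadratic_majorant (R : realType) (S A G : R) (ga e : nat -> R) :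
  0 <= S -> 0 <= A -> 0 <= G -> (forall k, 0 <= ga k) -> (forall k, 0 <= e k) ->
  ga 0%N = 0 -> e 0%N = 0 ->
  let Gp k := if k is 0 then 0 else G ^+ k in
  (forall k, ga k.+1 <= S * (G ^+ k.+1 + \sum_(i < k.+2) Gp i * ga (k.+1 - i)%N +
      \sum_(i < k.+2) e i * ga (k.+1 - i)%N)) ->
  (forall k, e k.+1 <= A * ga k.+1 + (G ^+ k.+1 + \sum_(i < k.+2) Gp i * ga (k.+1 - i)%N)) ->
  exists r, 0 < r /\ forall N, \sum_(k < N) ga k * r ^+ k <= 1 / 2 /\
    \sum_(k < N) e k * r ^+ k <= A + 1.
Proof.
move=> S0 A0 G0 ga0 e0 ga00 e00 Gp gaH eH.
have SA : 0 < 2 * (S + 1) * (A + 1) by rewrite !mulr_gt0// ltr_wpDl.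
(* [eta] is the threshold for the partial sums of [ga]; with this value the quadratic contribution S
   (A + 1) eta^2 is at most eta / 2. *)
have [eta eta0 etaE] : exists2 eta, 0 < eta & 2 * (S + 1) * (A + 1) * eta = 1.
  exists (2 * (S + 1) * (A + 1))^-1; first by rewrite invr_gt0.
  by rewrite divff// gt_eqF.
have etaS : S * (A + 1) * eta <= 1 / 2.
  have := mulr_ge0 A0 (ltW eta0).
  lra.
have eta12 : eta <= 1 / 2.
  have : 0 <= S * A * eta by rewrite !mulr_ge0// ltW.
  have : 0 <= S * eta by rewrite !mulr_ge0// ltW.
  have : 0 <= A * eta by rewrite !mulr_ge0// ltW.
  lra.
have GS : 0 < 8 * (G + 1) * (S + 1) by nra.
(* [r] is so small that [t] below, which bounds the sum of (G r)^k over k >= 1, leaves at most eta /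
   2 for the remaining contribution S (t + t eta). *)
have [r r0 rE] : exists2 r, 0 < r & 8 * (G + 1) * (S + 1) * r = eta.
  exists (eta / (8 * (G + 1) * (S + 1))); first by rewrite divr_gt0.
  by rewrite mulrC divfK// gt_eqF.
have [t tE] : exists t, t = 2 * (G * r) by exists (2 * (G * r)).
have Gr0 : 0 <= G * r by rewrite mulr_ge0// ltW.
have tS : 2 * t * (S + 1) <= eta / 2.
  have : 0 <= r * (S + 1) by rewrite mulr_ge0 ?addr_ge0// ltW.
  rewrite tE; lra.
have tS0 : 0 <= t * S by rewrite tE; apply: mulr_ge0 => //; apply: mulr_ge0.
have t0 : 0 <= t by rewrite tE mulr_ge0.
have Gr2 : G * r <= 1 / 2 by nra.
have Gsum N : \sum_(k < N) Gp k * r ^+ k <= t.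
  case: N => [|N]; first by rewrite big_ord0.
  rewrite big_ord_recl/= mul0r add0r.
  under eq_bigr do rewrite /bump leq0n add1n -exprMn exprS.
  rewrite -mulr_sumr tE mulrC ler_wpM2r//.
  have Gr01 : 0 <= G * r < 1 by rewrite Gr0 (le_lt_trans Gr2)//; lra.
  rewrite (le_trans (geometric_sum_le _ Gr01))// -[leRHS]invrK lef_pV2 ?posrE ?invr_gt0//; lra.
have Gp0 k : 0 <= Gp k by case: k => //= k; rewrite exprn_ge0.
have conv (a b : nat -> R) N : (forall i, 0 <= a i) -> (forall i, 0 <= b i) -> a 0%N = 0 -> b 0%N = 0 ->
    \sum_(k < N) (\sum_(i < k.+2) a i * b (k.+1 - i)%N) * r ^+ k.+1 <=
    (\sum_(i < N) a i * r ^+ i) * (\sum_(l < N) b l * r ^+ l).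
  move=> a0 b0 a00 b00.
  have := @convolution_le R (fun i => a i * r ^+ i) (fun i => b i * r ^+ i) N.
  rewrite a00 b00 !mul0r => /(_ _ _ erefl erefl) h.
  apply: le_trans (h _ _); last 2 first.
  - by move=> i; rewrite mulr_ge0// exprn_ge0// ltW.
  - by move=> i; rewrite mulr_ge0// exprn_ge0// ltW.
  rewrite [leRHS]big_ord_recl/= big_ord1 a00 !mul0r add0r.
  apply: ler_sum => k _; rewrite mulr_suml /bump leq0n add1n; apply: ler_sum => i _.
  have ik : (i <= k.+1)%N by rewrite -ltnS.
  by rewrite mulrACA -exprD subnKC.
exists r; split => // N.
suff [h1 h2] : \sum_(k < N) ga k * r ^+ k <= eta /\ \sum_(k < N) e k * r ^+ k <= (A + 1) * eta.
  split; first exact: le_trans eta12.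
  rewrite (le_trans h2)// ler_piMr ?addr_ge0//; lra.
elim: N => [|N [IH1 IH2]]; first by rewrite !big_ord0 mulr_ge0 ?addr_ge0// !ltW.
have gs0 : 0 <= \sum_(k < N) ga k * r ^+ k.
  by apply: sumr_ge0 => k _; rewrite mulr_ge0// exprn_ge0// ltW.
have es0 : 0 <= \sum_(k < N) e k * r ^+ k.
  by apply: sumr_ge0 => k _; rewrite mulr_ge0// exprn_ge0// ltW.
have cG : \sum_(k < N) (\sum_(i < k.+2) Gp i * ga (k.+1 - i)%N) * r ^+ k.+1 <= t * eta.
  apply: le_trans (conv Gp ga N Gp0 ga0 erefl ga00) _; rewrite ler_pM//.
  by apply: sumr_ge0 => k _; rewrite mulr_ge0// exprn_ge0// ltW.
have cE : \sum_(k < N) (\sum_(i < k.+2) e i * ga (k.+1 - i)%N) * r ^+ k.+1 <= (A + 1) * eta * eta.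
  by apply: le_trans (conv e ga N e0 ga0 e00 ga00) _; rewrite ler_pM.
have G1 : \sum_(k < N) G ^+ k.+1 * r ^+ k.+1 <= t.
  have := Gsum N.+1; rewrite big_ord_recl/= mul0r add0r.
  by under eq_bigr do rewrite /bump leq0n add1n.
have gaN : \sum_(k < N.+1) ga k * r ^+ k <= eta.
  rewrite big_ord_recl/= ga00 mul0r add0r.
  apply: (@le_trans _ _ (S * (\sum_(k < N) G ^+ k.+1 * r ^+ k.+1 +
     \sum_(k < N) (\sum_(i < k.+2) Gp i * ga (k.+1 - i)%N) * r ^+ k.+1 +
     \sum_(k < N) (\sum_(i < k.+2) e i * ga (k.+1 - i)%N) * r ^+ k.+1))).
    rewrite -!big_split/= mulr_sumr; apply: ler_sum => k _; rewrite /bump leq0n add1n.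
    by rewrite -!mulrDl mulrA ler_wpM2r ?exprn_ge0 ?(ltW r0).
  apply: (@le_trans _ _ (S * (t + t * eta + (A + 1) * eta * eta))).
    by rewrite ler_wpM2l// !lerD.
  nra.
split => //.
rewrite big_ord_recl/= e00 mul0r add0r.
apply: (@le_trans _ _ (A * \sum_(k < N.+1) ga k * r ^+ k +
   (\sum_(k < N) G ^+ k.+1 * r ^+ k.+1 +
     \sum_(k < N) (\sum_(i < k.+2) Gp i * ga (k.+1 - i)%N) * r ^+ k.+1))).
  rewrite big_ord_recl/= ga00 mul0r add0r mulr_sumr -!big_split/=.
  apply: ler_sum => k _; rewrite /bump leq0n add1n.
  by rewrite mulrA -!mulrDl ler_wpM2r ?exprn_ge0 ?(ltW r0).
have : A * \sum_(k < N.+1) ga k * r ^+ k <= A * eta by rewrite ler_wpM2l.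
have tse : t * eta <= t by rewrite ler_piMr//; lra.
nra.
Qed.

Definition dnorm_le {R : realType} {X : Type} (d : X -> X -> R) (f : X -> R) (c : R) : Prop :=
  (forall x, `|f x| <= c) /\ dlipschitz d f c.

Section DNorm.
Context {R : realType} {X : Type}.
Variable d : X -> X -> R.
Hypothesis d0 : forall x y, 0 <= d x y.
Implicit Types (f g : X -> R) (c e : R).

Lemma dnorm_leW f c e : c <= e -> dnorm_le d f c -> dnorm_le d f e.
Proof.
move=> ce [fc flip]; split=> [x|]; first exact: le_trans (fc x) ce.
exact: dlipschitzW flip.
Qed.

Lemma dnorm_leD f g c e : dnorm_le d f c -> dnorm_le d g e ->
  dnorm_le d (fun x => f x + g x) (c + e).
Proof.
move=> [fc fl] [ge gl]; split=> [x|x y].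
  by rewrite (le_trans (ler_normD _ _))// lerD.
rewrite opprD addrACA mulrDl (le_trans (ler_normD _ _))//.
by apply: lerD; [exact: fl|exact: gl].
Qed.

Lemma dnorm_leN f c : dnorm_le d f c -> dnorm_le d (fun x => - f x) c.
Proof.
move=> [fc fl]; split=> [x|x y]; first by rewrite normrN.
by rewrite -opprD normrN; exact: fl.
Qed.

Lemma dnorm_leM f g c e : dnorm_le d f c -> dnorm_le d g e ->
  dnorm_le d (fun x => f x * g x) (2 * (c * e)).
Proof.
move=> [fc fl] [ge gl].
have bnd (x z : X) : 0 <= c * e.
  by apply: le_trans (ler_pM _ _ (fc x) (ge z)) => //; rewrite mulr_ge0.
split=> [x|x y].
  rewrite normrM (le_trans (ler_pM _ _ (fc x) (ge x)))//.
  by rewrite mulr_natl mulr2n lerDl (bnd x x).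
have -> : f x * g x - f y * g y = f x * (g x - g y) + (f x - f y) * g y by ring.
rewrite (_ : 2 * (c * e) * d x y = c * (e * d x y) + c * d x y * e); last by ring.
rewrite (le_trans (ler_normD _ _))// !normrM lerD//.
  by rewrite ler_pM//; exact: gl.
by rewrite ler_pM//; exact: fl.
Qed.

Lemma dnorm_le_cst (c : R) : dnorm_le d (fun=> c) `|c|.
Proof. by split=> // x y; rewrite subrr normr0 mulr_ge0. Qed.

Lemma dnorm_leZ (a c : R) f : dnorm_le d f c -> dnorm_le d (fun x => a * f x) (`|a| * c).
Proof.
move=> [fc fl]; split=> [x|x y]; first by rewrite normrM ler_wpM2l.
by rewrite -mulrBr normrM -mulrA ler_wpM2l//; exact: fl.
Qed.

Lemma dnorm_le_sum (I : finType) (F : I -> X -> R) (c : I -> R) :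
  (forall i, dnorm_le d (F i) (c i)) ->
  dnorm_le d (fun x => \sum_i F i x) (\sum_i c i).
Proof.
move=> Fc; split=> [x|x y].
  rewrite (le_trans (ler_norm_sum _ _ _))//; apply: ler_sum => i _; exact: (Fc i).1.
rewrite -sumrB mulr_suml (le_trans (ler_norm_sum _ _ _))//.
by apply: ler_sum => i _; exact: (Fc i).2.
Qed.

End DNorm.

Section FormalSolution.
Context {R : realType} {X : Type}.
Variables (d : X -> X -> R) (x0 : X) (Ls : nat -> (X -> R) -> X -> R).
Variables (res : (X -> R) -> X -> R) (S A G : R).
Hypothesis d01 : forall x y, 0 <= d x y <= 1.
Hypotheses (S0 : 0 <= S) (A0 : 0 <= A) (G0 : 0 <= G).
Hypothesis L0 : forall f c, 0 <= c -> dnorm_le d f c -> dnorm_le d (Ls 0%N f) (A * c).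
Hypothesis Lk : forall k f c, 0 <= c -> dnorm_le d f c ->
  dnorm_le d (Ls k.+1 f) (G ^+ k.+1 * c).
Hypothesis Hres : forall f c, 0 <= c -> dlipschitz d f c ->
  [/\ dlipschitz d (res f) (S * c), res f x0 = 0 &
      forall x, res f x - (Ls 0%N (res f) x - Ls 0%N (res f) x0) = f x - f x0].
Hypothesis L01 : forall x, Ls 0%N (fun=> 1) x = 1.

Let d0 x y : 0 <= d x y. Proof. by have /andP[] := d01 x y. Qed.

(* Power series sum_k g_k t^k and sum_k eps_k t^k solving
   (sum_k t^k L_k) g = eps g with g(x0) = 1. *)
Lemma formal_eigenpair : exists (g : nat -> X -> R) (eps : nat -> R) (r E : R),
  [/\ 0 < r, g 0%N = (fun=> 1), eps 0%N = 1,
    (forall k x, \sum_(i < k.+1) Ls (k - i)%N (g i) x = \sum_(i < k.+1) eps i * g (k - i)%N x) &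
    [/\ forall N x, \sum_(k < N) `|g k.+1 x| * r ^+ k.+1 <= 1 / 2,
      forall k x, `|g k x| * r ^+ k <= 1 & forall k, `|eps k| * r ^+ k <= E]].
Proof.
(* One recursion produces the function g_k, the number eps_k and majorants of both. The guards on i
   in the sums below make step k depend on earlier entries only. *)
pose T := ((X -> R) * R * (R * R))%type.
pose gf (t : T) := t.1.1. pose ef (t : T) := t.1.2.
pose gaf (t : T) := t.2.1. pose eef (t : T) := t.2.2.
pose Gp k := if k is 0 then 0 else G ^+ k.
pose phi (u : nat -> T) k x := \sum_(i < k.+1) if (i < k)%N then Ls (k - i)%N (gf (u i)) x else 0.
(* Since g_0 = 1, order k of the equation reads g_k - L_0 g_k = rhs_k - eps_k. [Hres] solves it
   modulo constants with g_k(x0) = 0, and eps_k is the constant that makes it hold at [x0]. *)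
pose rhs (u : nat -> T) k x := phi u k x -
  \sum_(i < k.+1) if (0 < i < k)%N then ef (u i) * gf (u (k - i)%N) x else 0.
pose phib (u : nat -> T) k := G ^+ k +
  \sum_(i < k.+1) if (0 < i < k)%N then Gp i * gaf (u (k - i)%N) else 0.
pose rhsb (u : nat -> T) k := phib u k +
  \sum_(i < k.+1) if (0 < i < k)%N then eef (u i) * gaf (u (k - i)%N) else 0.
(* The majorants at k = 0 are set to 0 although g_0 = 1 and eps_0 = 1: the contribution of g_0 is
   the separate term G^k of [phib], and that of eps_0 is the term g_k on the left of the
   equation. *)
pose F (u : nat -> T) k : T := if k is 0 then ((fun=> 1), 1, (0, 0)) else
  (res (rhs u k), Ls 0%N (res (rhs u k)) x0 + phi u k x0,
   (S * rhsb u k, A * (S * rhsb u k) + phib u k)).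
have Fext u v k : (forall i, (i < k)%N -> u i = v i) -> F u k = F v k.
  case: k => [//|k] uv.
  have lt_sub (i : nat) : (0 < i)%N -> (k.+1 - i < k.+1)%N by move=> i0; rewrite ltn_subrL i0.
  have e1 : phi u k.+1 = phi v k.+1.
    apply/funext => x; apply: eq_bigr => i _; case: ifP => // ik; by rewrite uv.
  have e2 : rhs u k.+1 = rhs v k.+1.
    apply/funext => x; rewrite /rhs e1; congr (_ - _); apply: eq_bigr => i _.
    by case: ifP => // /andP[i0 ik]; rewrite !uv// lt_sub.
  have e3 : phib u k.+1 = phib v k.+1.
    congr (_ + _); apply: eq_bigr => i _; case: ifP => // /andP[i0 ik].
    by rewrite uv// lt_sub.
  have e4 : rhsb u k.+1 = rhsb v k.+1.
    rewrite /rhsb e3; congr (_ + _); apply: eq_bigr => i _.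
    by case: ifP => // /andP[i0 ik]; rewrite !uv// lt_sub.
  by rewrite /F e2 e1 e3 e4.
have [u uE] := strong_recursion ((fun=> 1), 1, (0, 0)) Fext.
pose g k := gf (u k). pose eps k := ef (u k).
pose ga k := gaf (u k). pose e k := eef (u k).
have g00 : g 0%N = (fun=> 1) by rewrite /g uE.
have eps00 : eps 0%N = 1 by rewrite /eps uE.
have ga00 : ga 0%N = 0 by rewrite /ga uE.
have e00 : e 0%N = 0 by rewrite /e uE.
have Gp0 k : 0 <= Gp k by case: k => //= k; rewrite exprn_ge0.
have phibE k : phib u k.+1 = G ^+ k.+1 + \sum_(i < k.+2) Gp i * ga (k.+1 - i)%N.
  congr (_ + _); apply: eq_bigr => i _; case: ifPn => //.
  rewrite negb_and -eqn0Ngt -leqNgt => /orP[/eqP->|ki]; first by rewrite mul0r.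
  have -> : (i : nat) = k.+1 by apply/eqP; rewrite eqn_leq ki andbT -ltnS.
  by rewrite subnn ga00 mulr0.
have rhsbE k : rhsb u k.+1 = G ^+ k.+1 + \sum_(i < k.+2) Gp i * ga (k.+1 - i)%N +
    \sum_(i < k.+2) e i * ga (k.+1 - i)%N.
  rewrite /rhsb phibE; congr (_ + _); apply: eq_bigr => i _; case: ifPn => //.
  rewrite negb_and -eqn0Ngt -leqNgt => /orP[/eqP->|ki]; first by rewrite e00 mul0r.
  have -> : (i : nat) = k.+1 by apply/eqP; rewrite eqn_leq ki andbT -ltnS.
  by rewrite subnn ga00 mulr0.
have gE k : g k.+1 = res (rhs u k.+1) by rewrite /g uE.
have epsE k : eps k.+1 = Ls 0%N (g k.+1) x0 + phi u k.+1 x0 by rewrite /eps gE uE.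
have gaE k : ga k.+1 = S * rhsb u k.+1 by rewrite /ga uE.
have eE k : e k.+1 = A * ga k.+1 + phib u k.+1 by rewrite /e gaE uE.
have bnd_rhs k : (forall i, (0 < i)%N -> (i < k.+1)%N ->
    [/\ 0 <= ga i, 0 <= e i, dnorm_le d (g i) (ga i) & `|eps i| <= e i]) ->
  [/\ 0 <= phib u k.+1, 0 <= rhsb u k.+1,
    dnorm_le d (phi u k.+1) (phib u k.+1) & dnorm_le d (rhs u k.+1) (rhsb u k.+1)].
  move=> IH.
  have IHs i : (0 < i)%N -> (i < k.+1)%N -> (0 < k.+1 - i < k.+1)%N.
    by move=> i0 ik; rewrite subn_gt0 ik ltn_subrL i0.
  have phib0 : 0 <= phib u k.+1.
    rewrite addr_ge0 ?exprn_ge0// sumr_ge0// => i _; case: ifP => // /andP[i0 ik].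
    have /andP[h1 h2] := IHs _ i0 ik.
    by rewrite mulr_ge0//; have [] := IH _ h1 h2.
  have phi_bnd : dnorm_le d (phi u k.+1) (phib u k.+1).
    have -> : phi u k.+1 = (fun x => Ls k.+1 (fun=> 1) x +
       \sum_(i < k.+2) if (0 < i < k.+1)%N then Ls i (g (k.+1 - i)%N) x else 0).
      apply/funext => x; rewrite /phi.
      rewrite [LHS](reindex_inj rev_ord_inj)/= [LHS]big_ord_recr/= subnn/= subn0.
      rewrite -/(g 0%N) g00 addrC; congr (_ + _).
      rewrite [RHS]big_ord_recr/= ltnn addr0; apply: eq_bigr => i _ /=.
      have ik : (i <= k)%N by rewrite -ltnS.
      rewrite subSS subKn ?(leqW ik)// ltn_subrL andbT ltnS ik andbT.
      by case: ifP.
    apply: dnorm_leD.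
      by rewrite -[X in dnorm_le _ _ X]mulr1; apply: Lk => //; rewrite -[X in dnorm_le _ _ X]normr1; exact: dnorm_le_cst.
    apply: dnorm_le_sum => -[[|i] iN] /=; first by rewrite -[X in dnorm_le _ _ X](@normr0 _ R); exact: dnorm_le_cst.
    case: ifP => ik; last by rewrite -[X in dnorm_le _ _ X](@normr0 _ R); exact: dnorm_le_cst.
    have /andP[h1 h2] := IHs i.+1 isT ik.
    by have [gp _ gn _] := IH _ h1 h2; exact: Lk.
  have e1 : 0 <= rhsb u k.+1.
    rewrite addr_ge0// sumr_ge0// => i _; case: ifP => // /andP[i0 ik].
    have /andP[h1 h2] := IHs _ i0 ik.
    have [gp _ _ _] := IH _ h1 h2; have [_ ep _ _] := IH _ i0 ik; exact: mulr_ge0.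
  split => //; rewrite /rhs; apply: dnorm_leD => //; apply: dnorm_leN.
  apply: dnorm_le_sum => i; case: ifP => [/andP[i0 ik]|_]; last first.
    by rewrite -[X in dnorm_le _ _ X](@normr0 _ R); exact: dnorm_le_cst.
  have /andP[h1 h2] := IHs _ i0 ik.
  have [gp _ gn _] := IH _ h1 h2; have [_ ep _ eb] := IH _ i0 ik.
  by apply: dnorm_leW (dnorm_leZ _ gn) => //; rewrite ler_wpM2r.
have main k : [/\ 0 <= ga k.+1, 0 <= e k.+1, dnorm_le d (g k.+1) (ga k.+1),
    `|eps k.+1| <= e k.+1 & g k.+1 x0 = 0 /\
     forall x, g k.+1 x - (Ls 0%N (g k.+1) x - Ls 0%N (g k.+1) x0) = rhs u k.+1 x - rhs u k.+1 x0].
  elim/ltn_ind: k => k IH.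
  have [i|p0 r0 pn [rn rl]] := bnd_rhs k.
    by case: i => // i _; rewrite ltnS => ik; have [] := IH i ik.
  have [gl g0 geq] := Hres r0 rl.
  have ga0 : 0 <= ga k.+1 by rewrite gaE mulr_ge0.
  have gn : dnorm_le d (g k.+1) (ga k.+1).
    split; last by rewrite gE gaE.
    move=> x; rewrite -[g k.+1 x]subr0 -[X in _ - X]g0 gE gaE (le_trans (gl x x0))//.
    by rewrite ler_piMr ?mulr_ge0//; have /andP[] := d01 x x0.
  split => //; last by rewrite gE.
    by rewrite eE addr_ge0// mulr_ge0.
  rewrite epsE eE (le_trans (ler_normD _ _))// lerD//; last exact: pn.1.
  exact: (L0 ga0 gn).1.
have gaP k : 0 <= ga k by case: k => [|k]; [rewrite ga00|have [] := main k].
have eP k : 0 <= e k by case: k => [|k]; [rewrite e00|have [] := main k].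
have [r [r0 rP]] : exists r, 0 < r /\ forall N, \sum_(k < N) ga k * r ^+ k <= 1 / 2 /\
    \sum_(k < N) e k * r ^+ k <= A + 1.
  apply: (@quadratic_majorant R S A G ga e) => // k.
    by rewrite gaE rhsbE.
  by rewrite eE phibE.
have term (b : nat -> R) (M : R) k : (forall i, 0 <= b i) ->
    \sum_(i < k.+1) b i * r ^+ i <= M -> b k * r ^+ k <= M.
  move=> b0; apply: le_trans; rewrite big_ord_recr/= lerDr sumr_ge0// => i _.
  by rewrite mulr_ge0// exprn_ge0// ltW.
exists g, eps, r, (A + 2); split => //.
  move=> [|k] x; first by rewrite !big_ord1 g00 eps00 L01 mul1r.
  have [_ _ _ _ [_ geq]] := main k.
  pose mid y := \sum_(i < k.+2) if (0 < i < k.+1)%N then eps i * g (k.+1 - i)%N y else 0.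
  have mid0 : mid x0 = 0.
    apply: big1 => i _; case: ifP => // /andP[i0 ik].
    have : (0 < k.+1 - i)%N by rewrite subn_gt0.
    by case: (k.+1 - i)%N => // l _; have [_ _ _ _ [-> _]] := main l; rewrite mulr0.
  have -> : \sum_(i < k.+2) Ls (k.+1 - i)%N (g i) x = phi u k.+1 x + Ls 0%N (g k.+1) x.
    rewrite big_ord_recr/= subnn; congr (_ + _).
    rewrite /phi [RHS]big_ord_recr/= ltnn addr0; apply: eq_bigr => i _.
    by rewrite ltn_ord.
  have -> : \sum_(i < k.+2) eps i * g (k.+1 - i)%N x = g k.+1 x + mid x + eps k.+1.
    rewrite /mid big_ord_recr/= subnn g00 mulr1 [in RHS]big_ord_recr/= ltnn addr0.
    rewrite [in LHS]big_ord_recl [in RHS]big_ord_recl/= eps00 mul1r subn0 add0r.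
    congr (_ + _ + _); apply: eq_bigr => i _.
    by rewrite /bump leq0n add1n ltnS ltn_ord.
  have := geq x; rewrite /rhs -/(mid x) -/(mid x0) mid0 epsE; lra.
split.
- move=> N x; have [h _] := rP N.+1; apply: le_trans h.
  rewrite [leRHS]big_ord_recl/= ga00 mul0r add0r; apply: ler_sum => k _.
  rewrite /bump leq0n add1n ler_wpM2r ?exprn_ge0 ?(ltW r0)//.
  by have [_ _ [h _] _ _] := main k; exact: h.
- move=> [|k] x; first by rewrite g00 normr1 mulr1.
  have [_ _ [h _] _ _] := main k; have [h' _] := rP k.+2.
  apply: (@le_trans _ _ (1 / 2)); last lra.
  apply: le_trans (term _ _ _ gaP h'); rewrite ler_wpM2r ?exprn_ge0 ?(ltW r0)//.
- move=> [|k]; first by rewrite eps00 normr1 mulr1; have := A0; lra.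
  have [_ _ _ h _] := main k; have [_ h'] := rP k.+2.
  apply: (@le_trans _ _ (A + 1)); last lra.
  apply: le_trans (term _ _ _ eP h'); rewrite ler_wpM2r ?exprn_ge0 ?(ltW r0)//.
Qed.

End FormalSolution.

(** * Local power series of the eigenvalue in the exponent *)

Section AnalyticEigenvalue.
Context {R : realType} {X : Type} {B : finType}.
Variables (a : B -> X -> R) (th : B -> X -> X) (d : X -> X -> R) (x0 : X) (b0 : B).
Variables (q K D Aa : R).
Hypothesis q01 : 0 <= q < 1.
Hypothesis K0 : 0 <= K.
Hypothesis dD : forall x y, 0 <= d x y <= D.
Hypothesis dC : forall x y, d x y = d y x.
Hypothesis dth : forall j x y, d (th j x) (th j y) <= q * d x y.
Hypothesis aA : forall j x, `|a j x| <= Aa.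
Hypothesis aK : forall j, dlipschitz d (a j) K.

Definition exp_weight (s : R) : B -> X -> R := fun j x => expR (s * a j x).

Definition positive_eigenpair (s lam : R) : Prop :=
  exists (h : X -> R) (c M : R), [/\ 0 < c, forall x, c <= h x <= M &
    transfer (exp_weight s) th h = (fun x => lam * h x)].

Let q1 : 0 < 1 - q. Proof. by rewrite subr_gt0; case/andP: q01. Qed.
Let d0 x y : 0 <= d x y. Proof. by have /andP[] := dD x y. Qed.
Let Aa0 : 0 <= Aa. Proof. exact: le_trans (normr_ge0 _) (aA b0 x0). Qed.

Lemma exp_weight_log_lipschitz s j : log_lipschitz d (`|s| * K) (exp_weight s j).
Proof.
split=> [x|x y]; first exact: expR_gt0.
rewrite /exp_weight -expRD ler_expR -lerBlDr -mulrBr (le_trans (ler_norm _))//.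
by rewrite normrM -mulrA ler_wpM2l//; exact: aK.
Qed.

Lemma exp_weight_eigenfunction s : exists (lam : R) (h : X -> R),
  [/\ 0 < lam, log_lipschitz d (`|s| * K / (1 - q)) h &
    transfer (exp_weight s) th h = (fun x => lam * h x)].
Proof.
apply: (@transfer_eigenfunction R X B (exp_weight s) th d x0 b0 q (`|s| * K) D) => //.
  by rewrite mulr_ge0.
by move=> j; exact: exp_weight_log_lipschitz.
Qed.

Lemma log_lipschitz_bounds C h : 0 <= C -> log_lipschitz d C h ->
  exists c M, 0 < c /\ forall x, c <= h x <= M.
Proof.
move=> C0 [h0 hC]; exists (h x0 / expR (C * D)), (expR (C * D) * h x0).
have E0 : 0 < expR (C * D) by exact: expR_gt0.
split=> [|x]; first by rewrite divr_gt0.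
have le_exp y z : expR (C * d y z) <= expR (C * D).
  by rewrite ler_expR ler_wpM2l//; have /andP[] := dD y z.
have hE y z : h y <= expR (C * D) * h z.
  by rewrite (le_trans (hC y z))// ler_wpM2r// ltW.
by rewrite ler_pdivrMr// mulrC !hE.
Qed.

Lemma exists_positive_eigenpair s : exists2 lam, 0 < lam & positive_eigenpair s lam.
Proof.
have [lam [h [lam0 hK hE]]] := exp_weight_eigenfunction s; exists lam => //.
have C0 : 0 <= `|s| * K / (1 - q) by rewrite !mulr_ge0// invr_ge0 ltW.
by have [c [M [c0 hb]]] := log_lipschitz_bounds C0 hK; exists h, c, M.
Qed.

Lemma dlipschitz_capped (kappa : R) (f : X -> R) (u v : R) :
  0 < kappa -> 0 <= u -> 0 <= v -> (forall x y, `|f x - f y| <= u) -> dlipschitz d f v ->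
  dlipschitz (capped kappa d) f (u + v / kappa).
Proof.
move=> k0 u0 v0 fu fv x y.
have vk : 0 <= v / kappa by rewrite divr_ge0// ltW.
rewrite /capped /Num.min; case: ifP => _.
  by rewrite mulr1 (le_trans (fu x y))// lerDl.
rewrite mulrDl (le_trans (fv x y))// ler_wpDl ?mulr_ge0 ?(ltW k0)//.
by rewrite mulrA divfK// gt_eqF.
Qed.

(** After normalization by the eigenfunction [h0] at [s0], expanding exp ((s - s0) a_j) turns the
    operator into a power series in s - s0 with a Markov leading term. The formal solution sums to
    an eigenvalue and to a function within 1/2 of 1; multiplied by [h0], the latter is a positive
    eigenfunction at [s]. *)
Lemma eigenvalue_analytic (s0 : R) : exists (rho : R) (c : nat -> R), 0 < rho /\
  forall s : R, `|s - s0| < rho -> exists lam,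
    (fun N : nat => \sum_(k < N) c k * (s - s0) ^+ k) @ \oo --> lam /\
    positive_eigenpair s lam.
Proof.
have [lam0 [h0 [lam00 hK hE]]] := exp_weight_eigenfunction s0.
pose K' := `|s0| * K / (1 - q).
have K'0 : 0 <= K' by rewrite !mulr_ge0// invr_ge0 ltW.
rewrite -/K' in hK; clearbody K'.
have [hmin [hmax [hmin0 hb]]] := log_lipschitz_bounds K'0 hK.
have [h0p h0K] := hK.
pose p j x := exp_weight s0 j x * h0 (th j x) / (lam0 * h0 x).
have lh x : 0 < lam0 * h0 x by rewrite mulr_gt0.
have p1 x : \sum_j p j x = 1.
  rewrite -mulr_suml; have := congr1 (fun f => f x) hE.
  by rewrite /transfer => ->; rewrite divff// gt_eqF.
(* One term comes from the weight, and K' occurs twice, for [h0] in the numerator and in the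
   denominator of [p]. *)
pose C := `|s0| * K + 2 * K'.
have C0 : 0 <= C by rewrite addr_ge0 ?mulr_ge0.
have pC j : log_lipschitz d C (p j).
  split=> [x|x y]; first by rewrite divr_gt0// mulr_gt0// expR_gt0.
  have [_ /(_ x y) wl] := exp_weight_log_lipschitz s0 j.
  have hl : h0 (th j x) <= expR (K' * d x y) * h0 (th j y).
    rewrite (le_trans (h0K _ (th j y)))// ler_wpM2r ?(ltW (h0p _))// ler_expR.
    by rewrite ler_wpM2l// (le_trans (dth _ _ _))// ler_piMl// ltW//; case/andP: q01.
  have hi : (lam0 * h0 x)^-1 <= expR (K' * d x y) * (lam0 * h0 y)^-1.
    rewrite ler_pdivlMr// mulrC ler_pdivrMr// mulrCA ler_wpM2l ?(ltW lam00)//.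
    by rewrite dC; exact: h0K.
  apply: (@le_trans _ _ ((expR (`|s0| * K * d x y) * exp_weight s0 j y *
    (expR (K' * d x y) * h0 (th j y))) * (expR (K' * d x y) * (lam0 * h0 y)^-1))).
    apply: ler_pM => //; [|by rewrite invr_ge0 ltW|].
      by rewrite mulr_ge0 ?expR_ge0// ltW.
    by apply: ler_pM => //; [exact: expR_ge0|exact: ltW].
  rewrite (_ : C * d x y = `|s0| * K * d x y + K' * d x y + K' * d x y); last by rewrite /C; ring.
  rewrite !expRD /p le_eqVlt; apply/orP; left; apply/eqP; ring.
have p0 j x : 0 <= p j x by have [/(_ x)/ltW] := pC j.
have ple1 j x : p j x <= 1 by rewrite -(p1 x) (bigD1 j)//= lerDl sumr_ge0.
have [kappa [S [A [res [kappa0 S0 A0 resP]]]]] :=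
  @markov_poisson R X B p th d x0 q C D q01 C0 dD dC dth p1 pC.
pose cd := capped kappa d.
have cd01 x y : 0 <= cd x y <= 1.
  by rewrite le_min ler01 ge_min lexx/= andbT mulr_ge0// ltW.
have cd0 x y : 0 <= cd x y by have /andP[] := cd01 x y.
pose Ls k f := transfer (fun j x => p j x * (a j x ^+ k / k`!%:R)) th f.
have Ls0 f : Ls 0%N f = transfer p th f.
  by apply/funext => x; apply: eq_bigr => j _; rewrite expr0 fact0 divr1 mulr1.
pose P := 2 + (C * expR (C * D)) / kappa.
have CE0 : 0 <= C * expR (C * D) by rewrite mulr_ge0// expR_ge0.
have P0 : 0 <= P by rewrite addr_ge0// divr_ge0// ltW.
have pP j : dnorm_le cd (p j) P.
  split=> [x|]; first rewrite ger0_norm// (le_trans (ple1 _ _))//.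
    by rewrite ler_wpDr ?divr_ge0// ?ler1n// ltW.
  have half x y : p j x - p j y <= C * expR (C * D) * d x y.
    have [_ /(_ x y) h] := pC j.
    have dxy := d0 x y; have /andP[_ dxD] := dD x y.
    have e1 : expR (C * d x y) <= expR (C * D) by rewrite ler_expR ler_wpM2l.
    have e2 : expR (C * d x y) - 1 <= C * d x y * expR (C * d x y).
      have := expR_ge1Dx (- (C * d x y)); have eg := expR_gt0 (C * d x y).
      by rewrite expRN -[leRHS]mul1r ler_pdivlMr//; lra.
    have e3 : C * d x y * expR (C * d x y) <= C * d x y * expR (C * D).
      by rewrite ler_wpM2l// mulr_ge0.
    have e4 : (expR (C * d x y) - 1) * p j y <= expR (C * d x y) - 1.
      rewrite ler_piMr// subr_ge0 -[leLHS]expR0 ler_expR mulr_ge0//.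
    lra.
  apply: dlipschitz_capped => //; last first.
    move=> x y; rewrite ler_norml half andbT lerNl opprB; rewrite dC; exact: half.
  move=> x y; have := p0 j x; have := p0 j y; have := ple1 j x; have := ple1 j y.
  by rewrite ler_norml => *; apply/andP; split; lra.
pose Ma := 2 * Aa + K / kappa.
have Kk : 0 <= K / kappa by rewrite divr_ge0// ltW.
have Ma0 : 0 <= Ma by rewrite addr_ge0// mulr_ge0.
have aMa j : dnorm_le cd (a j) Ma.
  split=> [x|]; first by rewrite (le_trans (aA j x))// /Ma; have := Aa0; lra.
  apply: dlipschitz_capped => //; first by rewrite mulr_ge0.
  by move=> x y; rewrite (le_trans (ler_normB _ _))// mulr_natl mulr2n lerD.
have powM j k : dnorm_le cd (fun x => a j x ^+ k) ((2 * Ma) ^+ k).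
  elim: k => [|k IH]; first by rewrite expr0 -[X in dnorm_le _ _ X](@normr1 R); exact: dnorm_le_cst.
  have -> : (fun x => a j x ^+ k.+1) = (fun x => a j x * a j x ^+ k).
    by apply/funext => x; rewrite exprS.
  by rewrite exprS -mulrA; exact: dnorm_leM.
have thM j f c : 0 <= c -> dnorm_le cd f c -> dnorm_le cd (fun x => f (th j x)) c.
  move=> c0 [fc fl]; split=> [x|x y]; first exact: fc.
  rewrite (le_trans (fl _ _))// ler_wpM2l// le_min ge_min lexx/= ge_min; apply/orP; right.
  rewrite ler_wpM2l ?(ltW kappa0)// (le_trans (dth _ _ _))// ler_piMl// ltW//.
  by case/andP: q01.
(* The factor 4 #|B| P, which occurs once in each coefficient, is absorbed in the base; the added 1
   keeps the first factor of [G] at least 1, so that its powers dominate it. *)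
pose G := (4 * #|B|%:R * P + 1) * (2 * Ma).
have LsG k f c : 0 <= c -> dnorm_le cd f c -> dnorm_le cd (Ls k.+1 f) (G ^+ k.+1 * c).
  move=> c0 fc.
  have fact1 : `|(k.+1`!%:R : R)^-1| <= 1.
    by rewrite ger0_norm ?invr_ge0// invf_le1 ?ltr0n ?fact_gt0// ler1n fact_gt0.
  have h j : dnorm_le cd (fun x => p j x * (a j x ^+ k.+1 / k.+1`!%:R) * f (th j x))
      (4 * P * (2 * Ma) ^+ k.+1 * c).
    have h1 : dnorm_le cd (fun x => a j x ^+ k.+1 / k.+1`!%:R) ((2 * Ma) ^+ k.+1).
      have -> : (fun x => a j x ^+ k.+1 / k.+1`!%:R) = (fun x => k.+1`!%:R^-1 * a j x ^+ k.+1).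
        by apply/funext => x; rewrite mulrC.
      apply: dnorm_leW (dnorm_leZ _ (powM j k.+1)) => //.
      by rewrite ler_piMl// exprn_ge0// mulr_ge0.
    have := dnorm_leM (dnorm_leM (pP j) h1) (thM j f c c0 fc).
    by apply: dnorm_leW => //; rewrite le_eqVlt; apply/orP; left; apply/eqP; ring.
  apply: dnorm_leW (dnorm_le_sum h) => //.
  rewrite sumr_const -[leLHS]mulr_natl !mulrA ler_wpM2r//.
  rewrite /G [in leRHS]exprMn ler_wpM2r ?exprn_ge0 ?mulr_ge0//.
  have z0 : 0 <= 4 * #|B|%:R * P by rewrite !mulr_ge0.
  rewrite (_ : _ * 4 * P = 4 * #|B|%:R * P); last by ring.
  rewrite (@le_trans _ _ (4 * #|B|%:R * P + 1))// ?lerDl//.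
  by rewrite ler_eXnr// lerDr.
have LsA f c : 0 <= c -> dnorm_le cd f c -> dnorm_le cd (Ls 0%N f) ((A + 1) * c).
  move=> c0 [fc fl]; have [Al _ _ _] := resP f c c0 fl; rewrite Ls0; split; last first.
    by apply: dlipschitzW Al => //; rewrite ler_wpM2r// lerDl.
  move=> x; rewrite (@le_trans _ _ c)//; last by rewrite ler_peMl// lerDr.
  rewrite (le_trans (ler_norm_sum _ _ _))// -[leRHS]mul1r -(p1 x) mulr_suml.
  by apply: ler_sum => j _; rewrite normrM ger0_norm// ler_wpM2l.
have Lsres f c : 0 <= c -> dlipschitz cd f c ->
  [/\ dlipschitz cd (res f) (S * c), res f x0 = 0 &
      forall x, res f x - (Ls 0%N (res f) x - Ls 0%N (res f) x0) = f x - f x0].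
  by move=> c0 fc; have [_ h1 h2 h3] := resP f c c0 fc; rewrite Ls0.
have Ls01 x : Ls 0%N (fun=> 1) x = 1.
  by rewrite Ls0 /transfer -[RHS](p1 x); apply: eq_bigr => j _; rewrite mulr1.
have A10 : 0 <= A + 1 by rewrite addr_ge0.
have G0 : 0 <= G by rewrite /G !mulr_ge0// addr_ge0// !mulr_ge0.
have [g [eps [r [E [r0 g0 eps0 geps [gsum gr epsr]]]]]] :=
  @formal_eigenpair R X cd x0 Ls res S (A + 1) G cd01 S0 A10 G0 LsA LsG Lsres Ls01.
(* The terms of the three series for g, eps and the exponential are then at most M (1/4)^k, as
   [cvg_cauchy_product] requires. *)
pose rho := Num.min (r / 4) (4 * (Aa + 1))^-1.
have Aa1 : 0 < Aa + 1 by rewrite ltr_wpDl.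
have rho0 : 0 < rho by rewrite lt_min divr_gt0//= invr_gt0 mulr_gt0.
exists rho, (fun k => lam0 * eps k); split => // s; set t := s - s0 => ts.
have tr : `|t| * 4 <= r.
  by rewrite -ler_pdivlMr// (le_trans (ltW ts))// ge_min lexx.
have ta j x : `|t * a j x| <= 1 / 4.
  have : `|t| * (4 * (Aa + 1)) <= 1.
    by rewrite -ler_pdivlMr ?mulr_gt0// div1r (le_trans (ltW ts))// ge_min lexx orbT.
  have := aA j x; have := normr_ge0 t; have := normr_ge0 (a j x); rewrite normrM; nra.
have tk (z e : R) k : 0 <= e -> `|z| * r ^+ k <= e -> `|z * t ^+ k| <= e * (1 / 4) ^+ k.
  move=> e0 ze; rewrite normrM normrX.
  apply: (@le_trans _ _ (`|z| * (r * (1 / 4)) ^+ k)).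
    by rewrite ler_wpM2l// lerXn2r// ?nnegrE ?mulr_ge0 ?(ltW r0)//; lra.
  by rewrite exprMn mulrA ler_wpM2r// exprn_ge0.
have E0 : 0 <= E by have := epsr 0%N; rewrite eps0 normr1 mulr1; lra.
pose M := E + 1.
have q4 : 0 <= (1 / 4 : R) < 1 by apply/andP; split; lra.
have geoW (e : R) k : e <= M -> e * (1 / 4) ^+ k <= M * (1 / 4) ^+ k.
  by move=> eM; rewrite ler_wpM2r// exprn_ge0//; lra.
have bg x k : `|g k x * t ^+ k| <= M * (1 / 4) ^+ k.
  by rewrite (le_trans (tk _ 1 _ _ (gr k x)))// geoW// lerDr.
have be k : `|eps k * t ^+ k| <= M * (1 / 4) ^+ k.
  by rewrite (le_trans (tk _ E _ _ (epsr k)))// geoW// lerDl.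
have bx j x k : `|(t * a j x) ^+ k / k`!%:R| <= M * (1 / 4) ^+ k.
  have f1 : `|(k`!%:R : R)^-1| <= 1.
    by rewrite ger0_norm ?invr_ge0// invf_le1 ?ltr0n ?fact_gt0// ler1n fact_gt0.
  rewrite normrM normrX (le_trans (ler_wpM2l _ f1)) ?exprn_ge0// mulr1.
  rewrite (@le_trans _ _ (1 * (1 / 4) ^+ k))//; last by rewrite geoW// lerDr.
  by rewrite mul1r lerXn2r// nnegrE.
pose f x := limn (fun N => \sum_(k < N) g k x * t ^+ k).
pose mu := limn (fun N => \sum_(k < N) eps k * t ^+ k).
have cf x : \sum_(k < N) g k x * t ^+ k @[N --> \oo] --> f x.
  exact: (geometric_series_cvg q4 (bg x)).
have cmu : \sum_(k < N) eps k * t ^+ k @[N --> \oo] --> mu.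
  exact: (geometric_series_cvg q4 be).
have cexp j x : \sum_(k < N) (t * a j x) ^+ k / k`!%:R @[N --> \oo] --> expR (t * a j x).
  have e : (fun N => \sum_(k < N) (t * a j x) ^+ k / k`!%:R) = series (exp_coeff (t * a j x)).
    by apply/funext => N; rewrite /series/= big_mkord.
  by rewrite e; exact: is_cvg_series_exp_coeff.
have fE x : \sum_j p j x * (f (th j x) * expR (t * a j x)) = mu * f x.
  (* Both sides are limits of the same sequence: the formal identities equate the two Cauchy
     products order by order. *)
  pose u N := \sum_j p j x * (\sum_(k < N) \sum_(i < k.+1) g i (th j x) * t ^+ i *
     ((t * a j x) ^+ (k - i)%N / (k - i)`!%:R)).
  have l1 : u N @[N --> \oo] --> \sum_j p j x * (f (th j x) * expR (t * a j x)).
    apply: cvg_big => [|j _]; first exact: add_continuous.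
    have := cvg_cauchy_product (bg (th j x)) (bx j x) (cf (th j x)) (cexp j x).
    exact: cvgMl_tmp.
  have l2 := cvg_cauchy_product be (bg x) cmu (cf x).
  suff uE : u = (fun N => \sum_(k < N) \sum_(i < k.+1)
      eps i * t ^+ i * (g (k - i)%N x * t ^+ (k - i)%N)).
    by rewrite uE in l1; exact: (cvg_unique _ l1 l2).
  apply/funext => N; rewrite /u.
  under eq_bigr do rewrite mulr_sumr.
  rewrite exchange_big/=; apply: eq_bigr => k _.
  have := congr1 (fun z => z * t ^+ k) (geps k x); rewrite !mulr_suml => h.
  rewrite [RHS](eq_bigr (fun i : 'I_k.+1 => eps i * g (k - i)%N x * t ^+ k)) => [|i _]; last first.
    have -> : t ^+ k = t ^+ i * t ^+ (k - i) by rewrite -exprD subnKC// -ltnS.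
    ring.
  rewrite -h; under eq_bigr do rewrite mulr_sumr.
  rewrite exchange_big/=; apply: eq_bigr => i _.
  rewrite /Ls /transfer mulr_suml; apply: eq_bigr => j _.
  have -> : t ^+ k = t ^+ i * t ^+ (k - i) by rewrite -exprD subnKC// -ltnS.
  rewrite exprMn; ring.
have f12 x : 1 / 2 <= f x <= 3 / 2.
  have b N : `|\sum_(k < N.+1) g k x * t ^+ k - 1| <= 1 / 2.
    rewrite big_ord_recl g0 mul1r expr0 addrAC subrr add0r.
    rewrite (le_trans (ler_norm_sum _ _ _))// (le_trans _ (gsum N x))//.
    apply: ler_sum => k _; rewrite normrM ler_wpM2l// normrX.
    rewrite lerXn2r ?nnegrE// ?(ltW r0)//; have := normr_ge0 t; lra.
  have cf1 : \sum_(k < N.+1) g k x * t ^+ k @[N --> \oo] --> f x.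
    by rewrite (cvg_shiftS (fun N => \sum_(k < N) g k x * t ^+ k)); exact: cf.
  apply/andP; split.
    apply: (cvgr_to_ge cf1); apply: nearW => N; have := b N; rewrite ler_norml => /andP[]; lra.
  apply: (cvgr_to_le cf1); apply: nearW => N; have := b N; rewrite ler_norml => /andP[]; lra.
exists (lam0 * mu); split.
  under eq_fun do under eq_bigr do rewrite -mulrA.
  under eq_fun do rewrite -mulr_sumr.
  exact: cvgMl_tmp.
exists (fun x => h0 x * f x), (hmin / 2), (hmax * (3 / 2)); split.
- by rewrite divr_gt0.
- move=> x; have /andP[h1 h2] := hb x; have /andP[f1 f2] := f12 x; apply/andP; split.
    by rewrite ler_pM// ?(ltW hmin0)// -div1r.
  by rewrite ler_pM// ?(ltW (h0p x))//; lra.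
apply/funext => x; rewrite mulrACA -(fE x) /transfer mulr_sumr; apply: eq_bigr => j _.
rewrite (_ : exp_weight s j x = exp_weight s0 j x * expR (t * a j x)); last first.
  by rewrite /exp_weight -expRD /t; congr expR; ring.
by rewrite /p; field; rewrite !gt_eqF.
Qed.

End AnalyticEigenvalue.

(** * Algebra of functions with continuous derivatives up to the boundary *)

Section C0barTheory.
Context {R : realType} {n : nat}.
Variable H : set 'rV[R]_n.
Implicit Types (f g : 'rV[R]_n -> R).

Lemma within_closure_continuous (V : topologicalType) (f : 'rV[R]_n -> V) (x : 'rV[R]_n) :
  open H -> {within closure H, continuous f} -> H x -> {for x, continuous f}.
Proof.
move=> oH cf Hx.
have : {within H, continuous f} by apply: continuous_subspaceW cf; exact: subset_closure.
by rewrite continuous_open_subspace// => /(_ x); apply; rewrite inE.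
Qed.

Lemma C0bar_of_extension f g : open H -> {within closure H, continuous g} ->
  (forall x, H x -> g x = f x) -> C0bar H f.
Proof.
move=> oH cg gf; split; last by exists g.
move=> x Hx; have cgx := within_closure_continuous oH cg Hx.
have key : f @ x --> g x.
  apply: cvg_trans cgx; apply: (@near_eq_cvg _ _ (nbhs x) (nbhs_filter x)).
  have : nbhs x H by exact: open_nbhs_nbhs.
  by apply: filterS => y /gf.
by rewrite gf in key.
Qed.

Lemma C0bar_eq f g : open H -> (forall x, H x -> f x = g x) -> C0bar H f -> C0bar H g.
Proof.
move=> oH fg [_ [e [ce ef]]]; apply: C0bar_of_extension ce _ => // x Hx.
by rewrite ef// fg.
Qed.

Lemma C0bar_cst (c : R) : open H -> C0bar H (fun=> c).
Proof.
by move=> oH; apply: (@C0bar_of_extension _ (fun=> c)) => // x; exact: cvg_cst.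
Qed.

Lemma C0barD f g : open H -> C0bar H f -> C0bar H g -> C0bar H (fun x => f x + g x).
Proof.
move=> oH [_ [f' [cf f'f]]] [_ [g' [cg g'g]]].
apply: (@C0bar_of_extension _ (fun x => f' x + g' x)) => //.
  by move=> x; apply: continuousD; [exact: cf|exact: cg].
by move=> x Hx; rewrite f'f// g'g.
Qed.

Lemma C0barM f g : open H -> C0bar H f -> C0bar H g -> C0bar H (fun x => f x * g x).
Proof.
move=> oH [_ [f' [cf f'f]]] [_ [g' [cg g'g]]].
apply: (@C0bar_of_extension _ (fun x => f' x * g' x)) => //.
  by move=> x; apply: continuousM; [exact: cf|exact: cg].
by move=> x Hx; rewrite f'f// g'g.
Qed.

Lemma closure_maps (th : 'rV[R]_n -> 'rV[R]_n) (x : 'rV[R]_n) :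
  (forall y, H y -> H (th y)) -> {within closure H, continuous th} ->
  closure H x -> closure H (th x).
Proof.
move=> Hth /subspace_continuousP cth Hx U Ux.
have h : nbhs x [set y | closure H y -> U (th y)] by exact: cth x Hx U Ux.
have [y [Hy Uy]] := Hx _ h.
by exists (th y); split; [exact: Hth|exact: Uy (subset_closure Hy)].
Qed.

Lemma within_closure_comp (V : topologicalType) (f : 'rV[R]_n -> V) (th : 'rV[R]_n -> 'rV[R]_n) :
  (forall y, H y -> H (th y)) -> {within closure H, continuous th} ->
  {within closure H, continuous f} -> {within closure H, continuous (f \o th)}.
Proof.
move=> Hth cth /subspace_continuousP cf; apply/subspace_continuousP => x Hx U Ux.
have h : nbhs (th x) [set y | closure H y -> U (f y)].
  exact: cf _ (closure_maps Hth cth Hx) U Ux.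
have /subspace_continuousP cth' := cth.
have h' : nbhs x [set y | closure H y -> closure H (th y) -> U (f (th y))].
  exact: cth' x Hx _ h.
have : within (closure H) (nbhs x) ((f \o th) @^-1` U).
  apply: (@filterS _ (nbhs x) (nbhs_filter x) _ _ _ h') => y h1 Hy.
  by apply: h1 => //; exact: closure_maps.
by [].
Qed.

Lemma C0bar_comp f (th : 'rV[R]_n -> 'rV[R]_n) :
  open H -> (forall y, H y -> H (th y)) -> {within closure H, continuous th} ->
  C0bar H f -> C0bar H (f \o th).
Proof.
move=> oH Hth cth [_ [f' [cf f'f]]].
apply: (@C0bar_of_extension _ (f' \o th)) => //; first exact: within_closure_comp.
by move=> x Hx; rewrite /= f'f//; exact: Hth.
Qed.

Lemma closure_le (f : 'rV[R]_n -> R) (c : R) : {within closure H, continuous f} ->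
  (forall x, H x -> f x <= c) -> forall x, closure H x -> f x <= c.
Proof.
move=> /subspace_continuousP cf fc x Hx; rewrite leNgt; apply/negP => cfx.
have h0 : nbhs (f x) [set r | c < r] by apply: open_nbhs_nbhs; split; [exact: open_gt|].
have h : nbhs x [set y | closure H y -> c < f y] by exact: cf x Hx _ h0.
have [y [Hy cfy]] := Hx _ h.
by have := cfy (subset_closure Hy); rewrite ltNge fc.
Qed.

(** A bound on the difference of two extensions over [H] persists on the closure, so the extensions
    are uniformly Cauchy there and their limit extends [f]. *)
Lemma C0bar_uniform_limit (f_ : nat -> 'rV[R]_n -> R) f : open H ->
  (forall N, C0bar H (f_ N)) ->
  (forall e, 0 < e -> \forall N \near \oo, forall x, H x -> `|f_ N x - f x| <= e) ->
  C0bar H f.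
Proof.
move=> oH cf unif.
have /choice[g gP] := fun N => (cf N).2.
have cauchy e : 0 < e -> exists N, forall i, (N <= i)%N -> forall j, (N <= j)%N ->
    forall x, closure H x -> `|g i x - g j x| <= e.
  move=> e0; have e20 : 0 < e / 2 by rewrite divr_gt0.
  have [N _ HN] := unif _ e20; exists N => i Ni j Nj; apply: closure_le.
    have /subspace_continuousP ci := (gP i).1; have /subspace_continuousP cj := (gP j).1.
    by apply/subspace_continuousP => x Hx; apply: cvg_norm; apply: cvgB; [exact: ci|exact: cj].
  move=> x Hx; rewrite (gP i).2// (gP j).2//.
  rewrite (_ : _ - _ = (f_ i x - f x) - (f_ j x - f x)); last by ring.
  rewrite (le_trans (ler_normB _ _))// (splitr e) lerD//; exact: HN.
have cvgg x : closure H x -> cvgn (fun N => g N x).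
  move=> Hx; apply/cauchy_cvgP/cauchy_exP => e e0.
  have e20 : 0 < e / 2 by rewrite divr_gt0.
  have [N HN] := cauchy _ e20; exists (g N x), N => // i /= Ni.
  rewrite /ball/= (le_lt_trans (HN _ (leqnn N) _ Ni _ Hx))//.
  by rewrite ltr_pdivrMr// ltr_pMr// ltr1n.
pose h x := limn (fun N => g N x).
have hg e : 0 < e -> exists N, forall i, (N <= i)%N -> forall x, closure H x -> `|g i x - h x| <= e.
  move=> e0; have [N HN] := cauchy _ e0; exists N => i Ni x Hx.
  have c : `|g i x - g j x| @[j --> \oo] --> `|g i x - h x|.
    by apply: cvg_norm; apply: cvgB; [exact: cvg_cst|exact: cvgg].
  by apply: (cvgr_to_le c); exists N => // j Nj; exact: HN.
apply: (@C0bar_of_extension _ h) => //.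
  apply/subspace_continuousP => x Hx; apply/cvgrPdist_le => e e0.
  have e30 : 0 < e / 3 by rewrite divr_gt0.
  have [N HN] := hg _ e30.
  have /subspace_continuousP/(_ x Hx)/cvgrPdist_le/(_ _ e30) := (gP N).1.
  rewrite !near_withinE; apply: filterS => y k Hy; have := k Hy => {}k.
  rewrite (_ : h x - h y = (h x - g N x) + (g N x - g N y) + (g N y - h y)); last by ring.
  have k1 := HN N (leqnn _) x Hx; have k2 := HN N (leqnn _) y Hy.
  rewrite distrC in k1.
  rewrite (le_trans (ler_normD _ _))// (_ : e = e / 3 + e / 3 + e / 3); last by field.
  by rewrite lerD// (le_trans (ler_normD _ _))// lerD.
move=> x Hx; have c1 := cvgg x (subset_closure Hx).
have c2 : g N x @[N --> \oo] --> f x.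
  apply/cvgrPdist_le => e e0; have := unif _ e0; apply: filterS => N h1.
  by rewrite (gP N).2// distrC; exact: h1.
exact: (cvg_unique _ c1 c2).
Qed.

End C0barTheory.

Section CmBarTheory.
Context {R : realType} {n : nat}.
Variable H : set 'rV[R]_n.
Hypothesis oH : open H.
Implicit Types (f g : 'rV[R]_n -> R).

Lemma near_eq_on_open f g (x : 'rV[R]_n) : (forall y, H y -> f y = g y) -> H x ->
  \forall y \near x, f y = g y.
Proof.
by move=> fg Hx; have : nbhs x H by [exact: open_nbhs_nbhs]; apply: filterS.
Qed.

Lemma CmBar_eq m f g : (forall x, H x -> f x = g x) -> CmBar m H f -> CmBar m H g.
Proof.
elim: m f g => [|m IH] f g fg.
  by rewrite !CmBar0E; exact: C0bar_eq.
rewrite !CmBarSE => -[cf df]; split; first exact: C0bar_eq cf.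
move=> i; have [di ci] := df i; split.
  move=> x Hx; apply: near_eq_derivable (near_eq_on_open fg Hx) _; exact: di.
apply: IH ci => x Hx; exact: near_eq_derive (near_eq_on_open fg Hx).
Qed.

Lemma CmBar_cst m (c : R) : CmBar m H (fun=> c).
Proof.
elim: m c => [|m IH] c; first by apply/CmBar0E; exact: C0bar_cst.
apply/CmBarSE; split; first exact: C0bar_cst.
move=> i; split=> [x _|]; first exact: derivable_cst.
rewrite (_ : pderiv i (fun=> c) = fun=> 0); first exact: IH.
by apply/funext => x; rewrite /pderiv derive_cst.
Qed.

Lemma CmBarD m f g : CmBar m H f -> CmBar m H g -> CmBar m H (fun x => f x + g x).
Proof.
elim: m f g => [|m IH] f g; first by rewrite !CmBar0E; exact: C0barD.
rewrite !CmBarSE => -[cf df] [cg dg]; split; first exact: C0barD.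
move=> i; have [dfi cfi] := df i; have [dgi cgi] := dg i; split.
  by move=> x Hx; apply: derivableD; [exact: dfi|exact: dgi].
apply: CmBar_eq (IH _ _ cfi cgi) => x Hx.
by rewrite /pderiv deriveD//; [exact: dfi|exact: dgi].
Qed.

Lemma pderivM i f g (x : 'rV[R]_n) : derivable f x (ebasis i) -> derivable g x (ebasis i) ->
  pderiv i (fun y => f y * g y) x = pderiv i f x * g x + f x * pderiv i g x.
Proof.
move=> df dg; rewrite /pderiv (deriveM df dg) addrC; congr (_ + _).
by rewrite [LHS]mulrC.
Qed.

Lemma CmBarM m f g : CmBar m H f -> CmBar m H g -> CmBar m H (fun x => f x * g x).
Proof.
elim: m f g => [|m IH] f g; first by rewrite !CmBar0E; exact: C0barM.
move=> Cf Cg; have cf := CmBarW Cf; have cg := CmBarW Cg.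
move: Cf Cg; rewrite !CmBarSE => -[c0f df] [c0g dg]; split; first exact: C0barM.
move=> i; have [dfi cfi] := df i; have [dgi cgi] := dg i; split.
  by move=> x Hx; apply: derivableM; [exact: dfi|exact: dgi].
apply: CmBar_eq (CmBarD (IH _ _ cfi cg) (IH _ _ cf cgi)) => x Hx.
by rewrite pderivM//; [exact: dfi|exact: dgi].
Qed.

Lemma CmBar_sum m (I : finType) (F : I -> 'rV[R]_n -> R) :
  (forall i, CmBar m H (F i)) -> CmBar m H (fun x => \sum_i F i x).
Proof.
move=> cF; elim: (index_enum I) => [|i s IH].
  by apply: CmBar_eq (CmBar_cst m 0) => x _; rewrite big_nil.
by apply: CmBar_eq (CmBarD (cF i) IH) => x _; rewrite big_cons.
Qed.

Lemma is_derive_comp_real (V : normedModType R) (phi : R -> R) (f : V -> R) (x v : V) (df dphi : R) :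
  is_derive x v f df -> is_derive (f x) 1 phi dphi -> is_derive x v (phi \o f) (dphi * df).
Proof.
move=> [dfx fE] dphix.
have line (k : V -> R) : (fun h : R => h^-1 *: ((k \o shift x) (h *: v) - k x)) =
   (fun h : R => h^-1 *: (((fun t : R => k (t *: v + x)) \o shift 0) (h *: 1) - k (0 *: v + x))).
  by apply/funext => h /=; rewrite addr0 scale0r add0r [h *: 1]mulr1.
have h1 : is_derive (0 : R) 1 (fun t : R => f (t *: v + x)) df.
  by rewrite -fE; apply: DeriveDef; [rewrite /derivable -line|rewrite /derive -line].
have h2 : is_derive (f (0 *: v + x)) 1 phi dphi by rewrite scale0r add0r.
have [d1 d2] := @is_derive1_comp R phi _ 0 _ _ h2 h1.
by apply: DeriveDef; [rewrite /derivable line|rewrite -d2 /derive line].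
Qed.

(** The derivative s b^(s-1) db contains a power of [b] again, so the induction on the order runs
    over all exponents. Positivity on the closure makes exp (s ln b) continuous up to the
    boundary. *)
Lemma CmBar_powR m (b : 'rV[R]_n -> R) (s : R) : {within closure H, continuous b} ->
  (forall x, closure H x -> 0 < b x) -> CmBar m H b -> CmBar m H (fun x => b x `^ s).
Proof.
move=> cb b0.
have bH x : H x -> 0 < b x by move=> Hx; apply: b0; exact: subset_closure.
have C0 t : C0bar H (fun x => b x `^ t).
  apply: (@C0bar_of_extension _ _ _ _ (fun x => expR (t * ln (b x)))) => //; last first.
    by move=> x /bH bx; rewrite /powR gt_eqF.
  apply/subspace_continuousP => x Hx.
  have /subspace_continuousP/(_ x Hx) h := cb.
  apply: (@cvg_comp _ _ _ b (fun y => expR (t * ln y)) _ (nbhs (b x))) => //.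
  apply: continuous_cvg; first exact: continuous_expR.
  by apply: cvgMl_tmp; apply: continuous_ln; exact: b0.
elim: m s => [|m IH] s; first by move=> _; apply/CmBar0E; exact: C0.
move=> Cb; have := Cb; rewrite CmBarSE => -[_ db]; apply/CmBarSE; split; first exact: C0.
have dpow i x : H x -> is_derive x (ebasis i) (fun x => b x `^ s)
    (s * b x `^ (s - 1) * pderiv i b x).
  move=> Hx; apply: (@is_derive_comp_real _ (fun y => y `^ s) b).
    by apply: DeriveDef => //; exact: (db i).1.
  by apply: is_derive1_powR; exact: bH.
move=> i; split=> [x Hx|]; first by have [] := dpow i x Hx.
apply: (@CmBar_eq _ (fun x => s * b x `^ (s - 1) * pderiv i b x)) => [x Hx|].
  by have [_] := dpow i x Hx.
apply: CmBarM; last exact: (db i).2.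
apply: CmBarM; first exact: CmBar_cst.
by apply: IH; exact: CmBarW.
Qed.

End CmBarTheory.

(** * Contracting linear systems over words *)

Section WordSums.
Context {R : realType} {B : finType}.

(** Recursion on the first letter matches [thetaw] and [bw], where the first letter acts first. *)
Fixpoint wsum (k : nat) (F : seq B -> R) : R :=
  if k is k'.+1 then \sum_j wsum k' (fun w => F (j :: w)) else F [::].

Lemma eq_wsum k F G : (forall w, size w = k -> F w = G w) -> wsum k F = wsum k G.
Proof.
elim: k F G => [|k IH] F G FG /=; first exact: FG.
by apply: eq_bigr => j _; apply: IH => w wk; apply: FG; rewrite /= wk.
Qed.

Lemma le_wsum k F G : (forall w, size w = k -> F w <= G w) -> wsum k F <= wsum k G.
Proof.
elim: k F G => [|k IH] F G FG /=; first exact: FG.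
by apply: ler_sum => j _; apply: IH => w wk; apply: FG; rewrite /= wk.
Qed.

Lemma wsumZ k c F : wsum k (fun w => c * F w) = c * wsum k F.
Proof.
by elim: k F => [|k IH] F //=; rewrite mulr_sumr; apply: eq_bigr => j _; exact: IH.
Qed.

Lemma wsumD k F G : wsum k (fun w => F w + G w) = wsum k F + wsum k G.
Proof.
by elim: k F G => [|k IH] F G //=; rewrite -big_split/=; apply: eq_bigr => j _; exact: IH.
Qed.

Lemma wsum0 k : wsum k (fun=> 0) = 0.
Proof. by elim: k => [|k IH] //=; rewrite big1. Qed.

Lemma wsum_sum k (I : finType) (F : I -> seq B -> R) :
  wsum k (fun w => \sum_i F i w) = \sum_i wsum k (F i).
Proof.
elim: k F => [|k IH] F //=; rewrite exchange_big/=.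
by apply: eq_bigr => j _; exact: IH.
Qed.

Lemma ler_norm_wsum k F : `|wsum k F| <= wsum k (fun w => `|F w|).
Proof.
elim: k F => [|k IH] F //=; rewrite (le_trans (ler_norm_sum _ _ _))//.
by apply: ler_sum => j _; exact: IH.
Qed.

Lemma wsum_add k l F : wsum (k + l) F = wsum k (fun u => wsum l (fun v => F (u ++ v))).
Proof. by elim: k F => [|k IH] F //=; apply: eq_bigr => j _; rewrite IH. Qed.

End WordSums.

Lemma thetaw_cat (R : realType) (n : nat) (B : Type) (th : B -> 'rV[R]_n -> 'rV[R]_n)
  (u v : seq B) (x : 'rV[R]_n) : thetaw th (u ++ v) x = thetaw th v (thetaw th u x).
Proof. by elim: u x => /=. Qed.

Section System.
Context {R : realType} {n : nat} {B I : finType}.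
Variables (th : B -> 'rV[R]_n -> 'rV[R]_n) (A : B -> I -> I -> 'rV[R]_n -> R).
Implicit Types (F : I -> 'rV[R]_n -> R) (w : seq B) (x : 'rV[R]_n).

Definition sys F : I -> 'rV[R]_n -> R :=
  fun i x => \sum_j \sum_i' A j i i' x * F i' (th j x).

(** The matrix cocycle over the word: the product of the matrices [A] of its letters along the orbit
    of [x]. *)
Fixpoint aw w (i i' : I) x : R :=
  if w is j :: w' then \sum_l A j i l x * aw w' l i' (th j x) else (i == i')%:R.

Lemma iter_sysE k F i x :
  iter k sys F i x = wsum k (fun w => \sum_i' aw w i i' x * F i' (thetaw th w x)).
Proof.
elim: k i x => [|k IH] i x /=.
  rewrite (bigD1 i)//= eqxx mul1r big1 ?addr0// => i' i'i.
  by rewrite eq_sym (negbTE i'i) mul0r.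
rewrite {1}/sys; apply: eq_bigr => j _.
rewrite (eq_bigr _ (fun l _ => congr1 (fun z => A j i l x * z) (IH l (th j x)))).
rewrite -(eq_bigr _ (fun l _ => wsumZ _ _ _)) -wsum_sum; apply: eq_wsum => w _.
under [RHS]eq_bigr do rewrite mulr_suml.
rewrite [RHS]exchange_big/=; apply: eq_bigr => l _; rewrite mulr_sumr.
by apply: eq_bigr => i' _; rewrite mulrA.
Qed.

Lemma aw_cat u v i i' x : aw (u ++ v) i i' x = \sum_l aw u i l x * aw v l i' (thetaw th u x).
Proof.
elim: u i x => [|j u IH] i x /=.
  rewrite (bigD1 i)//= eqxx mul1r big1 ?addr0// => l li.
  by rewrite eq_sym (negbTE li) mul0r.
under [RHS]eq_bigr do rewrite mulr_suml.
rewrite [RHS]exchange_big/=; apply: eq_bigr => l _; rewrite IH mulr_sumr.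
by apply: eq_bigr => l' _; rewrite mulrA.
Qed.

Variable H : set 'rV[R]_n.
Hypothesis Hth : forall j x, H x -> H (th j x).

Lemma thetaw_maps w x : H x -> H (thetaw th w x).
Proof. by elim: w x => //= j w IH x Hx; apply: IH; exact: Hth. Qed.

Definition absnorm (om : I -> R) k i x := wsum k (fun w => \sum_i' `|aw w i i' x| * om i').

(** The k-th iterate has norm at most 1/2 for the supremum over [H] weighted by 1 / om. The weights
    allow derivatives their own scale, and absolute values taken word by word allow bounded factors
    depending on the word to be inserted. *)
Definition contracting (om : I -> R) (k : nat) : Prop :=
  [/\ (0 < k)%N, forall i, 0 < om i & forall i x, H x -> absnorm om k i x <= om i / 2].

Lemma absnorm_mul om k p : contracting om k -> forall i x, H x ->
  absnorm om (k * p) i x <= om i / 2 ^+ p.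
Proof.
move=> [k0 om0 hk]; elim: p => [|p IH] i x Hx.
  rewrite muln0 /absnorm/= expr0 divr1 (bigD1 i)//= eqxx normr1 mul1r big1 ?addr0// => i' i'i.
  by rewrite eq_sym (negbTE i'i) normr0 mul0r.
rewrite mulnS /absnorm wsum_add.
apply: (@le_trans _ _ (wsum k (fun u => \sum_l `|aw u i l x| * (om l / 2 ^+ p)))).
  apply: le_wsum => u _.
  apply: (@le_trans _ _ (\sum_l `|aw u i l x| * absnorm om (k * p) l (thetaw th u x))); last first.
    by apply: ler_sum => l _; rewrite ler_wpM2l// IH//; exact: thetaw_maps.
  rewrite -(eq_bigr _ (fun l _ => wsumZ _ _ _)) -wsum_sum; apply: le_wsum => v _.
  rewrite (eq_bigr _ (fun l _ => mulr_sumr _ _ _ _)) exchange_big/=.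
  apply: ler_sum => i' _; rewrite aw_cat.
  apply: (@le_trans _ _ (\sum_l `|aw u i l x * aw v l i' (thetaw th u x)| * om i')).
    by rewrite -mulr_suml ler_wpM2r ?(ltW (om0 _))// ler_norm_sum.
  by apply: ler_sum => l _; rewrite normrM mulrA.
rewrite (@eq_wsum _ _ _ _ (fun u => (2 ^+ p)^-1 * \sum_l `|aw u i l x| * om l)); last first.
  by move=> u _; rewrite mulr_sumr; apply: eq_bigr => l _; rewrite mulrA mulrC.
rewrite wsumZ exprS invfM mulrA mulrC ler_wpM2r ?invr_ge0 ?exprn_ge0//.
exact: hk.
Qed.

Lemma iter_sys_bound om k p F M : contracting om k -> 0 <= M ->
  (forall i x, H x -> `|F i x| <= M * om i) ->
  forall i x, H x -> `|iter (k * p) sys F i x| <= M * (om i / 2 ^+ p).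
Proof.
move=> ck M0 FM i x Hx; rewrite iter_sysE (le_trans (ler_norm_wsum _ _))//.
apply: (@le_trans _ _ (M * absnorm om (k * p) i x)); last first.
  by rewrite ler_wpM2l//; exact: absnorm_mul.
rewrite -wsumZ; apply: le_wsum => w _; rewrite mulr_sumr (le_trans (ler_norm_sum _ _ _))//.
apply: ler_sum => i' _; rewrite normrM mulrCA ler_wpM2l//.
by apply: FM; exact: thetaw_maps.
Qed.

Lemma sysB F G i x : sys (fun i x => F i x - G i x) i x = sys F i x - sys G i x.
Proof.
rewrite /sys -sumrB; apply: eq_bigr => j _; rewrite -sumrB; apply: eq_bigr => i' _.
by rewrite mulrBr.
Qed.

Lemma sysD F G i x : sys (fun i x => F i x + G i x) i x = sys F i x + sys G i x.
Proof.
rewrite /sys -big_split; apply: eq_bigr => j _; rewrite -big_split; apply: eq_bigr => i' _.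
by rewrite mulrDr.
Qed.

Lemma eq_sys F G : (forall i x, H x -> F i x = G i x) ->
  forall i x, H x -> sys F i x = sys G i x.
Proof.
move=> FG i x Hx; apply: eq_bigr => j _; apply: eq_bigr => i' _.
by rewrite FG//; exact: Hth.
Qed.

Lemma sys_unique om k (g f1 f2 : I -> 'rV[R]_n -> R) (M1 M2 : R) : contracting om k ->
  (forall i x, H x -> `|f1 i x| <= M1) -> (forall i x, H x -> `|f2 i x| <= M2) ->
  (forall i x, H x -> f1 i x = g i x + sys f1 i x) ->
  (forall i x, H x -> f2 i x = g i x + sys f2 i x) ->
  forall i x, H x -> f1 i x = f2 i x.
Proof.
move=> ck b1 b2 s1 s2 i x Hx.
have [_ om0 _] := ck.
pose e i x := f1 i x - f2 i x.
have se l y : H y -> sys e l y = e l y.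
  by move=> Hy; rewrite sysB /e s1// s2//; ring.
have ie p l y : H y -> iter p sys e l y = e l y.
  elim: p l y => //= p IH l y Hy; rewrite -se//; exact: eq_sys.
pose M := \sum_l (`|M1| + `|M2|) / om l.
have M0 : 0 <= M by apply: sumr_ge0 => l _; rewrite divr_ge0 ?addr_ge0// ltW.
have eM l y : H y -> `|e l y| <= M * om l.
  move=> Hy; rewrite -ler_pdivrMr//; apply: (@le_trans _ _ ((`|M1| + `|M2|) / om l)).
    rewrite ler_wpM2r ?invr_ge0 ?(ltW (om0 _))// (le_trans (ler_normB _ _))//.
    by rewrite lerD// (le_trans _ (ler_norm _))//; [exact: b1|exact: b2].
  by rewrite /M (bigD1 l)//= lerDl sumr_ge0// => l' _; rewrite divr_ge0 ?addr_ge0// ltW.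
apply/eqP; rewrite -subr_eq0 -normr_le0 -/(e i x).
have c : M * om i * (1 / 2) ^+ p @[p --> \oo] --> 0.
  rewrite -(mulr0 (M * om i)); apply: cvgMl_tmp; apply: cvg_expr.
  by rewrite ger0_norm; lra.
apply: (cvgr_to_ge c); apply: nearW => p.
rewrite -(ie (k * p)%N)// (le_trans (iter_sys_bound p ck M0 eM _ Hx))//.
by rewrite div1r exprVn mulrA.
Qed.

(** Horner form of g + T g + ... + T^(N-1) g with T = [sys]. *)
Fixpoint sums (g : I -> 'rV[R]_n -> R) (N : nat) : I -> 'rV[R]_n -> R :=
  if N is N'.+1 then fun i x => g i x + sys (sums g N') i x else fun _ _ => 0.

Lemma sums_add g N k i x : sums g (N + k) i x = sums g N i x + iter N sys (sums g k) i x.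
Proof.
elim: N i x => [|N IH] i x /=; first by rewrite add0r.
have -> : sums g (N + k) = (fun i x => sums g N i x + iter N sys (sums g k) i x).
  by apply/funext => l; apply/funext => y; exact: IH.
by rewrite sysD addrA.
Qed.

Lemma sys_neumann om k (g : I -> 'rV[R]_n -> R) (M : R) : contracting om k ->
  (forall i x, H x -> `|g i x| <= M) -> (forall i x, H x -> `|sums g k i x| <= M) ->
  exists f : I -> 'rV[R]_n -> R,
    [/\ exists C, forall i x, H x -> `|f i x| <= C,
        forall i x, H x -> f i x = g i x + sys f i x &
        forall e, 0 < e -> \forall p \near \oo, forall i x, H x ->
          `|sums g (k * p) i x - f i x| <= e].
Proof.
move=> ck gM sM.
have [_ om0 _] := ck.
pose M' := \sum_l `|M| / om l.
have M0 : 0 <= M' by apply: sumr_ge0 => l _; rewrite divr_ge0// ltW.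
have MM' l (z : R) : `|z| <= M -> `|z| <= M' * om l.
  move=> zM; rewrite -ler_pdivrMr//; apply: (@le_trans _ _ (`|M| / om l)).
    rewrite ler_wpM2r ?invr_ge0 ?(ltW (om0 _))// (le_trans zM)// ler_norm//.
  by rewrite /M' (bigD1 l)//= lerDl sumr_ge0// => l' _; rewrite divr_ge0// ltW.
have gM' l y : H y -> `|g l y| <= M' * om l by move=> Hy; apply: MM'; exact: gM.
have sM' l y : H y -> `|sums g k l y| <= M' * om l by move=> Hy; apply: MM'; exact: sM.
pose Om := \sum_l om l.
have Om0 : 0 <= Om by apply: sumr_ge0 => l _; exact: ltW.
have omOm l : om l <= Om by rewrite /Om (bigD1 l)//= lerDl sumr_ge0// => l' _; exact: ltW.
pose C := M' * Om.
have C0 : 0 <= C by rewrite mulr_ge0.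
pose u p i x := iter (k * p) sys (sums g k) i x.
have ub p l y : H y -> `|u p l y| <= C * (1 / 2) ^+ p.
  move=> Hy; rewrite (le_trans (iter_sys_bound p ck M0 sM' l Hy))//.
  rewrite /C div1r exprVn mulrA ler_wpM2r ?invr_ge0 ?exprn_ge0// ler_wpM2l//.
have sE p l y : sums g (k * p) l y = \sum_(q < p) u q l y.
  elim: p => [|p IH]; first by rewrite muln0 big_ord0.
  by rewrite mulnSr sums_add IH big_ord_recr.
have half01 : 0 <= (1 / 2 : R) < 1 by apply/andP; split; lra.
have cv l y : H y -> cvgn (fun p => sums g (k * p) l y).
  move=> Hy; under eq_fun do rewrite sE.
  by apply: (@geometric_series_cvg _ _ C (fun q => u q l y) half01) => p; exact: ub.
pose f i x := limn (fun p => sums g (k * p) i x).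
have tail p l y : H y -> `|sums g (k * p) l y - f l y| <= C * 2 * (1 / 2) ^+ p.
  move=> Hy; have c : `|sums g (k * p) l y - sums g (k * (p + r)) l y| @[r --> \oo] -->
      `|sums g (k * p) l y - f l y|.
    apply: cvg_norm; apply: cvgB; first exact: cvg_cst.
    have := cv l y Hy; rewrite -(cvg_shiftn p) => h.
    by under eq_fun do rewrite addnC; exact: h.
  apply: (cvgr_to_le c); apply: nearW => r.
  rewrite !sE big_split_ord/= opprD addrA subrr add0r normrN.
  rewrite (le_trans (ler_norm_sum _ _ _))//.
  apply: (@le_trans _ _ (\sum_(q < r) (C * (1 / 2) ^+ p) * (1 / 2) ^+ q)).
    by apply: ler_sum => q _; rewrite -mulrA -exprD; exact: ub.
  rewrite -mulr_sumr (_ : C * 2 * (1 / 2) ^+ p = C * (1 / 2) ^+ p * 2); last by ring.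
  rewrite ler_wpM2l ?mulr_ge0 ?exprn_ge0//.
  rewrite (le_trans (geometric_sum_le _ half01))//.
  by rewrite (_ : (1 - 1 / 2)^-1 = 2)//; field.
exists f; split.
- exists (C * 2) => l y Hy; have := tail 0%N l y Hy.
  by rewrite muln0 /= sub0r normrN expr0 mulr1.
- move=> l y Hy.
  (* One more term turns the partial sum f_p into g + T f_p and changes it by T^(k p) g, which tends
     to 0; hence the limit solves the equation. *)
  have c1 : sums g (k * p).+1 l y @[p --> \oo] --> g l y + sys f l y.
    rewrite /=; apply: cvgD; first exact: cvg_cst.
    apply: cvg_big => [|j _]; first exact: add_continuous.
    apply: cvg_big => [|i' _]; first exact: add_continuous.
    apply: cvgMl_tmp; apply: cv; exact: Hth.
  have c2 : sums g (k * p).+1 l y @[p --> \oo] --> f l y.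
    have e1 : (fun p => sums g (k * p).+1 l y) =
        (fun p => sums g (k * p) l y + iter (k * p) sys g l y).
      apply/funext => p; rewrite -addn1 sums_add; congr (_ + _).
      have -> // : sums g 1 = g.
      apply/funext => i'; apply/funext => z /=; rewrite /sys big1 ?addr0// => j _.
      by rewrite big1// => i'' _; rewrite mulr0.
    rewrite e1 -[f l y]addr0; apply: cvgD; first exact: cv.
    apply/norm_cvg0P; apply: (@squeeze_cvgr _ _ _ _ (fun=> 0) (fun p => C * (1 / 2) ^+ p)).
    + apply: nearW => p; rewrite normr_ge0/= (le_trans (iter_sys_bound p ck M0 gM' l Hy))//.
      by rewrite /C div1r exprVn mulrA ler_wpM2r ?invr_ge0 ?exprn_ge0// ler_wpM2l.
    + exact: cvg_cst.
    + rewrite -(mulr0 C); apply: cvgMl_tmp; apply: cvg_expr.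
      by rewrite ger0_norm; lra.
  exact: (cvg_unique _ c2 c1).
- move=> e e0.
  have c : C * 2 * (1 / 2) ^+ p @[p --> \oo] --> 0.
    rewrite -(mulr0 (C * 2)); apply: cvgMl_tmp; apply: cvg_expr.
    by rewrite ger0_norm; lra.
  have /cvgr0Pnorm_le/(_ _ e0) := c; apply: filterS => p hp i x Hx.
  by rewrite (le_trans (tail p i x Hx))// (le_trans (ler_norm _)).
Qed.

End System.

(** * Chain rule and derivatives of uniform limits *)

Section ChainRule.
Context {R : realType} {n : nat}.

Lemma rv_sum_basis (v : 'rV[R]_n) : v = \sum_(c < n) v 0 c *: ebasis c.
Proof.
apply/rowP => i; rewrite summxE (bigD1 i)//= !mxE !eqxx mulr1 big1 ?addr0// => c ci.
by rewrite !mxE eqxx /= eq_sym (negbTE ci) mulr0.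
Qed.

Lemma differentiable_rv (th : 'rV[R]_n -> 'rV[R]_n) (x : 'rV[R]_n) :
  (forall c, differentiable (fun y => th y 0 c : R) x) -> differentiable th x.
Proof.
move=> dth.
have -> : th = \sum_(c < n) (fun y => (th y 0 c : R) *: ebasis c).
  by apply/funext => y; rewrite fct_sumE; exact: rv_sum_basis.
by apply: differentiable_sum => c; apply: differentiableZl.
Qed.

Lemma pderiv_comp (f : 'rV[R]_n -> R) (th : 'rV[R]_n -> 'rV[R]_n) (x : 'rV[R]_n) (a : 'I_n) :
  differentiable f (th x) -> differentiable th x ->
  pderiv a (fun y => f (th y)) x =
    \sum_c pderiv a (fun y => th y 0 c) x * pderiv c f (th x).
Proof.
move=> df dth.
have dth' : derivable th x (ebasis a) by exact: diff_derivable.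
rewrite /pderiv deriveE; last exact: (differentiable_comp dth df).
have dE : 'd th x (ebasis a) = 'D_(ebasis a) th x by rewrite deriveE.
rewrite (diff_comp dth df)/= dE derive_mx//.
rewrite [X in 'd f (th x) X]rv_sum_basis linear_sum; apply: eq_bigr => c _.
by rewrite linearZ mxE/= -deriveE.
Qed.

Lemma norm_ebasis (i : 'I_n) : `|ebasis i : 'rV[R]_n| <= 1.
Proof.
rewrite [leLHS]/Num.norm/= mx_normrE; apply: bigmax_le => // -[k j] _ /=.
by rewrite mxE; case: (_ && _); rewrite ?normr1 ?normr0.
Qed.

Lemma pderiv_lipschitz_bound (f : 'rV[R]_n -> R) (x : 'rV[R]_n) (a : 'I_n) (C : R) :
  0 <= C -> (\forall y \near x, `|f y - f x| <= C * `|y - x|) -> derivable f x (ebasis a) ->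
  `|pderiv a f x| <= C.
Proof.
move=> C0 /nbhs_ballP[r /= r0 rf] df.
have h : `|h^-1 *: ((f \o shift x) (h *: ebasis a) - f x)| @[h --> 0^'] --> `|pderiv a f x|.
  by apply: cvg_norm; exact: df.
apply: (cvgr_to_le h).
near=> t.
have t0 : t != 0 by near: t; exact: nbhs_dnbhs_neq.
rewrite normrZ normfV ler_pdivrMl ?normr_gt0//.
have tn : `|t *: ebasis a : 'rV[R]_n| <= `|t| by rewrite normrZ ler_piMr// norm_ebasis.
apply: (le_trans (rf (t *: ebasis a + x) _)); last first.
  by rewrite addrK mulrC ler_wpM2r.
rewrite -ball_normE /ball_/= opprD addrCA subrr addr0 normrN (le_lt_trans tn)//.
by near: t; exact: dnbhs0_lt.
Unshelve. all: end_near. Qed.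

(* Only the increments of f_q - f_p along the direction a are compared, by the
   mean value inequality, so the limit derivative need not be continuous. *)
Lemma pderiv_uniform_limit (H : set 'rV[R]_n) (a : 'I_n) (f_ : nat -> 'rV[R]_n -> R)
    (f g : 'rV[R]_n -> R) : open H ->
  (forall N x, H x -> derivable (f_ N) x (ebasis a)) ->
  (forall e, 0 < e -> \forall N \near \oo, forall x, H x -> `|f_ N x - f x| <= e) ->
  (forall e, 0 < e -> \forall N \near \oo, forall x, H x -> `|pderiv a (f_ N) x - g x| <= e) ->
  forall x, H x -> derivable f x (ebasis a) /\ pderiv a f x = g x.
Proof.
move=> oH df uf ug x Hx.
have /nbhs_ballP[r /= r0 rH] : nbhs x H by exact: open_nbhs_nbhs.
have Hball (t : R) : `|t| < r -> H (t *: ebasis a + x).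
  move=> tr; apply: rH; rewrite -ball_normE /ball_/= opprD addrCA subrr addr0 normrN.
  by rewrite normrZ (le_lt_trans _ tr)// ler_piMr// norm_ebasis.
have cf y : H y -> f_ N y @[N --> \oo] --> f y.
  move=> Hy; apply/cvgrPdist_le => e e0; have := uf e e0.
  by apply: filterS => N h; rewrite distrC; exact: h.
suff lim : h^-1 *: ((f \o shift x) (h *: ebasis a) - f x) @[h --> 0^'] --> g x.
  by split; [apply/cvg_ex; exists (g x)|apply/cvg_lim].
apply/cvgrPdist_le => e e0.
have e40 : 0 < e / 4 by rewrite divr_gt0// ltr0n.
have [N _ HN] := ug _ e40.
have incr (t : R) : `|t| < r ->
    `|(f (t *: ebasis a + x) - f x) - (f_ N (t *: ebasis a + x) - f_ N x)| <= (e / 2) * `|t|.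
  move=> tr.
  have c : `|(f_ M (t *: ebasis a + x) - f_ M x) - (f_ N (t *: ebasis a + x) - f_ N x)| @[M --> \oo]
     --> `|(f (t *: ebasis a + x) - f x) - (f_ N (t *: ebasis a + x) - f_ N x)|.
    apply: cvg_norm; apply: cvgB; last exact: cvg_cst.
    by apply: cvgB; apply: cf => //; exact: Hball.
  apply: (cvgr_to_le c); exists N => // M NM.
  have := @directional_mean_value R 'rV[R]_n (fun y => f_ M y - f_ N y) x (ebasis a) 0 (e / 2) t.
  rewrite mul0r subr0 (_ : _ - _ - (f_ M x - f_ N x) =
    f_ M (t *: ebasis a + x) - f_ M x - (f_ N (t *: ebasis a + x) - f_ N x)); last by ring.
  apply => u /andP[u0 u1].
  have Hu : H ((u * t) *: ebasis a + x).
    by apply: Hball; rewrite normrM (ger0_norm u0) (le_lt_trans _ tr)// ler_piMl.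
  split; first by apply: derivableB; exact: df.
  rewrite subr0 deriveB; [|exact: df|exact: df].
  have h1 := HN M NM _ Hu; have h2 := HN N (leqnn N) _ Hu.
  move: h1 h2; rewrite /pderiv; set p1 := 'D_ _ _ _; set p2 := 'D_ _ _ _; set p3 := g _ => h1 h2.
  rewrite (_ : p1 - p2 = (p1 - p3) - (p2 - p3)); last by ring.
  by rewrite (le_trans (ler_normB _ _))//; lra.
have dN : h^-1 *: ((f_ N \o shift x) (h *: ebasis a) - f_ N x) @[h --> 0^'] --> pderiv a (f_ N) x.
  exact: df.
have /cvgrPdist_le/(_ _ e40) near1 := dN.
near=> t.
have t0 : t != 0 by near: t; exact: nbhs_dnbhs_neq.
have tr : `|t| < r by near: t; exact: dnbhs0_lt.
have h1 : `|pderiv a (f_ N) x - t^-1 *: ((f_ N \o shift x) (t *: ebasis a) - f_ N x)| <= e / 4.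
  by near: t; exact: near1.
have h2 := HN N (leqnn N) x Hx.
have h3 : `|t^-1 *: ((f \o shift x) (t *: ebasis a) - f x) -
    t^-1 *: ((f_ N \o shift x) (t *: ebasis a) - f_ N x)| <= e / 2.
  rewrite -scalerBr normrZ normfV ler_pdivrMl ?normr_gt0// mulrC; exact: incr.
move: h1 h2 h3; set z1 := pderiv _ _ _; set z2 := t^-1 *: _; set z3 := t^-1 *: _; set z4 := g x.
move=> h1 h2 h3.
rewrite (_ : z4 - z3 = (z4 - z1) + (z1 - z2) + (z2 - z3)); last by ring.
rewrite distrC in h2; rewrite distrC in h3.
rewrite (le_trans (ler_normD _ _))// (_ : e = e / 4 + e / 4 + e / 2); last by field.
by rewrite lerD// (le_trans (ler_normD _ _))// lerD.
Unshelve. all: end_near. Qed.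

End ChainRule.

Section Prolongation.
Context {R : realType} {n : nat} {B I : finType}.
Variables (th : B -> 'rV[R]_n -> 'rV[R]_n) (A : B -> I -> I -> 'rV[R]_n -> R).
Variable H : set 'rV[R]_n.
Hypothesis oH : open H.
Hypothesis Hth : forall j x, H x -> H (th j x).
Hypothesis dth : forall j x, H x -> forall c, differentiable (fun y => th j y 0 c : R) x.
Hypothesis dA : forall j i i' x, H x -> differentiable (A j i i') x.

Local Notation I' := (I + I * 'I_n)%type.

(* Coefficients of the system satisfied by the functions F i (index [inl i])
   together with their partial derivatives (index [inr (i, a)]). *)
Definition prolong_coef (j : B) (k k' : I') (x : 'rV[R]_n) : R :=
  match k, k' with
  | inl i, inl i' => A j i i' x
  | inl i, inr _ => 0
  | inr (i, a), inl i' => pderiv a (A j i i') x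
  | inr (i, a), inr (i', c) => A j i i' x * pderiv a (fun y => th j y 0 c) x
  end.

Definition prolong (F : I -> 'rV[R]_n -> R) (k : I') : 'rV[R]_n -> R :=
  match k with inl i => F i | inr (i, a) => pderiv a (F i) end.

Lemma big_prolong (F : I' -> R) :
  \sum_(k : I') F k = \sum_i F (inl i) + \sum_i \sum_(a < n) F (inr (i, a)).
Proof.
by rewrite big_sumType/= pair_bigA/=; congr (_ + _); apply: eq_bigr => -[].
Qed.

Lemma differentiable_th j x : H x -> differentiable (th j) x.
Proof. by move=> Hx; apply: differentiable_rv => c; exact: dth. Qed.

Lemma differentiable_thetaw w x : H x -> differentiable (thetaw th w) x.
Proof.
elim: w x => [|j w IH] x Hx; first exact: (@ex_diff _ _ _ _ _ (id : 'rV[R]_n -> 'rV[R]_n) id).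
apply: (@differentiable_comp _ _ _ _ (th j) (thetaw th w)).
  exact: differentiable_th.
by apply: IH; exact: Hth.
Qed.

Lemma differentiable_thetaw_coord w x c : H x ->
  differentiable (fun y => thetaw th w y 0 c : R) x.
Proof.
move=> Hx; apply: (@differentiable_comp _ _ _ _ (thetaw th w) (fun v : 'rV[R]_n => v 0 c : R)).
  exact: differentiable_thetaw.
exact: differentiable_coord.
Qed.

Lemma differentiable_sum_fin (J : finType) (F : J -> 'rV[R]_n -> R) x :
  (forall j, differentiable (F j) x) -> differentiable (fun y => \sum_j F j y) x.
Proof.
move=> dF; elim: (index_enum J) => [|j s IH].
  rewrite (_ : (fun y => _) = cst 0); first exact: differentiable_cst.
  by apply/funext => y; rewrite big_nil.
rewrite (_ : (fun y => _) = (F j) + (fun y => \sum_(j <- s) F j y)).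
  exact: differentiableD.
by apply/funext => y; rewrite big_cons.
Qed.

Lemma pderiv_sum_fin (J : finType) (F : J -> 'rV[R]_n -> R) x a :
  (forall j, differentiable (F j) x) ->
  pderiv a (fun y => \sum_j F j y) x = \sum_j pderiv a (F j) x.
Proof.
move=> dF.
have [] : differentiable (fun y => \sum_(j <- index_enum J) F j y) x /\
  pderiv a (fun y => \sum_(j <- index_enum J) F j y) x = \sum_(j <- index_enum J) pderiv a (F j) x.
  elim: (index_enum J) => [|j s [IH1 IH2]].
    rewrite (_ : (fun y => _) = cst 0).
      by split; [exact: differentiable_cst|rewrite big_nil /pderiv derive_cst].
    by apply/funext => y; rewrite big_nil.
  rewrite (_ : (fun y => _) = (F j) + (fun y => \sum_(j <- s) F j y)); last first.
    by apply/funext => y; rewrite big_cons.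
  split; first exact: differentiableD.
  by rewrite big_cons -IH2 /pderiv deriveD//; exact: diff_derivable.
by [].
Qed.

Lemma differentiable_sys_term F j i i' x : (forall i x, H x -> differentiable (F i) x) -> H x ->
  differentiable (fun y => A j i i' y * F i' (th j y)) x.
Proof.
move=> dF Hx; apply: differentiableM; first exact: dA.
apply: (@differentiable_comp _ _ _ _ (th j) (F i')); first exact: differentiable_th.
by apply: dF; exact: Hth.
Qed.

Lemma differentiable_sys F i x : (forall i x, H x -> differentiable (F i) x) -> H x ->
  differentiable (sys th A F i) x.
Proof.
move=> dF Hx; apply: differentiable_sum_fin => j; apply: differentiable_sum_fin => i'.
exact: differentiable_sys_term.
Qed.

Lemma prolong_sys F : (forall i x, H x -> differentiable (F i) x) ->
  forall k x, H x -> prolong (sys th A F) k x = sys th prolong_coef (prolong F) k x.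
Proof.
move=> dF [i|[i a]] x Hx; rewrite /sys /=.
  apply: eq_bigr => j _; rewrite big_prolong/= [X in _ = _ + X]big1 ?addr0// => i' _.
  by rewrite big1// => c _; rewrite mul0r.
rewrite pderiv_sum_fin => [|j]; last first.
  by apply: differentiable_sum_fin => i'; exact: differentiable_sys_term.
apply: eq_bigr => j _; rewrite pderiv_sum_fin => [|i']; last exact: differentiable_sys_term.
rewrite big_prolong/= -big_split/=; apply: eq_bigr => i' _.
have dFi : differentiable (F i') (th j x) by apply: dF; exact: Hth.
have dthj := differentiable_th j Hx.
rewrite (@pderivM _ _ _ (A j i i') (fun y => F i' (th j y))); last 2 first.
- by apply: diff_derivable; exact: dA.
- by apply: diff_derivable; exact: (differentiable_comp dthj dFi).
congr (_ + _); rewrite pderiv_comp// mulr_sumr; apply: eq_bigr => c _.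
by rewrite mulrA.
Qed.

(** Termwise differentiation of Neumann sums gives exactly the Neumann sums of the prolonged system,
    so uniform convergence of the latter yields differentiability of the limit of the former. *)
Lemma sums_prolong g N : (forall i x, H x -> differentiable (g i) x) ->
  (forall i x, H x -> differentiable (sums th A g N i) x) /\
  forall k x, H x -> prolong (sums th A g N) k x = sums th prolong_coef (prolong g) N k x.
Proof.
move=> dg; elim: N => [|N [IH1 IH2]] /=.
  split=> [i x Hx|[i|[i a]] x Hx] //=.
  by rewrite /pderiv derive_cst.
split=> [i x Hx|k x Hx].
  by apply: differentiableD; [exact: dg|exact: differentiable_sys].
rewrite -(eq_sys prolong_coef Hth IH2)// -prolong_sys//.
case: k => [i|[i a]] //=.
rewrite /pderiv deriveD//; apply: diff_derivable; [exact: dg|exact: differentiable_sys].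
Qed.

Lemma aw_prolong w x : H x ->
  [/\ forall i i', aw th prolong_coef w (inl i) (inl i') x = aw th A w i i' x,
    forall i ic, aw th prolong_coef w (inl i) (inr ic) x = 0 &
    forall i a i' c, aw th prolong_coef w (inr (i, a)) (inr (i', c)) x =
      aw th A w i i' x * pderiv a (fun y => thetaw th w y 0 c) x].
Proof.
elim: w x => [|j w IH] x Hx /=.
  split=> // i a i' c.
  rewrite (_ : (inr (i, a) == inr (i', c) :> I') = (i == i') && (a == c)); last first.
    by rewrite -[RHS]/((i, a) == (i', c)).
  have -> : pderiv a (fun y : 'rV[R]_n => y 0 c) x = (a == c)%:R.
    have dI : derivable (id : 'rV[R]_n -> 'rV[R]_n) x (ebasis a) by exact: derivable_id.
    have := derive_mx dI.
    rewrite derive_id => /(congr1 (fun M : 'rV[R]_n => M 0 c)); rewrite !mxE /pderiv => <-.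
    by rewrite eqxx/= eq_sym.
  by case: (i == i'); rewrite ?mul1r ?mul0r.
have [h1 h2 h3] := IH (th j x) (Hth j Hx).
split=> [i i'|i ic|i a i' c]; rewrite big_prolong/=.
- rewrite [X in _ + X]big1 ?addr0 => [|l _].
    by apply: eq_bigr => l _; rewrite h1.
  by rewrite big1// => e _; rewrite mul0r.
- rewrite !big1 ?addr0// => l _; last by rewrite h2 mulr0.
  by rewrite big1// => e _; rewrite mul0r.
rewrite big1 ?add0r => [|l _]; last by rewrite h2 mulr0.
rewrite mulr_suml; apply: eq_bigr => l _.
rewrite (@pderiv_comp _ _ (fun y => thetaw th w y 0 c) (th j)); last 2 first.
- by apply: differentiable_thetaw_coord; exact: Hth.
- exact: differentiable_th.
rewrite mulr_sumr; apply: eq_bigr => e _; rewrite h3; ring.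
Qed.

(* The prolonged system is block triangular: its block on the derivatives is
   the old one times Jacobians of the maps thetaw w, bounded by Cth, and the
   coupling block is absorbed by a large weight on the derivatives. *)
Lemma prolong_contracting om k (Cth : R) :
  contracting th A H om k -> 0 <= Cth ->
  (forall w x y, H x -> H y -> `|thetaw th w x - thetaw th w y| <= Cth * `|x - y|) ->
  (exists E, forall j i i' x, H x -> `|prolong_coef j i i' x| <= E) ->
  exists om' k', contracting th prolong_coef H om' k'.
Proof.
move=> ck C0 lip [E hE].
have [k0 om0 _] := ck.
have dthw w x a c : H x -> `|pderiv a (fun y => thetaw th w y 0 c) x| <= Cth.
  move=> Hx; apply: pderiv_lipschitz_bound => //; last first.
    by apply: diff_derivable; exact: differentiable_thetaw_coord.
  have : nbhs x H by exact: open_nbhs_nbhs.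
  apply: filterS => y Hy; rewrite (le_trans _ (lip w y x Hy Hx))//.
  by have := rv_coord_le_norm (thetaw th w y - thetaw th w x) c; rewrite !mxE.
(* [p] halvings reduce the cost of the [n] Jacobian entries of a row, each at most [Cth], to a
   quarter. *)
have [p hp] : exists p, n%:R * Cth * (1 / 2) ^+ p <= 1 / 4 /\ (0 < p)%N.
  have c : n%:R * Cth * (1 / 2) ^+ p @[p --> \oo] --> 0.
    rewrite -(mulr0 (n%:R * Cth)); apply: cvgMl_tmp; apply: cvg_expr.
    by rewrite ger0_norm; lra.
  have e40 : 0 < 1 / 4 :> R by lra.
  have /cvgr0Pnorm_le/(_ _ e40)[p _ h] := c; exists p.+1; split => //.
  by rewrite (le_trans (ler_norm _))//; exact: h (leqnSn p).
have {hp} [hp p0] := hp.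
pose K := (k * p)%N.
have [E' E'0 hE'] : exists2 E', 0 <= E' & forall w i i' x, size w = K -> H x ->
    `|aw th prolong_coef w i i' x| <= E'.
  elim: K => [|K [E' E'0 IH]].
    exists 1 => // w i i' x /size0nil-> _ /=.
    by case: (i == i'); rewrite ?normr1 ?normr0.
  have cE : 0 <= \sum_(l : I') `|E| * E' by apply: sumr_ge0 => l _; exact: mulr_ge0.
  exists (\sum_(l : I') `|E| * E') => // -[//|j w] i i' x [wK] Hx /=.
  rewrite (le_trans (ler_norm_sum _ _ _))//; apply: ler_sum => l _.
  rewrite normrM ler_pM// ?(le_trans (hE _ _ _ _ Hx)) ?ler_norm//.
  by apply: IH => //; exact: Hth.
pose Nw := wsum K (fun _ : seq B => 1 : R).
have Nw0 : 0 <= Nw by rewrite -(wsum0 (B:=B) K); apply: le_wsum.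
pose Om := \sum_i om i.
have Om0 : 0 <= Om by apply: sumr_ge0 => i _; exact: ltW.
(* The weight [La] of the derivatives makes the coupling block cost at most La om_i / 4; with the
   quarter from the derivative block this gives the required half. *)
pose La := 1 + \sum_i 4 * (Nw * E' * Om) / om i.
have La_ge i : 4 * (Nw * E' * Om) <= La * om i.
  rewrite -ler_pdivrMr// /La (bigD1 i)//= addrCA lerDl addr_ge0// sumr_ge0// => l _.
  by rewrite divr_ge0 ?(ltW (om0 _))// !mulr_ge0.
have La0 : 0 < La.
  rewrite ltr_wpDr// sumr_ge0// => l _.
  by rewrite divr_ge0 ?(ltW (om0 _))// !mulr_ge0.
exists (fun k : I' => match k with inl i => om i | inr (i, a) => La * om i end), K; split.
- by rewrite muln_gt0 k0.
- by case=> [i|[i a]]; rewrite ?mulr_gt0.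
have half2 : (2 ^+ p)^-1 <= 1 / 2 :> R.
  rewrite div1r lef_pV2 ?posrE ?exprn_gt0//.
  by rewrite -[leLHS]expr1 ler_eXn2l// ltr1n.
case=> [i|[i a]] x Hx; rewrite /absnorm.
  apply: (@le_trans _ _ (absnorm th A om K i x)).
    apply: le_wsum => w _; rewrite big_prolong.
    have [h1 h2 _] := aw_prolong w Hx.
    rewrite [X in _ + X]big1 ?addr0 => [|l _].
      by apply: ler_sum => l _; rewrite h1.
    by rewrite big1// => e _; rewrite h2 normr0 mul0r.
  rewrite (le_trans (absnorm_mul Hth p ck _ Hx))// ler_wpM2l ?(ltW (om0 _))//.
  by rewrite -[leRHS]div1r.
apply: (@le_trans _ _ (wsum K (fun w => E' * Om + n%:R * Cth * La * \sum_i' `|aw th A w i i' x| * om i'))).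
  apply: le_wsum => w wK; rewrite big_prolong lerD//.
    by rewrite mulr_sumr; apply: ler_sum => i' _; rewrite ler_wpM2r ?(ltW (om0 _))//; exact: hE'.
  have [_ _ h3] := aw_prolong w Hx.
  rewrite mulr_sumr; apply: ler_sum => i' _.
  apply: (@le_trans _ _ (\sum_(c < n) Cth * La * (`|aw th A w i i' x| * om i'))); last first.
    by rewrite sumr_const card_ord -[leLHS]mulr_natl !mulrA.
  apply: ler_sum => c _; rewrite h3 normrM.
  rewrite (_ : Cth * La * _ = `|aw th A w i i' x| * Cth * (La * om i')); last by ring.
  by rewrite ler_wpM2r ?mulr_ge0 ?(ltW (om0 _)) ?(ltW La0)// ler_wpM2l// dthw.
rewrite wsumD wsumZ -/(absnorm th A om K i x).
rewrite (_ : wsum K (fun=> E' * Om) = Nw * E' * Om); last first.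
  rewrite (@eq_wsum _ _ K _ (fun _ => E' * Om * 1)) => [|w _]; last by rewrite mulr1.
  by rewrite wsumZ -/Nw; ring.
have b1 := absnorm_mul Hth p ck i Hx.
have b2 : n%:R * Cth * La * absnorm th A om K i x <= La * om i / 4.
  apply: (@le_trans _ _ (n%:R * Cth * La * (om i / 2 ^+ p))).
    by rewrite ler_wpM2l// !mulr_ge0// ltW.
  rewrite (_ : _ * (om i / 2 ^+ p) = n%:R * Cth * (1 / 2) ^+ p * (La * om i)); last first.
    by rewrite div1r exprVn; ring.
  by rewrite mulrC ler_wpM2l ?mulr_ge0 ?(ltW (om0 _)) ?(ltW La0)// -[leRHS]div1r.
have := La_ge i; lra.
Qed.

End Prolongation.

(** * Regularity of bounded solutions *)

Section Smoothness.
Context {R : realType} {n : nat} {B : finType}.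
Variables (th : B -> 'rV[R]_n -> 'rV[R]_n) (H : set 'rV[R]_n) (Cth : R).
Hypothesis bH : bounded_set H.
Hypothesis oH : open H.
Hypothesis Hth : forall j x, H x -> H (th j x).
Hypothesis cth : forall j, {within closure H, continuous (th j)}.
Hypothesis Cth0 : 0 <= Cth.
Hypothesis lip : forall w x y, H x -> H y ->
  `|thetaw th w x - thetaw th w y| <= Cth * `|x - y|.

Lemma C0bar_sums (I : finType) (A : B -> I -> I -> 'rV[R]_n -> R) (g : I -> 'rV[R]_n -> R) N :
  (forall j i i', C0bar H (A j i i')) -> (forall i, C0bar H (g i)) ->
  forall i, C0bar H (sums th A g N i).
Proof.
move=> cA cg; elim: N => [|N IH] i /=; first exact: C0bar_cst.
apply: C0barD => //; apply/CmBar0E; apply: CmBar_sum => // j; apply: CmBar_sum => // i'.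
apply/CmBar0E; apply: C0barM => //.
exact: (C0bar_comp oH (fun y => @Hth j y) (@cth j) (IH i')).
Qed.

Lemma C0bar_family_bounded (J : finType) (F : J -> 'rV[R]_n -> R) :
  (forall j, C0bar H (F j)) -> exists M, forall j x, H x -> `|F j x| <= M.
Proof.
move=> cF; have /choice[K KP] : forall j, exists K, 0 <= K /\ forall x, H x -> `|F j x| <= K.
  by move=> j; have [K K0 hK] := C0bar_bounded bH (cF j); exists K.
exists (\sum_j K j) => j x Hx; have [_ /(_ x Hx) h] := KP j.
by rewrite (le_trans h)// (bigD1 j)//= lerDl sumr_ge0// => l _; have [] := KP l.
Qed.

Lemma sys_solution_exists (I : finType) (A : B -> I -> I -> 'rV[R]_n -> R)
    (g : I -> 'rV[R]_n -> R) om k :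
  (forall j i i', C0bar H (A j i i')) -> (forall i, C0bar H (g i)) ->
  contracting th A H om k ->
  exists f : I -> 'rV[R]_n -> R,
    [/\ forall i, C0bar H (f i),
        forall i x, H x -> f i x = g i x + sys th A f i x &
        forall e, 0 < e -> \forall p \near \oo, forall i x, H x ->
          `|sums th A g (k * p) i x - f i x| <= e].
Proof.
move=> cA cg ck.
have [M1 h1] := C0bar_family_bounded cg.
have [M2 h2] := C0bar_family_bounded (C0bar_sums k cA cg).
have [||f [_ fE fU]] := @sys_neumann R n B I th A H Hth om k g (Num.max M1 M2) ck.
- by move=> i x Hx; rewrite le_max h1.
- by move=> i x Hx; rewrite le_max h2// orbT.
exists f; split => // i.
apply: (@C0bar_uniform_limit _ _ H (fun p => sums th A g (k * p) i)) => //.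
  by move=> N; exact: C0bar_sums.
by move=> e e0; have := fU e e0; apply: filterS => p hp x Hx; exact: hp.
Qed.

(* A solution and its partial derivatives solve the prolonged system, whose
   coefficients have one order of smoothness less, so boundedness bootstraps. *)
Lemma sys_smooth m (I : finType) (A : B -> I -> I -> 'rV[R]_n -> R)
    (g f : I -> 'rV[R]_n -> R) om k :
  (forall j c, CmBar m H (fun x => th j x 0 c)) ->
  (forall j i i', CmBar m H (A j i i')) -> (forall i, CmBar m H (g i)) ->
  contracting th A H om k ->
  (exists M, forall i x, H x -> `|f i x| <= M) ->
  (forall i x, H x -> f i x = g i x + sys th A f i x) ->
  forall i, CmBar m H (f i).
Proof.
elim: m I A g f om k => [|m IH] I A g f om k Cthm CA Cg ck [M fM] fE i.
  (* At order 0, uniqueness among bounded solutions identifies [f] with the Neumann solution, which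
     is continuous up to the boundary. *)
  have cA j i1 i2 : C0bar H (A j i1 i2) by exact: CmBar_C0bar (CA j i1 i2).
  have cg i1 : C0bar H (g i1) by exact: CmBar_C0bar (Cg i1).
  have [f0 [cf0 f0E _]] := sys_solution_exists cA cg ck.
  have [M0 hM0] := C0bar_family_bounded cf0.
  apply/CmBar0E; apply: C0bar_eq (cf0 i) => // x Hx; apply/esym.
  exact: (sys_unique Hth ck fM hM0 fE f0E).
have dthc j x : H x -> forall c, differentiable (fun y => th j y 0 c : R) x.
  by move=> Hx c; apply: CmBar_differentiable Hx; [|exact: Cthm].
have dA j i1 i2 x : H x -> differentiable (A j i1 i2) x.
  by move=> Hx; apply: CmBar_differentiable Hx; [|exact: CA].
have dg i1 x : H x -> differentiable (g i1) x.
  by move=> Hx; apply: CmBar_differentiable Hx; [|exact: Cg].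
have CpA j k1 k2 : CmBar m H (prolong_coef th A j k1 k2).
  case: k1 => [i1|[i1 a]]; case: k2 => [i2|[i2 c]] /=.
  - exact: CmBarW (CA _ _ _).
  - exact: CmBar_cst.
  - by have /CmBarSE[_ /(_ a)[]] := CA j i1 i2.
  - apply: CmBarM => //; first exact: CmBarW (CA _ _ _).
    by have /CmBarSE[_ /(_ a)[]] := Cthm j c.
have Cpg k1 : CmBar m H (prolong g k1).
  case: k1 => [i1|[i1 a]] /=; first exact: CmBarW (Cg _).
  by have /CmBarSE[_ /(_ a)[]] := Cg i1.
have cpA j k1 k2 : C0bar H (prolong_coef th A j k1 k2) by exact: CmBar_C0bar (CpA j k1 k2).
have cpg k1 : C0bar H (prolong g k1) by exact: CmBar_C0bar (Cpg k1).
have [E hE] := @C0bar_family_bounded (B * (I + I * 'I_n) * (I + I * 'I_n))%type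
  (fun t => prolong_coef th A t.1.1 t.1.2 t.2) (fun t => cpA _ _ _).
have [om' [k' ck']] := prolong_contracting oH Hth dthc ck Cth0 lip
  (ex_intro _ E (fun j i i' x Hx => hE (j, i, i') x Hx)).
have [F [cF FE FU]] := sys_solution_exists cpA cpg ck'.
have [MF hMF] := C0bar_family_bounded cF.
have CF := IH _ _ _ F _ _ (fun j c => CmBarW (Cthm j c)) CpA Cpg ck' (ex_intro _ MF hMF) FE.
have FinlE i1 x : H x -> F (inl i1) x = g i1 x + sys th A (fun i => F (inl i)) i1 x.
  move=> Hx; rewrite FE//=; congr (_ + _); apply: eq_bigr => j _.
  rewrite big_prolong/= [X in _ + X]big1 ?addr0// => l _.
  by rewrite big1// => e _; rewrite mul0r.
have fF x : H x -> F (inl i) x = f i x.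
  move=> Hx; apply/esym; apply: (sys_unique Hth ck fM _ fE FinlE) => //.
  by move=> i1 y Hy; exact: hMF.
apply: (CmBar_eq oH fF); apply/CmBarSE; split; first exact: cF.
move=> a.
have sp N := sums_prolong Hth dthc dA N dg.
(* The component [inr (i, a)] of [F] is so far only a solution of the prolonged system; it is a
   derivative because it is the uniform limit of the derivatives of the sums that converge to
   [F (inl i)]. *)
have lim := @pderiv_uniform_limit R n H a (fun p => sums th A g (k' * p) i) (F (inl i)) (F (inr (i, a))) oH.
have {}lim x : H x -> derivable (F (inl i)) x (ebasis a) /\ pderiv a (F (inl i)) x = F (inr (i, a)) x.
  apply: lim.
  - by move=> N y Hy; apply: diff_derivable; exact: (sp _).1.
  - move=> e e0; have := FU e e0; apply: filterS => p hp y Hy.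
    by have := hp (inl i) y Hy; rewrite -(sp _).2.
  - move=> e e0; have := FU e e0; apply: filterS => p hp y Hy.
    by have := hp (inr (i, a)) y Hy; rewrite -(sp _).2.
split=> [x Hx|]; first exact: (lim x Hx).1.
apply: (CmBar_eq oH _ (CF (inr (i, a)))) => x Hx; by rewrite (lim x Hx).2.
Qed.

End Smoothness.

(** * The positive eigenvalue as spectral radius *)

Section SpectralRadius.
Context {R : realType} {n : nat} {B : finType}.
Variables (b : B -> 'rV[R]_n -> R) (th : B -> 'rV[R]_n -> 'rV[R]_n).
Variables (H : set 'rV[R]_n) (Cth : R) (m : nat) (s : R).
Hypothesis bH : bounded_set H.
Hypothesis oH : open H.
Hypothesis H0 : H !=set0.
Hypothesis Hth : forall j x, H x -> H (th j x).
Hypothesis cth : forall j, {within closure H, continuous (th j)}.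
Hypothesis Cthm : forall j c, CmBar m H (fun x => th j x 0 c).
Hypothesis Cth0 : 0 <= Cth.
Hypothesis lip : forall w x y, H x -> H y ->
  `|thetaw th w x - thetaw th w y| <= Cth * `|x - y|.
Hypothesis Cb : forall j, CmBar m H (fun x => b j x `^ s).
Variables (h : 'rV[R]_n -> R) (lam c M : R).
Hypothesis c0 : 0 < c.
Hypothesis hcM : forall x, H x -> c <= h x <= M.
Hypothesis lam0 : 0 < lam.
Hypothesis hE : forall x, H x -> Lambda b th s h x = lam * h x.

Fixpoint bsw (w : seq B) (x : 'rV[R]_n) : R :=
  if w is j :: w' then b j x `^ s * bsw w' (th j x) else 1.

Let bsw_ge0 w x : 0 <= bsw w x.
Proof. by elim: w x => //= j w IH x; rewrite mulr_ge0// powR_ge0. Qed.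

Let h0 x : H x -> 0 < h x.
Proof. by move=> /hcM/andP[hx _]; exact: lt_le_trans hx. Qed.

Lemma wsum_bsw_eigen k x : H x ->
  wsum k (fun w => bsw w x * h (thetaw th w x)) = lam ^+ k * h x.
Proof.
elim: k x => [|k IH] x Hx /=; first by rewrite expr0 !mul1r.
rewrite exprSr -mulrA -hE// mulr_sumr; apply: eq_bigr => j _.
rewrite -(eq_wsum (fun w _ => mulrA _ _ _)) wsumZ IH; last exact: Hth.
by rewrite mulrCA.
Qed.

Lemma wsum_bsw_le k x : H x -> wsum k (fun w => bsw w x) <= M / c * lam ^+ k.
Proof.
move=> Hx; rewrite mulrAC ler_pdivlMr// mulrC.
apply: (@le_trans _ _ (lam ^+ k * h x)); last first.
  by rewrite mulrC ler_wpM2r ?exprn_ge0 ?(ltW lam0)//; have /andP[] := hcM Hx.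
rewrite -wsum_bsw_eigen// -wsumZ; apply: le_wsum => w _; rewrite mulrC ler_wpM2l//.
by have /andP[] := hcM (thetaw_maps Hth w Hx).
Qed.

(* A solution of Lambda u = lam u + 1 would satisfy
   u <= (K / c - k delta) h for every k. *)
Lemma eigenvalue_not_cbij : ~ cbij (Lambda b th s) (CmBar m H) H lam 0.
Proof.
move=> [_ surj].
have [u [v [Cu [_ uv]]]] := surj _ _ (CmBar_cst oH m (1 : R)) (CmBar_cst oH m 0).
have [K K0 uK] := C0bar_bounded bH (CmBar_C0bar Cu).
have [x1 Hx1] := H0.
have M0 : 0 < M by have /andP[h1 h2] := hcM Hx1; rewrite (lt_le_trans c0)// (le_trans h1).
pose delta := (lam * M)^-1.
have delta0 : 0 < delta by rewrite invr_gt0 mulr_gt0.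
have ind k x : H x -> u x <= (K / c - k%:R * delta) * h x.
  elim: k x => [|k IH] x Hx.
    rewrite mul0r subr0 (le_trans (ler_norm _))// (le_trans (uK x Hx))//.
    by rewrite mulrAC ler_pdivlMr// ler_wpM2l//; have /andP[] := hcM Hx.
  have [e _] := uv x Hx; rewrite mul0r addr0 in e.
  have L : Lambda b th s u x <= (K / c - k%:R * delta) * (lam * h x).
    rewrite -hE// /Lambda mulr_sumr; apply: ler_sum => j _.
    by rewrite mulrCA ler_wpM2l ?powR_ge0//; apply: IH; exact: Hth.
  rewrite -(ler_pM2l lam0).
  have d1 : lam * delta * h x <= 1.
    rewrite /delta invfM mulrA divff ?gt_eqF// mul1r mulrC ler_pdivrMr// mul1r.
    by have /andP[] := hcM Hx.
  have -> : lam * u x = Lambda b th s u x - 1 by rewrite -e; ring.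
  rewrite -natr1; lra.
have hx1 := h0 Hx1.
have dh : 0 < delta * h x1 by rewrite mulr_gt0.
set X := (K / c * h x1 - u x1) / (delta * h x1).
have := ind (Num.bound `|X|) x1 Hx1; move: (archi_boundP (normr_ge0 X)).
set N := Num.bound _ => /(le_lt_trans (ler_norm _)); rewrite /X.
rewrite ltr_pdivrMr// => h1 h2; lra.
Qed.

(** Division by a + i d turns the equation into f = G + (Lambda f) / (a + i d), a real system
    indexed by [bool] with [true] for the real part. Its k-th iterate is bounded by 2 (M / c) (lam /
    r)^k, where 2 counts the entries of a matrix row, so it contracts for large k. *)
Lemma resolvent_cbij (a d : R) : lam < Num.sqrt (a ^+ 2 + d ^+ 2) ->
  cbij (Lambda b th s) (CmBar m H) H a d.
Proof.
set rho := a ^+ 2 + d ^+ 2; set r := Num.sqrt rho => lr.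
have rho_ge0 : 0 <= rho by rewrite addr_ge0 ?sqr_ge0.
have r0 : 0 < r by exact: lt_trans lr.
have rho0 : 0 < rho by rewrite -sqrtr_gt0.
have r2 : r ^+ 2 = rho by rewrite sqr_sqrtr.
(* The real 2x2 matrix of the multiplication by 1 / (a + i d). *)
pose Z (i i' : bool) : R := if i == i' then a / rho else if i then d / rho else - d / rho.
pose A j i i' x := b j x `^ s * Z i i'.
(* Powers of (a + i d) / rho, the conjugate of 1 / (a + i d); the signs in [awE] account for the
   conjugation. *)
pose Zk k := iter k (fun t : R * R => (a / rho * t.1 - d / rho * t.2, a / rho * t.2 + d / rho * t.1)) (1, 0).
have awE w i i' x : aw th A w i i' x = bsw w x *
    (if i == i' then (Zk (size w)).1 else if i then (Zk (size w)).2 else - (Zk (size w)).2).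
  elim: w i i' x => [|j w IH] i i' x.
    by rewrite /= mul1r; case: i; case: i'; rewrite //= oppr0.
  rewrite [LHS]/= big_bool/= !IH /A /Z.
  rewrite -/(Zk (size w)); set t := Zk (size w).
  by case: i; case: i' => /=; ring.
have Zk2 k : (Zk k).1 ^+ 2 + (Zk k).2 ^+ 2 = (rho ^+ k)^-1.
  elim: k => [|k IH]; first by rewrite /= expr1n expr0n/= addr0 expr0 invr1.
  rewrite [in RHS]exprS [in RHS]invfM -IH /=; set t := Zk k; rewrite /rho; field.
  by rewrite -/rho gt_eqF.
have Zk_le k : `|(Zk k).1| <= r ^- k /\ `|(Zk k).2| <= r ^- k.
  have rk : 0 <= r ^- k by rewrite invr_ge0 exprn_ge0// ltW.
  have e : (r ^- k) ^+ 2 = (Zk k).1 ^+ 2 + (Zk k).2 ^+ 2.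
    by rewrite Zk2 exprVn -exprM mulnC exprM r2.
  split; rewrite -(ler_pXn2r (ltn0Sn 1)) ?nnegrE// e real_normK ?num_real//.
    by rewrite lerDl sqr_ge0.
  by rewrite lerDr sqr_ge0.
have [x1 Hx1] := H0.
have M0 : 0 < M by have /andP[h1 h2] := hcM Hx1; rewrite (lt_le_trans c0)// (le_trans h1).
have [k [k0 hk]] : exists k, (0 < k)%N /\ 2 * (M / c) * (lam / r) ^+ k <= 1 / 2.
  have lr01 : `|lam / r| < 1.
    by rewrite ger0_norm ?divr_ge0 ?ltW// ltr_pdivrMr// mul1r.
  have cv : 2 * (M / c) * (lam / r) ^+ k @[k --> \oo] --> 0.
    by rewrite -(mulr0 (2 * (M / c))); apply: cvgMl_tmp; exact: cvg_expr.
  have e0 : 0 < 1 / 2 :> R by lra.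
  have /cvgr0Pnorm_le/(_ _ e0)[p _ hp] := cv; exists p.+1; split => //.
  by rewrite (le_trans (ler_norm _))//; exact: hp (leqnSn p).
have ck : contracting th A H (fun=> 1) k.
  split=> // i x Hx; apply: (@le_trans _ _ (wsum k (fun w => 2 * r ^- k * bsw w x))).
    apply: le_wsum => w wk; rewrite big_bool/= !awE wk !mulr1 !normrM.
    rewrite (ger0_norm (bsw_ge0 w x)) -mulrDr mulrC ler_wpM2r//.
    rewrite mulr_natl mulr2n; have [z1 z2] := Zk_le k.
    by apply: lerD; case: i => //=; rewrite ?normrN.
  rewrite wsumZ (le_trans _ hk)//.
  rewrite (_ : 2 * (M / c) * _ = 2 * r ^- k * (M / c * lam ^+ k)); last by rewrite expr_div_n; ring.
  by rewrite ler_wpM2l ?wsum_bsw_le// mulr_ge0// invr_ge0 exprn_ge0// ltW.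
have CA j i1 i2 : CmBar m H (A j i1 i2) by apply: CmBarM => //; exact: CmBar_cst.
have sysE (f : bool -> 'rV[R]_n -> R) k1 x : sys th A f k1 x =
    Z k1 true * Lambda b th s (f true) x + Z k1 false * Lambda b th s (f false) x.
  rewrite /sys /Lambda !mulr_sumr -big_split/=; apply: eq_bigr => j _.
  by rewrite big_bool /A/=; ring.
have rhoN : a ^+ 2 + d ^+ 2 != 0 by rewrite gt_eqF.
split.
  move=> u v Cu Cv uv.
  pose f (i : bool) := if i then u else v.
  have [Ku _ hu] := C0bar_bounded bH (CmBar_C0bar Cu).
  have [Kv _ hv] := C0bar_bounded bH (CmBar_C0bar Cv).
  have f0 i x : H x -> f i x = 0.
    move=> Hx; apply: (@sys_unique R n B _ th A H Hth _ _ (fun _ _ => 0) f (fun _ _ => 0) (Num.max Ku Kv) 0 ck) => //.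
    - by move=> [] y Hy; rewrite le_max /f ?hu// hv// orbT.
    - by move=> _ y _; rewrite normr0.
    - move=> i' y Hy; rewrite sysE add0r /f.
      have [e1 e2] := uv y Hy.
      have -> : Lambda b th s u y = a * u y - d * v y by rewrite -[LHS]subr0 -e1; ring.
      have -> : Lambda b th s v y = a * v y + d * u y by rewrite -[LHS]subr0 -e2; ring.
      by case: i'; rewrite /Z/= /rho; field.
    - move=> i' y _; rewrite /sys add0r big1// => j _; rewrite big1// => l _; by rewrite mulr0.
  by move=> x Hx; split; [exact: (f0 true)|exact: (f0 false)].
move=> g1 g2 Cg1 Cg2.
(* (Lambda - (a + i d)) f = g means f = (Lambda f - g) / (a + i d), hence the sign. *)
pose G (i : bool) x := - (Z i true * g1 x + Z i false * g2 x).
have CG i : CmBar m H (G i).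
  have e x : H x -> -1 * (Z i true * g1 x + Z i false * g2 x) = G i x.
    by move=> _; rewrite mulN1r.
  apply: (CmBar_eq oH e); apply: CmBarM => //; first exact: CmBar_cst.
  by apply: CmBarD => //; apply: CmBarM => //; exact: CmBar_cst.
have [f [cf fE _]] := sys_solution_exists bH oH Hth cth
  (fun j i i' => CmBar_C0bar (CA j i i')) (fun i => CmBar_C0bar (CG i)) ck.
have Cf := sys_smooth bH oH Hth cth Cth0 lip Cthm CA CG ck (C0bar_family_bounded bH cf) fE.
exists (f true), (f false); split; first exact: Cf; split; first exact: Cf.
move=> x Hx; have := fE true x Hx; have := fE false x Hx; rewrite !sysE /G /Z/= => e1 e2.
set L1 := Lambda _ _ _ _ _; set L2 := Lambda _ _ _ _ _.
rewrite -/L1 -/L2 in e1 e2.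
split.
  by rewrite e1 e2 /rho; field.
by rewrite e1 e2 /rho; field.
Qed.

(** [lam] belongs to the set of moduli and bounds it from above, so the supremum is a maximum and no
    default value of [sup] intervenes. *)
Lemma spec_radius_eigenvalue : spec_radius (Lambda b th s) (CmBar m H) H = lam.
Proof.
rewrite /spec_radius; set S := [set r | _].
have Sub : ubound S lam.
  move=> _ [a [d [ncb ->]]]; rewrite leNgt; apply/negP => /resolvent_cbij; exact: ncb.
have Slam : S lam.
  exists lam, 0; split; first exact: eigenvalue_not_cbij.
  by rewrite expr0n/= addr0 sqrtr_sqr gtr0_norm.
apply/eqP; rewrite eq_le; apply/andP; split.
  by apply: ge_sup => //; exists lam.
by apply: ub_le_sup => //; exists lam.
Qed.

End SpectralRadius.

(** * Metrics contracted by every map *)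

Section NormEquivalence.
Context {R : realType} {n : nat}.
Variable N : 'rV[R]_n -> R.
Hypothesis normN : is_norm N.

Let N0 : N 0 = 0.
Proof. by have [_ [NZ _]] := normN; rewrite -(scale0r 0) NZ normr0 mul0r. Qed.

Let NN x : N (- x) = N x.
Proof. by have [_ [NZ _]] := normN; rewrite -scaleN1r NZ normrN1 mul1r. Qed.

Lemma is_norm_ge0 x : 0 <= N x.
Proof.
have [_ [_ /(_ x (- x))]] := normN; rewrite subrr N0 NN; lra.
Qed.

Lemma is_norm_gt0 x : x != 0 -> 0 < N x.
Proof.
move=> x0; rewrite lt_neqAle is_norm_ge0 andbT eq_sym; apply: contraNneq x0.
by have [h _] := normN; move=> /h ->.
Qed.

Lemma is_norm_le_norm : exists2 C, 0 < C & forall x, N x <= C * `|x|.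
Proof.
have [_ [NZ NT]] := normN.
have S0 : 0 <= \sum_(c < n) N (ebasis c) by apply: sumr_ge0 => c _; exact: is_norm_ge0.
exists (1 + \sum_(c < n) N (ebasis c)) => [|x]; first by rewrite ltr_pwDl.
apply: (@le_trans _ _ (\sum_(c < n) `|x 0 c| * N (ebasis c))).
  rewrite {1}(rv_sum_basis x); elim/big_ind2: _ => [|u r v t ur vt|c _].
  - by rewrite N0.
  - by rewrite (le_trans (NT _ _))// lerD.
  - by rewrite NZ.
rewrite mulrDl mul1r ler_wpDl// mulr_suml; apply: ler_sum => c _.
by rewrite mulrC ler_wpM2l ?is_norm_ge0// rv_coord_le_norm.
Qed.

Lemma is_norm_continuous : continuous N.
Proof.
have [_ [_ NT]] := normN; have [C C0 NC] := is_norm_le_norm.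
move=> x U /nbhs_ballP[e /= e0 eU]; apply/nbhs_ballP.
exists (e / C) => /= [|y]; first by rewrite divr_gt0.
rewrite -ball_normE /ball_/= => xy; apply: eU; rewrite -ball_normE /ball_/=.
have h u v : N u - N v <= C * `|u - v|.
  by rewrite (le_trans _ (NC _))// lerBlDr -[in leLHS](subrK v u) NT.
apply: (@le_lt_trans _ _ (C * `|x - y|)).
  by rewrite ler_norml h andbT lerNl opprB distrC h.
by rewrite mulrC -ltr_pdivlMr.
Qed.

Lemma norm_le_is_norm : exists2 C, 0 < C & forall x, `|x| <= C * N x.
Proof.
have [_ [NZ _]] := normN.
pose S := [set x : 'rV[R]_n | `|x| = 1].
have unit x : x != 0 -> S (`|x|^-1 *: x).
  by move=> x0; rewrite /S/= normrZ normfV normr_id mulVf// normr_eq0.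
(* The unit sphere is empty when n = 0; then every vector is 0. *)
have [S0|nS] := pselect (S !=set0); last first.
  exists 1 => // x; have [->|x0] := eqVneq x 0; first by rewrite normr0 N0 mulr0.
  by exfalso; apply: nS; exists (`|x|^-1 *: x); exact: unit.
have cS : compact S.
  apply: bounded_closed_compact.
    by exists 1; split=> // M M1 x /= ->; exact: ltW.
  have -> : S = (fun x : 'rV[R]_n => `|x|) @^-1` [set 1] by [].
  apply: preimage_closed; first by move=> x _; exact: (@norm_continuous R _ x).
  exact: closed_eq.
have [x0 /set_mem x0S x0P] := compact_EVT_min S0 cS (continuous_subspaceT is_norm_continuous).
have Nx0 : 0 < N x0.
  apply: is_norm_gt0; rewrite -normr_eq0.
  by rewrite (x0S : `|x0| = 1) oner_eq0.
exists (N x0)^-1 => [|x]; first by rewrite invr_gt0.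
have [->|xn0] := eqVneq x 0; first by rewrite normr0 N0 mulr0.
have := x0P _ (mem_set (unit x xn0)); rewrite NZ normfV normr_id.
by rewrite ler_pdivlMl ?normr_gt0// ler_pdivlMl// mulrC.
Qed.

End NormEquivalence.

Section AdaptedMetric.
Context {R : realType} {n : nat} {B : finType}.
Variables (th : B -> 'rV[R]_n -> 'rV[R]_n) (H : set 'rV[R]_n).
Hypothesis Hth : forall j x, H x -> H (th j x).

(** Words are cut into blocks of [mu] letters, each contracting [N] by k' = q^mu. A word shorter
    than [mu] expands by at most K^mu, which is at most [C0] q^length because q^length >= k'.
    Equivalence of norms transfers the bound. *)
Lemma geometric_contraction (N : 'rV[R]_n -> R) (L kappa : R) (mu : nat) :
  is_norm N -> (0 < mu)%N -> kappa < 1 ->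
  (forall j x y, H x -> H y -> `|th j x - th j y| <= L * `|x - y|) ->
  (forall w, size w = mu -> forall x y, H x -> H y ->
    N (thetaw th w x - thetaw th w y) <= kappa * N (x - y)) ->
  exists C q, [/\ 0 <= C, 0 < q < 1 & forall w x y, H x -> H y ->
    `|thetaw th w x - thetaw th w y| <= C * q ^+ size w * `|x - y|].
Proof.
move=> normN mu0 k1 thL thk.
have [C1 C10 NC1] := is_norm_le_norm normN.
have [C2 C20 NC2] := norm_le_is_norm normN.
have N0 := is_norm_ge0 normN.
(* [kappa] may be zero or negative, so it is raised to a positive number before its root of order
   [mu] is taken. *)
have [k' [k'0 k'1 kk']] : exists k', [/\ 0 < k', k' < 1 & kappa <= k'].
  by exists (Num.max kappa (1 / 2)); rewrite lt_max gt_max le_max lexx k1; split => //; lra.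
pose q := k' `^ (mu%:R^-1).
have q0 : 0 < q by rewrite powR_gt0.
have qmu : q ^+ mu = k'.
  rewrite -powR_mulrn ?powR_ge0// -powRrM mulVf ?powRr1 ?(ltW k'0)//.
  by rewrite pnatr_eq0 -lt0n.
have q1 : q < 1.
  by rewrite -(@expr_lt1 _ mu) ?qmu// ltW.
pose K := 1 + `|C1 * (L * C2)|.
have K1 : 1 <= K by rewrite lerDl.
have K0 : 0 <= K by exact: le_trans K1.
have thK w x y : H x -> H y ->
    N (thetaw th w x - thetaw th w y) <= K ^+ size w * N (x - y).
  elim: w x y => [|j w IH] x y Hx Hy /=; first by rewrite expr0 mul1r.
  rewrite (le_trans (IH _ _ (Hth _ Hx) (Hth _ Hy)))// exprSr -mulrA.
  rewrite ler_wpM2l ?exprn_ge0//.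
  apply: (@le_trans _ _ (`|C1 * (L * C2)| * N (x - y))); last first.
    by rewrite /K mulrDl mul1r lerDr.
  rewrite (le_trans (NC1 _))// normrM (gtr0_norm C10) -mulrA ler_wpM2l ?(ltW C10)//.
  rewrite (le_trans (thL _ _ _ Hx Hy))// normrM (gtr0_norm C20) -mulrA.
  rewrite (le_trans (ler_wpM2r (normr_ge0 _) (ler_norm L)))//.
  by rewrite ler_wpM2l.
have [C0 C0E] : exists C0, C0 = K ^+ mu / k' by exists (K ^+ mu / k').
have C00 : 0 <= C0 by rewrite C0E divr_ge0 ?exprn_ge0// ltW.
have key p w x y : (size w < p)%N -> H x -> H y ->
    N (thetaw th w x - thetaw th w y) <= C0 * q ^+ size w * N (x - y).
  elim: p w x y => [//|p IH] w x y wp Hx Hy.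
  have [wmu|muw] := ltnP (size w) mu.
    rewrite (le_trans (thK w x y Hx Hy))// ler_wpM2r// C0E mulrAC ler_pdivlMr// -qmu.
    rewrite ler_pM ?exprn_ge0 ?(ltW q0)//; first exact: ler_weXn2l (ltnW wmu).
    by apply: ler_wiXn2l; rewrite ?(ltW q0) ?(ltW q1)// ltnW.
  have st : size (take mu w) = mu by rewrite size_takel.
  rewrite -{1 2}(cat_take_drop mu w) !thetaw_cat.
  rewrite (le_trans (IH _ _ _ _ (thetaw_maps Hth _ Hx) (thetaw_maps Hth _ Hy)))//.
    by rewrite size_drop (leq_trans _ (wp : size w <= p)%N)// ltn_subrL mu0 (leq_trans mu0 muw).
  rewrite size_drop -!mulrA ler_wpM2l//.
  rewrite -{2}(subnK muw) exprD qmu -!mulrA ler_wpM2l ?exprn_ge0 ?(ltW q0)//.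
  by rewrite (le_trans (thk _ st _ _ Hx Hy))// ler_wpM2r.
exists (C2 * (C0 * C1)), q; split; first by rewrite !mulr_ge0// ltW.
  by rewrite q0.
move=> w x y Hx Hy; rewrite (le_trans (NC2 _))// -!mulrA ler_wpM2l ?(ltW C20)//.
rewrite (le_trans (key _ _ _ _ (ltnSn _) Hx Hy))// -mulrA ler_wpM2l//.
by rewrite mulrCA ler_wpM2l ?exprn_ge0 ?(ltW q0).
Qed.

Variables (C q : R).
Hypothesis q01 : 0 < q < 1.
Hypothesis thC : forall w x y, H x -> H y ->
  `|thetaw th w x - thetaw th w y| <= C * q ^+ size w * `|x - y|.

(* In this equivalent metric each map is a contraction, not only long compositions. *)
Definition adapted_metric (x y : 'rV[R]_n) : R :=
  sup (range (fun w => q ^- size w * `|thetaw th w x - thetaw th w y|)).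

Let q0 : 0 < q. Proof. by case/andP: q01. Qed.

Let ub x y w : H x -> H y ->
  q ^- size w * `|thetaw th w x - thetaw th w y| <= C * `|x - y|.
Proof.
move=> Hx Hy; rewrite mulrC ler_pdivrMr ?exprn_gt0// mulrAC; exact: thC.
Qed.

Let hs x y : H x -> H y ->
  has_sup (range (fun w => q ^- size w * `|thetaw th w x - thetaw th w y|)).
Proof.
move=> Hx Hy; split; first by exists (1^-1 * `|x - y|), [::].
by exists (C * `|x - y|) => _ [w _ <-]; exact: ub.
Qed.

Lemma adapted_metric_le x y : H x -> H y -> adapted_metric x y <= C * `|x - y|.
Proof.
move=> Hx Hy; apply: ge_sup; first exact: (hs Hx Hy).1.
by move=> _ [w _ <-]; exact: ub.
Qed.

Lemma le_adapted_metric x y : H x -> H y -> `|x - y| <= adapted_metric x y.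
Proof.
move=> Hx Hy; apply: ub_le_sup; first exact: (hs Hx Hy).2.
by exists [::] => //=; rewrite invr1 mul1r.
Qed.

Lemma adapted_metricC x y : adapted_metric x y = adapted_metric y x.
Proof. by congr sup; apply: eq_imagel => w _; rewrite distrC. Qed.

Lemma adapted_metric_contraction j x y : H x -> H y ->
  adapted_metric (th j x) (th j y) <= q * adapted_metric x y.
Proof.
move=> Hx Hy; apply: ge_sup; first exact: (hs (Hth _ Hx) (Hth _ Hy)).1.
move=> _ [w _ <-].
rewrite -ler_pdivrMl// mulrA -invfM -exprS.
by apply: ub_le_sup; [exact: (hs Hx Hy).2|exists (j :: w)].
Qed.

End AdaptedMetric.

(** * Dependence of the spectral radius on the exponent *)

Section PowerWeights.
Context {R : realType} {n : nat} {B : finType}.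
Variables (b : B -> 'rV[R]_n -> R) (th : B -> 'rV[R]_n -> 'rV[R]_n) (H : set 'rV[R]_n).
Hypothesis bH : bounded_set H.
Hypothesis H0 : H !=set0.
Hypothesis Hth : forall j x, H x -> H (th j x).
Hypothesis cth : forall j, {within closure H, continuous (th j)}.
Hypothesis cb : forall j, {within closure H, continuous (b j)}.
Hypothesis b0 : forall j x, closure H x -> 0 < b j x.

Lemma positive_lower_bound (f : 'rV[R]_n -> R) :
  {within closure H, continuous f} -> (forall x, closure H x -> 0 < f x) ->
  exists2 delta, 0 < delta & forall x, closure H x -> delta <= f x.
Proof.
move=> cf f0.
have cH0 : closure H !=set0 by have [x Hx] := H0; exists x; exact: subset_closure.
have [x /set_mem Hx xP] := compact_EVT_min cH0 (bounded_closure_compact bH) cf.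
by exists (f x) => [|y Hy]; [exact: f0|apply: xP; exact: mem_set].
Qed.

Lemma bw_within_continuous w : {within closure H, continuous (bw b th w)}.
Proof.
elim: w => [|j w IH] /=; first by move=> x; exact: cvg_cst.
have cw := within_closure_comp (@Hth j) (@cth j) IH.
by move=> x; apply: (@continuousM R (subspace (closure H)) (b j) (bw b th w \o th j)); [exact: cb|exact: cw].
Qed.

Lemma bw_gt0 w x : H x -> 0 < bw b th w x.
Proof.
elim: w x => [|j w IH] x Hx //=; rewrite mulr_gt0 ?b0 ?IH//; last exact: Hth.
exact: subset_closure.
Qed.

Lemma bsw_bw s w x : H x -> bsw b th s w x = bw b th w x `^ s.
Proof.
elim: w x => [|j w IH] x Hx /=; first by rewrite powR1.
have Hj := @Hth j x Hx.
rewrite IH// powRM// ltW//; last exact: bw_gt0.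
by apply: b0; exact: subset_closure.
Qed.

Lemma bw_uniform_lt1 k : (forall w, size w = k -> forall x, closure H x -> bw b th w x < 1) ->
  exists2 rho, 0 < rho < 1 & forall w, size w = k -> forall x, H x -> bw b th w x <= rho.
Proof.
move=> b1.
have /choice[delta deltaP] : forall w : k.-tuple B, exists delta, 0 < delta /\
    forall x, closure H x -> delta <= 1 - bw b th w x.
  move=> w.
  have [|x Hx|delta d0 dP] := @positive_lower_bound (fun x => 1 - bw b th w x).
  - apply/subspace_continuousP => x Hx; apply: cvgB; first exact: cvg_cst.
    by have /subspace_continuousP/(_ x Hx) := @bw_within_continuous w.
  - by rewrite subr_gt0 b1// size_tuple.
  - by exists delta.
(* There are finitely many words, and the initial value 1/2 keeps the maximum positive. *)
exists (\big[Num.max/(1 / 2)]_(w : k.-tuple B) (1 - delta w)).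
  apply/andP; split.
    by apply: lt_le_trans (bigmax_ge_id _ _ _ _); lra.
  elim/big_ind: _ => [|u v hu hv|w _]; first by lra.
    by rewrite gt_max hu.
  by have [h _] := deltaP w; lra.
move=> w wk x Hx; have /eqP sw := wk.
apply: le_trans (le_bigmax _ _ (Tuple sw)).
have [_ /(_ x (subset_closure Hx))] := deltaP (Tuple sw); rewrite /=; lra.
Qed.

Section Comparison.
Variables (s t lam1 lam2 c1 M1 c2 M2 rho : R) (h1 h2 : 'rV[R]_n -> R) (k : nat).
Hypothesis st : s <= t.
Hypothesis rho01 : 0 < rho < 1.
Hypothesis bwrho : forall w, size w = k -> forall x, H x -> bw b th w x <= rho.
Hypotheses (lam10 : 0 < lam1) (lam20 : 0 < lam2) (c10 : 0 < c1) (c20 : 0 < c2).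
Hypothesis h1P : forall x, H x -> c1 <= h1 x <= M1.
Hypothesis h2P : forall x, H x -> c2 <= h2 x <= M2.
Hypothesis h1E : forall x, H x -> Lambda b th s h1 x = lam1 * h1 x.
Hypothesis h2E : forall x, H x -> Lambda b th t h2 x = lam2 * h2 x.

(** For words w of length k, b_w^t <= rho^(t-s) b_w^s. Hence h2 <= D h1 implies h2 <= D (E / A) h1,
    where [A] and [E] are the two sides of the claim; if E < A, iteration would force h2 <= 0. *)
Lemma eigenvalue_comparison : lam2 ^+ k <= rho `^ (t - s) * lam1 ^+ k.
Proof.
have [x0 Hx0] := H0.
have M20 : 0 < M2 by have /andP[l1 l2] := h2P Hx0; rewrite (lt_le_trans c20)// (le_trans l1).
have h10 x : H x -> 0 < h1 x by move=> /h1P/andP[l1 _]; exact: lt_le_trans l1.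
have h20 x : H x -> 0 < h2 x by move=> /h2P/andP[l1 _]; exact: lt_le_trans l1.
have /andP[rho0 rho1] := rho01.
set A := lam2 ^+ k; set E := _ * _.
have A0 : 0 < A by rewrite exprn_gt0.
have E0 : 0 < E by rewrite mulr_gt0 ?powR_gt0 ?exprn_gt0.
rewrite leNgt; apply/negP => EA.
have step D : 0 <= D -> (forall x, H x -> h2 x <= D * h1 x) ->
    forall x, H x -> h2 x <= D * (E / A) * h1 x.
  move=> D0 hD x Hx.
  rewrite mulrA mulrAC ler_pdivlMr// mulrC /A -(wsum_bsw_eigen Hth h2E k Hx).
  rewrite /E -!mulrA -(wsum_bsw_eigen Hth h1E k Hx) -!wsumZ; apply: le_wsum => w wk.
  rewrite !bsw_bw// -{1}(subrK s t) [in leLHS]powRD; last by rewrite (gt_eqF (bw_gt0 w Hx)) implybT.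
  have Hw := thetaw_maps Hth w Hx.
  have -> : D * (rho `^ (t - s) * (bw b th w x `^ s * h1 (thetaw th w x))) =
    rho `^ (t - s) * bw b th w x `^ s * (D * h1 (thetaw th w x)) by ring.
  apply: ler_pM; rewrite ?mulr_ge0 ?powR_ge0 ?(ltW (h20 _ Hw)) ?hD//.
  rewrite ler_wpM2r ?powR_ge0// ge0_ler_powR ?subr_ge0 ?nnegrE ?(ltW (bw_gt0 w Hx)) ?(ltW rho0)//.
  exact: bwrho.
have iter p x : H x -> h2 x <= M2 / c1 * (E / A) ^+ p * h1 x.
  elim: p x => [|p IH] x Hx.
    rewrite expr0 mulr1 mulrAC ler_pdivlMr// ler_pM ?(ltW c10) ?(ltW (h20 _ Hx))//.
      by have /andP[] := h2P Hx.
    by have /andP[] := h1P Hx.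
  rewrite exprSr mulrA; apply: step => //.
  by rewrite mulr_ge0 ?exprn_ge0 ?divr_ge0// ltW.
have EA1 : `|E / A| < 1.
  by rewrite ger0_norm ?divr_ge0 ?ltW// ltr_pdivrMr// mul1r.
have cv : M2 / c1 * (E / A) ^+ p * h1 x0 @[p --> \oo] --> M2 / c1 * 0 * h1 x0.
  by apply: cvgMr_tmp; apply: cvgMl_tmp; exact: cvg_expr.
have : h2 x0 <= M2 / c1 * 0 * h1 x0.
  by apply: (cvgr_to_ge cv); apply: nearW => p; exact: iter.
by rewrite mulr0 mul0r leNgt h20.
Qed.

End Comparison.

End PowerWeights.

Section SpectralRadiusFamily.
Context {R : realType} {n : nat} {B : finType}.
Variables (b : B -> 'rV[R]_n -> R) (th : B -> 'rV[R]_n -> 'rV[R]_n) (H : set 'rV[R]_n).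
Variables (m : nat) (C q : R).
Hypothesis bH : bounded_set H.
Hypothesis oH : open H.
Hypothesis H0 : H !=set0.
Hypothesis rH : mildly_regular H.
Hypothesis B0 : (0 < #|B|)%N.
Hypothesis Hth : forall j x, H x -> H (th j x).
Hypothesis cth : forall j, {within closure H, continuous (th j)}.
Hypothesis Cthm : forall j c, CmBar m.+1 H (fun x => th j x 0 c).
Hypothesis cb : forall j, {within closure H, continuous (b j)}.
Hypothesis b0 : forall j x, closure H x -> 0 < b j x.
Hypothesis Cb : forall j, CmBar m.+1 H (b j).
Hypothesis C_ge0 : 0 <= C.
Hypothesis q01 : 0 < q < 1.
Hypothesis thC : forall w x y, H x -> H y ->
  `|thetaw th w x - thetaw th w y| <= C * q ^+ size w * `|x - y|.

Let r s := spec_radius (Lambda b th s) (CmBar m.+1 H) H.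

Let b0H j x : H x -> 0 < b j x.
Proof. by move=> Hx; apply: b0; exact: subset_closure. Qed.

(** The inequality ln (1 + z) <= z bounds the logarithm of the quotient, and the denominator is
    bounded below because [b j] is positive on the compact closure. *)
Lemma ln_weight_lipschitz : exists2 K, 0 <= K & forall j x y, H x -> H y ->
  `|ln (b j x) - ln (b j y)| <= K * `|x - y|.
Proof.
have /choice[K KP] : forall j, exists K, 0 <= K /\ forall x y, H x -> H y ->
    `|ln (b j x) - ln (b j y)| <= K * `|x - y|.
  move=> j; have [K K0 bK] := mildly_regular_lipschitz bH oH rH (Cb j).
  have [delta d0 bd] := positive_lower_bound bH H0 (@cb j) (@b0 j).
  exists (K / delta); split=> [|x y Hx Hy]; first by rewrite divr_ge0// ltW.
  have half u v : H u -> H v -> ln (b j u) - ln (b j v) <= K / delta * `|u - v|.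
    move=> Hu Hv; have bv := b0H j Hv.
    rewrite -ln_div ?posrE ?b0H//.
    have -> : b j u / b j v = 1 + (b j u - b j v) / b j v by field; rewrite gt_eqF.
    rewrite (le_trans (le_ln1Dx _))//.
      by rewrite mulrBl divff ?gt_eqF// ltrBrDl subrr divr_gt0// b0H.
    rewrite ler_pdivrMr// (le_trans (ler_norm _))// (le_trans (bK _ _ Hu Hv))//.
    have -> : K / delta * `|u - v| * b j v = K * `|u - v| * (b j v / delta) by ring.
    rewrite ler_peMr ?mulr_ge0// ler_pdivlMr// mul1r.
    by apply: bd; exact: subset_closure.
  by rewrite ler_norml half// andbT lerNl opprB distrC half.
exists (\sum_j K j) => [|j x y Hx Hy]; first by apply: sumr_ge0 => j _; have [] := KP j.
have [Kj /(_ x y Hx Hy) h] := KP j; rewrite (le_trans h)// ler_wpM2r//.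
by rewrite (bigD1 j)//= lerDl sumr_ge0// => l _; have [] := KP l.
Qed.

(** The results on transfer operators concern maps of a whole type into itself, hence the subtype of
    the points of [H]. *)
Let X := {x : 'rV[R]_n | H x}.
Let thX (j : B) (x : X) : X := exist _ (th j (sval x)) (Hth j (svalP x)).
Let aX (j : B) (x : X) : R := ln (b j (sval x)).

(** Whatever its origin, a positive eigenpair on the subtype determines [r s]; hence the sum of the
    power series of [eigenvalue_analytic] is [r s] itself. The eigenfunction is extended by 0, which
    is harmless since the maps preserve [H]. *)
Lemma spec_radius_positive_eigenpair s lam : positive_eigenpair aX thX s lam ->
  exists (h : 'rV[R]_n -> R) (c M : R), [/\ 0 < c, 0 < lam,
    forall x, H x -> c <= h x <= M,
    forall x, H x -> Lambda b th s h x = lam * h x & r s = lam].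
Proof.
move=> [h [c [M [c0 hcM hE]]]].
pose h' x := if pselect (H x) is left Hx then h (exist _ x Hx) else 0.
have h'E (x : X) : h' (sval x) = h x.
  case: x => x Hx; rewrite /h'/=; case: pselect => // Hx'.
  by congr (h (exist _ _ _)); exact: Prop_irrelevance.
have h'P x : H x -> c <= h' x <= M by move=> Hx; rewrite (h'E (exist _ x Hx)).
have LE x : H x -> Lambda b th s h' x = lam * h' x.
  move=> Hx; rewrite (h'E (exist _ x Hx)) -(congr1 (fun f => f (exist _ x Hx)) hE).
  rewrite /Lambda /transfer; apply: eq_bigr => j _.
  by rewrite -h'E/= /exp_weight /aX /= /powR gt_eqF ?b0H.
have [x0 Hx0] := H0; have /card_gt0P[j0 _] := B0.
have h'0 x : H x -> 0 < h' x by move=> /h'P/andP[l _]; exact: lt_le_trans l.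
have lam0 : 0 < lam.
  rewrite -(pmulr_lgt0 _ (h'0 _ Hx0)) -LE// /Lambda (bigD1 j0)//=.
  rewrite ltr_pwDl ?mulr_gt0 ?powR_gt0 ?b0H ?h'0//; first exact: Hth.
  by apply: sumr_ge0 => j _; rewrite mulr_ge0 ?powR_ge0// ltW// h'0//; exact: Hth.
exists h', c, M; split => //.
apply: (@spec_radius_eigenvalue R n B b th H C m.+1 s bH oH H0 Hth cth Cthm C_ge0 _ _ h' lam c M) => //.
  move=> w x y Hx Hy; rewrite (le_trans (thC w Hx Hy))// ler_wpM2r// ler_piMr//.
  by have /andP[q0 q1] := q01; rewrite exprn_ile1// ltW.
by move=> j; exact: (CmBar_powR oH s (@cb j) (@b0 j) (Cb j)).
Qed.

Lemma adapted_data : exists (D K Aa : R) (x0 : X) (j0 : B), let d x y := adapted_metric th q (sval x) (sval y) in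
  [/\ 0 <= K, forall x y : X, 0 <= d x y <= D, forall x y : X, d x y = d y x,
      forall j (x y : X), d (thX j x) (thX j y) <= q * d x y &
      (forall j (x : X), `|aX j x| <= Aa) /\ forall j, dlipschitz d (aX j) K].
Proof.
have [x0 Hx0] := H0; have /card_gt0P[j0 _] := B0.
have [K K0 aK] := ln_weight_lipschitz.
have [M [Mr HM]] := bH.
pose M' := `|M| + 1.
have HM' x : H x -> `|x| <= M'.
  by move=> Hx; apply: HM => //; rewrite (le_lt_trans (ler_norm _))// ltrDl.
pose D := C * (M' + M').
have xyM x y : H x -> H y -> `|x - y| <= M' + M'.
  by move=> Hx Hy; rewrite (le_trans (ler_normB _ _))// lerD// HM'.
exists D, K, (\sum_j `|ln (b j x0)| + K * (M' + M')), (exist _ x0 Hx0), j0 => d; split => //.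
- move=> [x Hx] [y Hy]; rewrite /d/=; apply/andP; split.
    exact: le_trans (normr_ge0 _) (le_adapted_metric q01 thC Hx Hy).
  by rewrite (le_trans (adapted_metric_le q01 thC Hx Hy))// ler_wpM2l// xyM.
- by move=> x y; exact: adapted_metricC.
- by move=> j [x Hx] [y Hy]; exact: (adapted_metric_contraction Hth q01 thC).
split=> [j [x Hx]|j [x Hx] [y Hy]]; rewrite /aX/=.
  rewrite -[ln _](subrK (ln (b j x0))) (le_trans (ler_normD _ _))// addrC lerD//.
    by rewrite (bigD1 j)//= lerDl sumr_ge0.
  by rewrite (le_trans (aK _ _ _ Hx Hx0))// ler_wpM2l// xyM.
rewrite (le_trans (aK _ _ _ Hx Hy))// ler_wpM2l//.
by have := le_adapted_metric q01 thC Hx Hy.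
Qed.

Lemma spec_radius_eigenfunction s :
  exists (h : 'rV[R]_n -> R) (c M : R), [/\ 0 < c, 0 < r s,
    forall x, H x -> c <= h x <= M &
    forall x, H x -> Lambda b th s h x = r s * h x].
Proof.
have [D [K [Aa [x0 [j0 [K0 dD dC dth [aA aK]]]]]]] := adapted_data.
have q01' : 0 <= q < 1 by case/andP: q01 => q0 ->; rewrite ltW.
have [lam lam0 /spec_radius_positive_eigenpair] :=
  exists_positive_eigenpair x0 j0 q01' K0 dD dth aK s.
by move=> [h [c [M [c0 _ hP hE ->]]]]; exists h, c, M.
Qed.

Lemma spec_radius_analytic : real_analytic r.
Proof.
move=> s0.
have [D [K [Aa [x0 [j0 [K0 dD dC dth [aA aK]]]]]]] := adapted_data.
have q01' : 0 <= q < 1 by case/andP: q01 => q0 ->; rewrite ltW.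
have [rho [c [rho0 rhoP]]] := eigenvalue_analytic x0 j0 q01' K0 dD dC dth aA aK s0.
exists rho, c; split => // s /rhoP[lam [cl /spec_radius_positive_eigenpair]].
by move=> [h [c1 [M [_ _ _ _ ->]]]].
Qed.

Variable k : nat.
Hypothesis k0 : (0 < k)%N.
Hypothesis b1 : forall w, size w = k -> forall x, closure H x -> bw b th w x < 1.

Lemma spec_radius_decay : exists2 rho, 0 < rho < 1 &
  forall s t, s <= t -> r t ^+ k <= rho `^ (t - s) * r s ^+ k.
Proof.
have [rho rho01 bwrho] := bw_uniform_lt1 bH H0 Hth cth cb b1.
exists rho => // s t st.
have [h1 [c1 [M1 [c10 lam10 h1P h1E]]]] := spec_radius_eigenfunction s.
have [h2 [c2 [M2 [c20 lam20 h2P h2E]]]] := spec_radius_eigenfunction t.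
exact: (eigenvalue_comparison H0 Hth b0 st rho01 bwrho lam10 lam20 c10 c20 h1P h2P h1E h2E).
Qed.

Let r0 s : 0 < r s.
Proof. by have [h [c [M []]]] := spec_radius_eigenfunction s. Qed.

Lemma spec_radius_decreasing s t : s < t -> r t < r s.
Proof.
move=> st; have [rho /andP[rho0 rho1] dec] := spec_radius_decay.
rewrite -(@ltr_pXn2r _ k) ?nnegrE ?ltW//.
apply: le_lt_trans (dec s t (ltW st)) _.
rewrite gtr_pMl ?exprn_gt0//; have <- : (1 : R) `^ (t - s) = 1 by rewrite powR1.
by rewrite gt0_ltr_powR ?subr_gt0 ?nnegrE// ltW.
Qed.

Lemma spec_radius_cvg0 : r s @[s --> +oo] --> 0.
Proof.
have [rho /andP[rho0 rho1] dec] := spec_radius_decay.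
have l0 : 0 < - ln rho by rewrite oppr_gt0 ln_lt0// rho0.
apply/cvgrPdist_lt => e e0.
have L0 : 0 < r 0 ^+ k by rewrite exprn_gt0.
have ek : 0 < e ^+ k by rewrite exprn_gt0.
near=> s.
have s0 : 0 < s by near: s; exact: nbhs_pinfty_gt.
rewrite sub0r normrN gtr0_norm// -(@ltr_pXn2r _ k) ?nnegrE ?ltW//.
have := dec 0 s (ltW s0); rewrite subr0 => /le_lt_trans; apply.
have u0 : 0 < s * - ln rho by rewrite mulr_gt0.
rewrite /powR gt_eqF// -[s * _]opprK -mulrN expRN.
rewrite mulrC ltr_pdivrMr ?expR_gt0// -ltr_pdivrMl//.
apply: lt_le_trans (expR_ge1Dx _); rewrite ltr_wpDl// -ltr_pdivrMr//.
by near: s; apply: nbhs_pinfty_gt; exact: num_real.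
Unshelve. all: by end_near. Qed.

End SpectralRadiusFamily.

(** If [H] or [B] were empty, the spectral radius would be identically 0 and not strictly
    decreasing. The values of [b] and [theta] on the closure are those of the continuous extensions,
    to which the conditions on the closure refer. *)
Theorem theorem9p2 (R : realType) (n m : nat) (B : finType)
  (H : set 'rV[R]_n) (b : B -> 'rV[R]_n -> R)
  (theta : B -> 'rV[R]_n -> 'rV[R]_n) :
  bounded_set H -> open H -> H !=set0 -> mildly_regular H ->
  (1 <= m)%N -> (0 < #|B|)%N ->
  (forall j : B, CmBar m H (b j) /\ {within closure H, continuous (b j)} /\
     forall x, closure H x -> 0 < b j x) ->
  (forall j : B, (forall x, H x -> H (theta j x)) /\
     {within closure H, continuous (theta j)} /\
     forall i : 'I_n, CmBar m H (fun x => theta j x 0 i)) ->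
  (exists N : 'rV[R]_n -> R, is_norm N /\
     exists (mu : nat) (kappa : R), (1 <= mu)%N /\ kappa < 1 /\
       forall w : seq B, size w = mu -> forall x y, H x -> H y ->
         N (thetaw theta w x - thetaw theta w y) <= kappa * N (x - y)) ->
  (exists mu' : nat, (1 <= mu')%N /\
     forall w : seq B, size w = mu' -> forall x, closure H x ->
       bw b theta w x < 1) ->
  (forall s t : R, s < t ->
     spec_radius (Lambda b theta t) (CmBar m H) H
       < spec_radius (Lambda b theta s) (CmBar m H) H) /\
  real_analytic (fun s => spec_radius (Lambda b theta s) (CmBar m H) H) /\
  (spec_radius (Lambda b theta s) (CmBar m H) H @[s --> +oo] --> 0).
Proof.
move=> bH oH H0 rH; case: m => // m _ B0 hb hth [N [normN [mu [kappa [mu0 [k1 thk]]]]]] [k [k0 b1]].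
have Hth j x : H x -> H (theta j x) by have [h _] := hth j; exact: h.
have cth j : {within closure H, continuous (theta j)} by have [_ []] := hth j.
have Cthm j c : CmBar m.+1 H (fun x => theta j x 0 c) by have [_ [_]] := hth j; exact.
have Cb j : CmBar m.+1 H (b j) by have [] := hb j.
have cb j : {within closure H, continuous (b j)} by have [_ []] := hb j.
have b0 j x : closure H x -> 0 < b j x by have [_ [_ h]] := hb j; exact: h.
(* The contraction hypothesis concerns words of length [mu] only; mild regularity supplies the
   Lipschitz constants of single maps needed for shorter words. *)
have /choice[Kc KcP] : forall jc : B * 'I_n, exists K, 0 <= K /\ forall x y, H x -> H y ->
    `|theta jc.1 x 0 jc.2 - theta jc.1 y 0 jc.2| <= K * `|x - y|.
  by move=> [j c]; have [K K0 hK] := mildly_regular_lipschitz bH oH rH (Cthm j c); exists K.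
have thL j x y : H x -> H y -> `|theta j x - theta j y| <= (\sum_(c < n) \sum_jc Kc jc) * `|x - y|.
  move=> Hx Hy; rewrite (le_trans (rv_norm_le_sum _))//.
  rewrite mulr_suml; apply: ler_sum => c _.
  have [_ /(_ x y Hx Hy) h] := KcP (j, c); rewrite !mxE (le_trans h)// ler_wpM2r//.
  by rewrite (bigD1 (j, c))//= lerDl sumr_ge0// => l _; have [] := KcP l.
have [C [q [C0 q01 thC]]] := geometric_contraction Hth normN mu0 k1 thL thk.
split=> [s t|].
  exact: (spec_radius_decreasing bH oH H0 rH B0 Hth cth Cthm cb b0 Cb C0 q01 thC k0 b1).
split.
  exact: (spec_radius_analytic bH oH H0 rH B0 Hth cth Cthm cb b0 Cb C0 q01 thC).
exact: (spec_radius_cvg0 bH oH H0 rH B0 Hth cth Cthm cb b0 Cb C0 q01 thC k0 b1).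
Qed.
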